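(* There is a constant $c_1>0$ depending only on the weighted graph $G$ (and on $\alpha,\beta$), and for every $K>0$ and $0<\nu'<\nu$ there is a constant $c(K,\nu')\ge 10^6c_0$ depending only on the weighted graph and on $K,\nu'$, such that the following holds whenever $\ell_0\ge c(K,\nu')$ and $L_0\ge 1$ (with $L_n=\ell_0^nL_0$). For $u_0>0$ and $n\ge 0$ set $$u_n^{\pm}=\prod_{0\le k<n}\Big(1+c_1\frac{\sqrt K}{(k+1)^{3/2}}\,\ell_0^{-\frac{\nu-\nu'}{2}}\Big)^{\pm1}u_0,\qquad u_\infty^{\pm}=\prod_{k\ge0}\Big(1+c_1\frac{\sqrt K}{(k+1)^{3/2}}\,\ell_0^{-\frac{\nu-\nu'}{2}}\Big)^{\pm1}u_0,$$ and for $u>0$ set $$\varepsilon(u)=\frac{2e^{-KuL_0^\nu\ell_0^{\nu'}}}{1-e^{-KuL_0^\nu\ell_0^{\nu'}}}.$$ Then for any $u_0>0$, $n\ge 0$, $\mathcal T\in\Lambda_n$, and all $\mathcal T$-adapted collections $A_m$, $m\in T_{(n)}$, of decreasing events on $\{0,1\}^E$, respectively $B_m$, $m\in T_{(n)}$, of increasing events on $\{0,1\}^E$, one has $$\mathbb P\Big[\bigcap_{m\in T_{(n)}}A_m^{u_\infty^+}\Big]\le\mathbb P\Big[\bigcap_{m\in T_{(n)}}A_m^{u_n^+}\Big]\le\prod_{m\in T_{(n)}}\big(\mathbb P[A_m^{u_0}]+\varepsilon(u_0)\big),$$ respectively $$\mathbb P\Big[\bigcap_{m\in T_{(n)}}B_m^{u_\infty^-}\Big]\le\mathbb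 P\Big[\bigcap_{m\in T_{(n)}}B_m^{u_n^-}\Big]\le\prod_{m\in T_{(n)}}\big(\mathbb P[B_m^{u_0}]+\varepsilon(u_\infty^-)\big).$$
   Context: Setting. $G$ is an infinite connected graph of bounded degree (countable vertex set), with graph distance $d_G$ and closed balls $B_G(y,r)$, endowed with a weight $\rho^G$: a symmetric non-negative function on $G\times G$ with $\rho^G_{y,y'}>0$ iff $y\sim y'$ (neighbors), such that $\rho^G_{y,y'}$ is uniformly bounded and uniformly positive over edges. Write $\rho^G(y)=\sum_{y'\sim y}\rho^G_{y,y'}$, $\rho^G(U)=\sum_{y\in U}\rho^G(y)$. Assume for some $\alpha>1$ that $cR^\alpha\le\rho^G(B_G(y,R))\le c'R^\alpha$ for all $R\ge\frac12$, $y\in G$. $E=G\times\mathbb Z$ is the graph in which $(y,z)\sim(y',z')$ iff ($y\sim y'$ and $z=z'$) or ($y=y'$ and $|z-z'|=1$), with weights $\rho_{x,x'}=\rho^G_{y,y'}$ on the first type of edges, $1$ on the second type, $0$ otherwise; $\rho(x)=\sum_{x'\sim x}\rho_{x,x'}$. $P_x$ is the law of the walk $(X_n)_{n\ge0}$ on $E$ started at $x$ with transition probability $\rho_{x,x'}/\rho(x)$, and $g(x,x')=\sum_{n\ge0}P_x[X_n=x']/\rho(x')$ is the Green density. Assume there is $\beta\in[2,1+\alpha]$ such that, with $\nu=\alpha-\frac\beta2>0$ and $d(x,x')=\max\{d_G(y,y'),|z-z'|^{2/\beta}\}$ for $x=(y,z),x'=(y',z')$, one has $c(d(x,x')\vee1)^{-\nu}\le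 g(x,x')\le c'(d(x,x')\vee1)^{-\nu}$ for all $x,x'\in E$. $B(x,r)$ is the closed $d$-ball in $E$. Interlacements. For finite $K\subset E$, $\mathrm{cap}(K)=\sum_{x\in K}P_x[X_n\notin K\text{ for all }n\ge1]\,\rho(x)$. On a probability space $(\Omega,\mathcal A,\mathbb P)$ one has the random interlacements $\mathcal I^u\subseteq E$, $u\ge0$ (non-decreasing in $u$); the law of $\mathcal I^u$ is characterized by $\mathbb P[\mathcal I^u\cap K=\emptyset]=e^{-u\,\mathrm{cap}(K)}$ for all finite $K\subset E$. For a measurable $A\subseteq\{0,1\}^E$, $A^u=\{\omega:\chi_{\mathcal I^u(\omega)}\in A\}$, where $\chi_U$ is the indicator function of $U$. Increasing/decreasing events on $\{0,1\}^E$ refer to the coordinatewise partial order; $\Psi_x$, $x\in E$, are the canonical coordinates. Scales and trees. $c_0>1$ is a fixed constant, depending only on the weighted graph, for which the following Harnack inequality holds with some constant $c$: $\max_{B(x,L)}v\le c\min_{B(x,L)}v$ for all $x\in E$, $L\ge1$ and all non-negative $v$ on the closure (set together with its neighbors) of $B(x,c_0L)$ that are harmonic for the walk in $B(x,c_0L)$. $L_n=\ell_0^nL_0$, $n\ge0$, with $L_0\ge1$, $\ell_0\ge10^6c_0$. $T_n=\bigcup_{0\le k\le n}\{1,2\}^k$ is the dyadic tree of depth $n$, $T_{(k)}=\{1,2\}^k$. $\Lambda_n$ is the set of maps $\mathcal T:T_n\to E$ such that, with $x_{m,\mathcal T}=\mathcal T(m)$ and $\widetilde C_{m,\mathcal T}=B(x_{m,\mathcal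 T},10L_{n-k})$ for $m\in T_{(k)}$, $0\le k\le n$, one has for all $0\le k<n$, $m\in T_{(k)}$, and its two descendants $m_1,m_2\in T_{(k+1)}$ (concatenating $1$, resp. $2$, to $m$): $\widetilde C_{m_1,\mathcal T}\cup\widetilde C_{m_2,\mathcal T}\subseteq\widetilde C_{m,\mathcal T}$ and $d(x_{m_1,\mathcal T},x_{m_2,\mathcal T})\ge\frac1{100}L_{n-k}$. A collection $A_m$, $m\in T_{(n)}$, of measurable subsets of $\{0,1\}^E$ is $\mathcal T$-adapted if $A_m$ is $\sigma(\Psi_x,x\in\widetilde C_{m,\mathcal T})$-measurable for each $m\in T_{(n)}$. *)

(* Defs.v *)
From HB Require Import structures.
From mathcomp Require Import all_boot all_order all_algebra.
From mathcomp Require Import all_classical all_reals all_analysis.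

Set Implicit Arguments.
Unset Strict Implicit.
Unset Printing Implicit Defensive.
Import Order.TTheory GRing.Theory Num.Theory.
Import numFieldNormedType.Exports.

Local Open Scope classical_set_scope.
Local Open Scope ring_scope.

HB.instance Definition _ := isPointed.Build int 0.

(** The graph $G$ is simple: [adj] is symmetric and irreflexive.  The vertex
    type is pointed only because the measurable types of the library are. *)
Record weighted_graph (R : realType) (V : pointedType) := WeightedGraph {
  adj : rel V ;
  weight : V -> V -> R ;
  adj_sym : symmetric adj ;
  adj_irr : irreflexive adj ;
  graph_countable : countable [set: V] ;
  graph_infinite : infinite_set [set: V] ;
  graph_connected : forall y y', exists2 p, path adj y p & last y p = y' ;
  graph_bounded_degree : exists D : nat, forall y,
    ([set y' | adj y y'] #<= `I_D)%card ;
  weight_sym : forall y y', weight y y' = weight y' y ;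
  weight_ge0 : forall y y', 0 <= weight y y' ;
  weight_gt0 : forall y y', (0 < weight y y') = adj y y' ;
  weight_bounds : exists a b : R, 0 < a /\
    forall y y', adj y y' -> a <= weight y y' <= b }.

(** $\rho(x) = \sum_{x' \sim x} \rho_{x,x'}$, for $G$ as well as for $E$. *)
Definition vertex_weight (R : realType) (T : choiceType) (a : rel T)
    (w : T -> T -> R) (x : T) : R :=
  \sum_(x' \in [set x' | a x x']) w x x'.

Section graph.
Variables (R : realType) (V : pointedType) (G : weighted_graph R V).
Implicit Types (y : V) (x : V * int).

Definition gdist y y' : R :=
  inf [set (size p)%:R | p in [set p | path (adj G) y p /\ last y p = y']].

Definition gball y (r : R) : set V := [set y' | gdist y y' <= r].

Definition volume_growth (alpha : R) : Prop :=
  exists c c' : R, 0 < c /\ forall y r, 1 / 2 <= r ->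
    c * r `^ alpha
      <= \sum_(y' \in gball y r) vertex_weight (adj G) (weight G) y'
      <= c' * r `^ alpha.

Definition adjE : rel (V * int) := fun x x' =>
  (adj G x.1 x'.1 && (x.2 == x'.2)) ||
  ((x.1 == x'.1) && (`|x.2 - x'.2| == 1)).

Definition weightE x x' : R :=
  if adj G x.1 x'.1 && (x.2 == x'.2) then weight G x.1 x'.1
  else if (x.1 == x'.1) && (`|x.2 - x'.2| == 1) then 1 else 0.

Definition rhoE x : R := vertex_weight adjE weightE x.

Definition distE (beta : R) x x' : R :=
  Num.max (gdist x.1 x'.1) ((`|x.2 - x'.2|%:~R) `^ (2 / beta)).

Definition ballE (beta : R) x (r : R) : set (V * int) :=
  [set x' | distE beta x x' <= r].

Definition closureE (U : set (V * int)) : set (V * int) :=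
  U `|` [set x | exists2 x', U x' & adjE x x'].

Definition harmonic_on (U : set (V * int)) (v : V * int -> R) : Prop :=
  forall x, U x ->
    v x = \sum_(x' \in [set x' | adjE x x']) weightE x x' / rhoE x * v x'.

(** The balls are finite and nonempty, so [sup] and [inf] are a maximum and a
    minimum. *)
Definition harnack (beta c0 : R) : Prop :=
  exists C : R, forall x (L : R) (v : V * int -> R), 1 <= L ->
    (forall x', closureE (ballE beta x (c0 * L)) x' -> 0 <= v x') ->
    harmonic_on (ballE beta x (c0 * L)) v ->
    sup (v @` ballE beta x L) <= C * inf (v @` ballE beta x L).

End graph.

(** [<<s coord_system C >>] is the sigma-algebra on [I -> T] generated by the
    coordinates in [C], where [T] carries the discrete sigma-algebra. *)
Definition coord_system (I T : Type) (C : set I) : set (set (I -> T)) :=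
  \bigcup_(i in C) preimage_set_system setT (fun w : I -> T => w i) setT.
Arguments coord_system {I} T C.

Definition paths (E : pointedType) :=
  g_sigma_algebraType (coord_system E [set: nat]).

Section walk.
Variables (R : realType) (V : pointedType) (G : weighted_graph R V).

(** On the canonical path space the finite-dimensional laws determine [P x]. *)
Definition walk_law (P : V * int -> probability (paths (V * int)%type) R) :
    Prop :=
  forall x (n : nat) (s : nat -> V * int),
    P x [set w | forall i, (i <= n)%N -> w i = s i] =
    ((s 0%N == x)%:R *
     \prod_(i < n) (weightE G (s i) (s i.+1) / rhoE G (s i)))%:E.

Variable P : V * int -> probability (paths (V * int)%type) R.

Definition green (x x' : V * int) : \bar R :=
  (\sum_(0 <= n <oo) P x [set w | w n = x'] * (rhoE G x')^-1%:E)%E.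

Definition green_bounds (beta nu : R) : Prop :=
  exists c c' : R, 0 < c /\ forall x x',
    ((c * Num.max (distE G beta x x') 1 `^ (- nu))%:E <= green x x'
      <= (c' * Num.max (distE G beta x x') 1 `^ (- nu))%:E)%E.

Definition cap (K : set (V * int)) : R :=
  \sum_(x \in K)
    fine (P x [set w | forall n, (1 <= n)%N -> ~ K (w n)]) * rhoE G x.

Definition random_interlacements d (Omega : measurableType d)
    (mu : probability Omega R) (I : R -> Omega -> set (V * int)) : Prop :=
  [/\ forall u x, 0 <= u -> measurable [set om | I u om x],
      forall u u' om, 0 <= u -> u <= u' -> I u om `<=` I u' om
    & forall u (K : set (V * int)), 0 <= u -> finite_set K ->
        mu [set om | I u om `&` K = set0] = (expR (- (u * cap K)))%:E].

End walk.

Definition event_at (R : realType) (E Omega : Type)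
    (I : R -> Omega -> set E) (A : set (E -> bool)) (u : R) : set Omega :=
  [set om | A (fun x => x \in I u om)].

Definition increasing_event (E : Type) (A : set (E -> bool)) : Prop :=
  forall w w' : E -> bool, (forall x, w x -> w' x) -> A w -> A w'.

Definition decreasing_event (E : Type) (A : set (E -> bool)) : Prop :=
  forall w w' : E -> bool, (forall x, w x -> w' x) -> A w' -> A w.

(** The letters 1, 2 are encoded by [false], [true]: the tree $T_n$ is
    [n.-bseq bool] (words of length at most n), its leaves $T_{(n)}$ are
    [n.-tuple bool], and the descendants of [m] are [rcons m false] and
    [rcons m true]. *)
Section trees.
Variables (R : realType) (V : pointedType) (G : weighted_graph R V).
Variables (beta ell0 L0 : R).

Definition scale (n : nat) : R := ell0 ^+ n * L0.

Definition box n (T : n.-bseq bool -> V * int) (m : n.-bseq bool) :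
    set (V * int) :=
  ballE G beta (T m) (10 * scale (n - size m)).

Definition Lambda n : set (n.-bseq bool -> V * int) :=
  [set T | forall m m1 m2 : n.-bseq bool,
    m1 = rcons m false :> seq bool -> m2 = rcons m true :> seq bool ->
    box T m1 `|` box T m2 `<=` box T m /\
    scale (n - size m) / 100 <= distE G beta (T m1) (T m2)].

Definition adapted n (T : n.-bseq bool -> V * int)
    (A : n.-tuple bool -> set (V * int -> bool)) : Prop :=
  forall m : n.-tuple bool, <<s coord_system bool (box T m) >> (A m).

End trees.

Section levels.
Variables (R : realType) (c1 K nu nu' ell0 u0 : R).

Definition sprinkling (k : nat) : R :=
  1 + c1 * (Num.sqrt K / k.+1%:R `^ (3 / 2)) * ell0 `^ (- ((nu - nu') / 2)).

Definition u_plus (n : nat) : R := (\prod_(k < n) sprinkling k) * u0.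
Definition u_minus (n : nat) : R := (\prod_(k < n) (sprinkling k)^-1) * u0.
Definition u_plus_infty : R := limn u_plus.
Definition u_minus_infty : R := limn u_minus.

End levels.

Definition epsilon (R : realType) (K nu nu' ell0 L0 u : R) : R :=
  let e := expR (- (K * u * L0 `^ nu * ell0 `^ nu')) in 2 * e / (1 - e).

(* Main.v *)
Require Import Defs.
From HB Require Import structures.
From mathcomp Require Import all_boot all_order all_algebra.
From mathcomp Require Import all_classical all_reals all_analysis.
From mathcomp Require Import ring lra.

Set Implicit Arguments.
Unset Strict Implicit.
Unset Printing Implicit Defensive.
Import Order.TTheory GRing.Theory Num.Theory.
Import numFieldNormedType.Exports.

Local Open Scope classical_set_scope.
Local Open Scope ring_scope.

(** On a finite set [C], the interlacement at level [u] is a Poisson union of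
    traces of walks started from [u] times the equilibrium measure of [C]; since
    only avoidance probabilities are given, this is obtained by inclusion-exclusion
    and as a limit over finite time horizons.  Let [C] consist of two pieces of
    radius [r] at distance at least [12 r], with neighbourhoods [U1] and [U2].
    The walks that do not come back to [C] after leaving [U1] and [U2] meet only
    one piece, hence contribute independently to the two pieces.  By time reversal
    and the maximum principle, a walk that comes back enters [C] with a law bounded
    by a multiple [a = O(r ^ - nu)] of the equilibrium measure, so the remaining
    traces are dominated by a geometric series of unions of independent excursions.
    Exponential moments show that they are absorbed when the level is multiplied
    by [1 + del], up to an error [exp (- c del ^ 2 u r ^ nu)].  Along the tree, this
    is applied at each scale to the two subtrees of a vertex, and the errors are
    distributed over the leaves by [\prod_i a_i + b ^ N <= \prod_i (a_i + b)]. *)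

(** * Poisson processes of finite sets *)

(** No point process of walks is given, so Poisson means are defined as finite linear functionals,
    and the time horizon is sent to infinity only in inequalities between such means. The absorption
    compares numbers of excursions. All excursions are replaced by draws from one normalised law.
    Except with exponentially small probability, the returning walks bring at most [t] draws and the
    extra single walks at least [t]; monotonicity does the rest. Scales: r = L_{n+1}/1200, and del
    is of order sqrt(K) (n+1)^(-3/2) ell0^(-(nu-nu')/2). Then del^2 u r^nu is of order K u L0^nu
    ell0^nu' times ell0^(n nu)/(n+1)^3, and ell0^nu >= 32 lets the last factor beat (n+1) 2^n. So
    the error at depth n is at most the 2^n-th power of 2 q^(n+1), with q = exp(-K u L0^nu
    ell0^nu'), and a leaf collects at most 2q + 2q^2 + ... = epsilon(u). The power 3/2 makes the
    product of the factors 1 + del converge. *)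

Lemma cvg_rsum (R : realType) (I : Type) (r : seq I) (f : I -> nat -> R)
    (l : I -> R) :
  (forall i, f i n @[n --> \oo] --> l i) ->
  (\sum_(i <- r) f i n) @[n --> \oo] --> \sum_(i <- r) l i.
Proof.
move=> h; elim: r => [|i r IH].
  by rewrite big_nil; under eq_cvg do rewrite big_nil; exact: cvg_cst.
rewrite big_cons; under eq_cvg do rewrite big_cons.
by apply: cvgD; [exact: h|exact: IH].
Qed.

Lemma cvg_seq_le (R : realType) (u v : nat -> R) (l l' : R) :
  u @ \oo --> l -> v @ \oo --> l' -> (forall n, u n <= v n) -> l <= l'.
Proof. by move=> ul vl h; apply: (ler_cvg_to ul vl); near=> n.
Unshelve. all: by end_near. Qed.

Section Poisson.
Variables (R : realType) (X : finType).
Implicit Types (m w : {set X} -> R) (F : {set X} -> R) (K S : {set X}).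

Definition avoid K S : R := (S :&: K == finset.set0)%:R.

Definition mono F := forall S S' : {set X}, S \subset S' -> F S <= F S'.

Lemma avoidU K S S' : avoid K (S :|: S') = avoid K S * avoid K S'.
Proof. by rewrite /avoid finset.setIUl finset.setU_eq0 -natrM mulnb. Qed.

Lemma avoidUr K K' S : avoid (K :|: K') S = avoid K S * avoid K' S.
Proof. by rewrite /avoid finset.setIUr finset.setU_eq0 -natrM mulnb. Qed.

Lemma avoid0 K : avoid K finset.set0 = 1.
Proof. by rewrite /avoid finset.set0I eqxx. Qed.

Definition spanned F := exists c : {set X} -> R,
  forall S, F S = \sum_K c K * avoid K S.

Lemma spanned_avoid K : spanned (avoid K).
Proof.
exists (fun K' => (K' == K)%:R) => S; rewrite (bigD1 K) //= eqxx mul1r.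
by rewrite big1 ?addr0 // => K' /negbTE ->; rewrite mul0r.
Qed.

Lemma spanned_lin a F F' : spanned F -> spanned F' ->
  spanned (fun S => F S + a * F' S).
Proof.
move=> [c hc] [c' hc']; exists (fun K => c K + a * c' K) => S.
rewrite hc hc' mulr_sumr -big_split /=.
by apply: eq_bigr => K _; rewrite mulrDl mulrA.
Qed.

Lemma spanned_ext F F' : F =1 F' -> spanned F -> spanned F'.
Proof. by move=> h [c hc]; exists c => S; rewrite -h. Qed.

Lemma spanned0 : spanned (fun=> 0).
Proof. by exists (fun=> 0) => S; rewrite big1 // => K _; rewrite mul0r. Qed.

Lemma spanned_sum (J : finType) (F : J -> {set X} -> R) (c : J -> R) :
  (forall j, spanned (F j)) -> spanned (fun S => \sum_j c j * F j S).
Proof.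
move=> h.
pose Q (s : seq J) := spanned (fun S => \sum_(j <- s) c j * F j S).
suff: Q (index_enum J) by [].
elim: (index_enum J) => [|j s IH]; rewrite /Q.
  by apply: spanned_ext spanned0 => S; rewrite big_nil.
apply: spanned_ext (spanned_lin (c j) IH (h j)) => S.
by rewrite big_cons addrC.
Qed.

Lemma spannedM F F' : spanned F -> spanned F' -> spanned (fun S => F S * F' S).
Proof.
move=> [c hc] [c' hc'].
have h K : spanned (fun S => \sum_K' c' K' * avoid (K :|: K') S).
  by apply: spanned_sum => K'; exact: spanned_avoid.
apply: spanned_ext (spanned_sum c h) => S; rewrite hc hc' mulr_suml.
apply: eq_bigr => K _; rewrite -mulrA; congr (_ * _); rewrite mulr_sumr.
by apply: eq_bigr => K' _; rewrite avoidUr mulrCA.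
Qed.

(** Inclusion-exclusion: the indicator is the product over the points [x] of [avoid [set x]] or of
    one minus it, and a product of functions [avoid] is [avoid] of the union. *)
Lemma spanned_delta S0 : spanned (fun S => (S == S0)%:R).
Proof.
pose f (x : X) S : R :=
  if x \in S0 then 1 - avoid [set x]%SET S else avoid [set x]%SET S.
have av1 x S : avoid [set x]%SET S = (x \notin S)%:R.
  rewrite /avoid; congr (nat_of_bool _)%:R; apply/eqP/idP => [h|h].
    apply/negP => xS.
    have : x \in S :&: [set x]%SET by rewrite !inE xS eqxx.
    by rewrite h inE.
  apply/finset.setP => y; rewrite !inE; case: eqP => [->|]; last by rewrite andbF.
  by rewrite (negbTE h).
have fE x S : f x S = ((x \in S0) == (x \in S))%:R.
  by rewrite /f av1; case: (x \in S0); case: (x \in S); rewrite ?subr0 ?subrr.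
have : spanned (fun S => \prod_x f x S).
  elim: (index_enum X) => [|x s IH].
    apply: spanned_ext (spanned_avoid finset.set0) => S.
    by rewrite big_nil /avoid finset.setI0 eqxx.
  suff h : spanned (f x).
    by apply: spanned_ext (spannedM h IH) => S; rewrite big_cons.
  rewrite /f; case: (x \in S0); last exact: spanned_avoid.
  apply: spanned_ext (spanned_lin (-1) (spanned_avoid finset.set0)
    (spanned_avoid [set x]%SET)) => S.
  by rewrite mulN1r {1}/avoid finset.setI0 eqxx.
apply: spanned_ext => S; rewrite (eq_bigr _ (fun x _ => fE x S)).
case: eqP => [->|/eqP neq].
  by rewrite big1 // => x _; rewrite eqxx.
have [x hx] : exists x, (x \in S0) != (x \in S).
  apply/existsP; apply: contraNT neq; rewrite negb_exists => /forallP h.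
  by apply/eqP/finset.setP => x; have := h x; rewrite negbK eq_sym => /eqP.
by rewrite (bigD1 x) //= (negbTE hx) mul0r.
Qed.

Definition coef S0 : {set X} -> R := sval (cid (spanned_delta S0)).

Lemma coefE S0 S : (S == S0)%:R = \sum_K coef S0 K * avoid K S.
Proof. by rewrite /coef; case: cid => c /= ->. Qed.

(** Inversion: a weight on sets, possibly signed, is determined by its avoidance sums. Hence
    avoidance probabilities suffice to identify laws and, through [weight_cvg], to prove their
    convergence. *)
Lemma weight_coef w S0 :
  w S0 = \sum_K coef S0 K * \sum_S w S * avoid K S.
Proof.
under eq_bigr do rewrite mulr_sumr.
rewrite exchange_big /= (bigD1 S0) //= [X in _ + X]big1 ?addr0.
  under eq_bigr do rewrite mulrCA.
  by rewrite -mulr_sumr -coefE eqxx mulr1.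
move=> S /negbTE neq; under eq_bigr do rewrite mulrCA.
by rewrite -mulr_sumr -coefE neq mulr0.
Qed.

Lemma weight_cvg (v : nat -> {set X} -> R) w :
  (forall K, (\sum_S v j S * avoid K S) @[j --> \oo] -->
     \sum_S w S * avoid K S) ->
  forall F, (\sum_S v j S * F S) @[j --> \oo] --> \sum_S w S * F S.
Proof.
move=> h.
have hw S : v j S @[j --> \oo] --> w S.
  rewrite weight_coef.
  under eq_cvg do rewrite weight_coef.
  apply: cvg_rsum => K; apply: cvgM; [exact: cvg_cst|exact: h].
move=> F; apply: cvg_rsum => S; apply: cvgM; [exact: hw|exact: cvg_cst].
Qed.

Definition op m F : {set X} -> R := fun S => \sum_S' m S' * F (S :|: S').

Definition hit m K : R := \sum_S m S * (1 - avoid K S).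

Definition mass m : R := \sum_S m S.

(** The Poisson series cut at fewer than [J] marks. For nonnegative data its terms are visibly
    nonnegative, whereas [pois_weight] is a signed sum; [psum_cvg] carries positivity and termwise
    estimates over to [pois]. *)
Definition psum m (J : nat) F : R :=
  expR (- mass m) * \sum_(0 <= j < J) iter j (op m) F finset.set0 / j`!%:R.

(* [pois m F] is the mean of [F] of the union of a Poisson process of marks of
   intensity [m]; it is determined by its values on the functions [avoid K]. *)
Definition pois_weight m S0 : R := \sum_K coef S0 K * expR (- hit m K).

Definition pois m F : R := \sum_S pois_weight m S * F S.

Lemma op_ext m F F' : F =1 F' -> op m F =1 op m F'.
Proof. by move=> h S; apply: eq_bigr => S' _; rewrite h. Qed.

Lemma iter_op_ext m j F F' : F =1 F' -> iter j (op m) F =1 iter j (op m) F'.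
Proof. by move=> h; elim: j => //= j IH; exact: op_ext. Qed.

Lemma op_lin m a F F' S :
  op m (fun S => F S + a * F' S) S = op m F S + a * op m F' S.
Proof.
rewrite /op mulr_sumr -big_split /=.
by apply: eq_bigr => S' _; rewrite mulrDr mulrCA.
Qed.

Lemma iter_op_lin m j a F F' S :
  iter j (op m) (fun S => F S + a * F' S) S =
  iter j (op m) F S + a * iter j (op m) F' S.
Proof.
elim: j S => //= j IH S.
by rewrite -op_lin; apply: op_ext => S'; rewrite IH.
Qed.

Lemma iter_op0 m j S : iter j (op m) (fun=> 0) S = 0.
Proof.
have := iter_op_lin m j (-1) (fun=> 0) (fun=> 0) S.
rewrite (@iter_op_ext m j _ (fun=> 0)); last by move=> ?; rewrite mulr0 addr0.
by rewrite mulN1r subrr.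
Qed.

Lemma iter_op_sum m j F S :
  iter j (op m) F S = \sum_S0 F S0 * iter j (op m) (fun S => (S == S0)%:R) S.
Proof.
rewrite (@iter_op_ext m j _ (fun S => \sum_S0 F S0 * (S == S0)%:R)); last first.
  move=> S'; rewrite (bigD1 S') //= eqxx mulr1 big1 ?addr0 // => i /negbTE.
  by rewrite eq_sym => ->; rewrite mulr0.
elim: (index_enum _) => [|S0 s IH].
  rewrite big_nil (@iter_op_ext m j _ (fun=> 0)) ?iter_op0 // => S'.
  by rewrite big_nil.
rewrite big_cons addrC -IH -iter_op_lin; apply: iter_op_ext => S'.
by rewrite big_cons addrC.
Qed.

(** [avoid K] is an eigenvector of [op m]: a further mark multiplies it by the weight of the marks
    that miss [K]. The Poisson series becomes an exponential series and gives the void probability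
    [expR (- hit m K)]. *)
Lemma iter_op_avoid m j K S :
  iter j (op m) (avoid K) S = (mass m - hit m K) ^+ j * avoid K S.
Proof.
elim: j S => [|j IH] S; first by rewrite mul1r.
rewrite iterS (@op_ext m _ (fun S => (mass m - hit m K) ^+ j * avoid K S))//.
rewrite /op exprSr -!mulrA.
have -> : mass m - hit m K = \sum_S' m S' * avoid K S'.
  rewrite /mass /hit -sumrB; apply: eq_bigr => S' _.
  by rewrite mulrBr mulr1 opprB addrC subrK.
rewrite mulr_suml mulr_sumr; apply: eq_bigr => S' _.
by rewrite avoidU; ring.
Qed.

Lemma psum_weight m J F :
  psum m J F = \sum_S psum m J (fun S' => (S' == S)%:R) * F S.
Proof.
rewrite /psum; under [RHS]eq_bigr do rewrite mulrAC -mulrA.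
rewrite -mulr_sumr; congr (_ * _).
under [RHS]eq_bigr do rewrite mulr_sumr.
rewrite exchange_big /=; apply: eq_bigr => j _.
rewrite iter_op_sum mulr_suml; apply: eq_bigr => S _.
by rewrite mulrA.
Qed.

Lemma cvg_expR_series (x : R) :
  (\sum_(0 <= j < J) x ^+ j / j`!%:R) @[J --> \oo] --> expR x.
Proof.
have /cvgP := is_cvg_series_exp_coeff x.
exact.
Qed.

Lemma psum_avoid_cvg m K : psum m J (avoid K) @[J --> \oo] --> expR (- hit m K).
Proof.
have -> : - hit m K = - mass m + (mass m - hit m K) by rewrite addKr.
rewrite expRD; apply: cvgM; first exact: cvg_cst.
under eq_cvg.
  move=> J; under eq_bigr do rewrite iter_op_avoid avoid0 mulr1.
  over.
exact: cvg_expR_series.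
Qed.

Lemma psum_delta_cvg m S :
  psum m J (fun S' => (S' == S)%:R) @[J --> \oo] --> pois_weight m S.
Proof.
under eq_cvg.
  move=> J; rewrite (weight_coef (fun S => psum m J (fun S' => (S' == S)%:R))).
  under eq_bigr do rewrite -psum_weight.
  over.
by apply: cvg_rsum => K; apply: cvgM;
  [exact: cvg_cst|exact: psum_avoid_cvg].
Qed.

Lemma psum_cvg m F : psum m J F @[J --> \oo] --> pois m F.
Proof.
under eq_cvg do rewrite psum_weight.
by apply: cvg_rsum => S; apply: cvgM; [exact: psum_delta_cvg|exact: cvg_cst].
Qed.

Lemma pois_avoid m K : pois m (avoid K) = expR (- hit m K).
Proof.
have h1 := psum_cvg (m := m) (F := avoid K).
have h2 := psum_avoid_cvg (m := m) (K := K).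
exact: (cvg_unique _ h1 h2).
Qed.

End Poisson.

Section PoissonTheory.
Variables (R : realType) (X : finType).
Implicit Types (m w : {set X} -> R) (F : {set X} -> R) (K S : {set X}).

Lemma spannedT F : spanned F.
Proof.
apply: spanned_ext (spanned_sum F (@spanned_delta R X)) => S.
rewrite (bigD1 S) //= eqxx mulr1 big1 ?addr0 // => S' /negbTE.
by rewrite eq_sym => ->; rewrite mulr0.
Qed.

Lemma pois_sum m (J : finType) (c : J -> R) (F : J -> {set X} -> R) :
  pois m (fun S => \sum_j c j * F j S) = \sum_j c j * pois m (F j).
Proof.
rewrite /pois; under eq_bigr do rewrite mulr_sumr.
rewrite exchange_big; apply: eq_bigr => j _; rewrite mulr_sumr.
by apply: eq_bigr => S _; rewrite mulrCA.
Qed.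

Lemma pois_eq m F F' : F =1 F' -> pois m F = pois m F'.
Proof. by move=> h; apply: eq_bigr => S _; rewrite h. Qed.

Lemma pois_span m F c : (forall S, F S = \sum_K c K * avoid R K S) ->
  pois m F = \sum_K c K * expR (- hit m K).
Proof.
move=> /pois_eq ->; rewrite pois_sum.
by apply: eq_bigr => K _; rewrite pois_avoid.
Qed.

Lemma iter_op_ge0 m j F : (forall S, 0 <= m S) -> (forall S, 0 <= F S) ->
  forall S, 0 <= iter j (op m) F S.
Proof.
move=> m0 F0; elim: j => //= j IH S.
by apply: sumr_ge0 => S' _; rewrite mulr_ge0.
Qed.

Lemma pois_ge0 m F : (forall S, 0 <= m S) -> (forall S, 0 <= F S) ->
  0 <= pois m F.
Proof.
move=> m0 F0; apply: (cvg_seq_le (cvg_cst 0) (psum_cvg (m := m) (F := F))) => J.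
rewrite /psum mulr_ge0 ?expR_ge0 // sumr_ge0 // => j _.
by rewrite divr_ge0 ?iter_op_ge0.
Qed.

Lemma poisB m F F' : pois m (fun S => F S - F' S) = pois m F - pois m F'.
Proof. by rewrite /pois -sumrB; apply: eq_bigr => S _; rewrite mulrBr. Qed.

Lemma pois_le m F F' : (forall S, 0 <= m S) -> (forall S, F S <= F' S) ->
  pois m F <= pois m F'.
Proof.
by move=> m0 h; rewrite -subr_ge0 -poisB pois_ge0 // => S; rewrite subr_ge0.
Qed.

Lemma pois_cst m a : pois m (fun=> a) = a.
Proof.
have h : pois m (avoid R finset.set0) = 1.
  rewrite pois_avoid /hit big1 ?oppr0 ?expR0 // => S _.
  by rewrite /avoid finset.setI0 eqxx subrr mulr0.
rewrite -[RHS]mul1r -h /pois mulr_suml; apply: eq_bigr => S _.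
by rewrite /avoid finset.setI0 eqxx mulr1.
Qed.

Lemma hitD m m' K : hit (fun S => m S + m' S) K = hit m K + hit m' K.
Proof. by rewrite /hit -big_split /=; apply: eq_bigr => S _; rewrite mulrDl. Qed.

(** Superposition of independent processes. On the spanning functions [avoid K] it is the additivity
    of [hit] in the exponent. *)
Lemma poisD m m' F : pois (fun S => m S + m' S) F =
  pois m (fun S => pois m' (fun S' => F (S :|: S'))).
Proof.
have [c hc] := spannedT F.
rewrite (pois_span _ hc).
have h S : pois m' (fun S' => F (S :|: S')) =
    \sum_K (c K * expR (- hit m' K)) * avoid R K S.
  rewrite (pois_eq _ (F' := fun S' => \sum_K (c K * avoid R K S) * avoid R K S')).
    rewrite pois_sum; apply: eq_bigr => K _.
    by rewrite pois_avoid mulrAC.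
  by move=> S'; rewrite hc; apply: eq_bigr => K _; rewrite avoidU mulrA.
rewrite (pois_span _ h); apply: eq_bigr => K _.
by rewrite hitD opprD expRD -mulrA [X in c K * X]mulrC.
Qed.

(* Marks that leave no trace do not count. *)
Lemma pois_off0 m m' F : (forall S, S != finset.set0 -> m S = m' S) ->
  pois m F = pois m' F.
Proof.
move=> h; apply: eq_bigr => S _; congr (_ * _); apply: eq_bigr => K _.
congr (_ * expR (- _)); apply: eq_bigr => S' _.
have [->|/h -> //] := eqVneq S' finset.set0.
by rewrite avoid0 subrr !mulr0.
Qed.

(** Superposing the difference of the two intensities only enlarges the union. The empty mark is
    left out of the comparison, which makes padding with empty marks free. *)
Lemma pois_mono m m' F : (forall S, 0 <= m S) ->
  (forall S, S != finset.set0 -> m S <= m' S) -> mono F ->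
  pois m F <= pois m' F.
Proof.
move=> m0 h Fm.
pose r S := if S == finset.set0 then 0 else m' S - m S.
have r0 S : 0 <= r S by rewrite /r; case: ifPn => // /h; rewrite subr_ge0.
rewrite -(@pois_off0 (fun S => m S + r S) m'); last first.
  by move=> S /negbTE Sn0; rewrite /r Sn0 addrC subrK.
rewrite poisD; apply: pois_le => // S.
rewrite -[leLHS](pois_cst r); apply: pois_le => // S'.
by apply: Fm; exact: finset.subsetUl.
Qed.

(** Each mark lies in one of two disjoint parts, so the rate of hitting a set in [X1] or a set in
    [X2] is the sum of the two rates. Void probabilities then factor, and linearity extends this to
    all functions. *)
Lemma pois_indep m (X1 X2 : {set X}) F1 F2 : X1 :&: X2 = finset.set0 ->
  (forall S, m S != 0 -> (S \subset X1) || (S \subset X2)) ->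
  (forall S, F1 S = F1 (S :&: X1)) -> (forall S, F2 S = F2 (S :&: X2)) ->
  pois m (fun S => F1 S * F2 S) = pois m F1 * pois m F2.
Proof.
move=> X12 hm h1 h2.
have avI K S Y : avoid R K (S :&: Y) = avoid R (K :&: Y) S.
  by rewrite /avoid -finset.setIA [Y :&: K]finset.setIC.
have [c1 hc1] := spannedT F1; have [c2 hc2] := spannedT F2.
have {}hc1 S : F1 S = \sum_K c1 K * avoid R (K :&: X1) S.
  by rewrite h1 hc1; apply: eq_bigr => K _; rewrite avI.
have {}hc2 S : F2 S = \sum_K c2 K * avoid R (K :&: X2) S.
  by rewrite h2 hc2; apply: eq_bigr => K _; rewrite avI.
rewrite (pois_eq _ hc1) (pois_eq _ hc2) !pois_sum mulr_suml.
rewrite (pois_eq _ (F' := fun S => \sum_K1 c1 K1 * (avoid R (K1 :&: X1) S * F2 S))); last first.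
  by move=> S; rewrite hc1 mulr_suml; apply: eq_bigr => K _; rewrite mulrA.
rewrite pois_sum; apply: eq_bigr => K1 _; rewrite -mulrA; congr (_ * _).
rewrite (pois_eq _ (F' := fun S => \sum_K2 c2 K2 *
    avoid R ((K1 :&: X1) :|: (K2 :&: X2)) S)); last first.
  move=> S; rewrite hc2 mulr_sumr; apply: eq_bigr => K _.
  by rewrite avoidUr mulrCA.
rewrite pois_sum mulr_sumr; apply: eq_bigr => K2 _; rewrite mulrCA; congr (_ * _).
rewrite !pois_avoid -expRD -opprD; congr (expR (- _)).
rewrite /hit -big_split; apply: eq_bigr => S _ /=.
have [->|/hm] := eqVneq (m S) 0; first by rewrite !mul0r addr0.
have av1 Y Z K : Y :&: Z = finset.set0 -> S \subset Y -> avoid R (K :&: Z) S = 1.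
  move=> YZ SY; rewrite /avoid; apply/eqP; rewrite pnatr_eq1 eqb1 -finset.subset0 -YZ.
  apply/fintype.subsetP => x; rewrite !inE => /and3P[xS _ ->].
  by rewrite (fintype.subsetP SY).
case/orP => SX; rewrite avoidUr.
  by rewrite (av1 X1 X2 K2) // subrr mulr0 addr0 mulr1.
by rewrite (av1 X2 X1 K1) ?subrr ?mulr0 ?add0r ?mul1r // finset.setIC.
Qed.

End PoissonTheory.

(** * Comparison of Poisson means through the number of independent draws *)

Section PolyOp.
Variables (R : realType) (X : finType) (g : {set X} -> R).
Implicit Types (F : {set X} -> R) (S : {set X}) (p q : {poly R}).
Local Notation iop k F := (iter k (op g) F).

(** [q] evaluated at the operator [op g]: the coefficient of degree [k] is the rate of groups of [k]
    independent marks. Evaluation is a ring morphism, so [j] groups correspond to [q ^+ j]; the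
    values of [q] at [1] and at [expR 1] are the total rate and an exponential moment. *)
Definition polyop q F S : R := \sum_(k < size q) q`_k * iop k F S.

Lemma polyop_widen n q F S : (size q <= n)%N ->
  polyop q F S = \sum_(k < n) q`_k * iop k F S.
Proof.
move=> h; rewrite /polyop (big_ord_widen_cond _ xpredT (fun k => q`_k * iop k F S) h).
rewrite big_mkcond; apply: eq_bigr => k _ /=.
by case: ltnP => // hk; rewrite nth_default ?mul0r.
Qed.

Lemma polyop_ext q F F' : F =1 F' -> polyop q F =1 polyop q F'.
Proof. by move=> h S; apply: eq_bigr => k _; rewrite (iter_op_ext _ _ h). Qed.

Lemma polyopD p q F S : polyop (p + q) F S = polyop p F S + polyop q F S.
Proof.
pose n := maxn (size (p + q)) (maxn (size p) (size q)).
rewrite !(@polyop_widen n) ?leq_max ?leqnn ?orbT // -big_split /=.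
by apply: eq_bigr => k _; rewrite coefD mulrDl.
Qed.

Lemma polyopC c F S : polyop c%:P F S = c * F S.
Proof.
rewrite (@polyop_widen 1) ?size_polyC ?leq_b1 //.
by rewrite big_ord_recl big_ord0 addr0 coefC.
Qed.

Lemma polyopMX q F S : polyop (q * 'X) F S = polyop q (op g F) S.
Proof.
rewrite (@polyop_widen (size q).+1); last first.
  by apply: leq_trans (size_polyMleq _ _) _; rewrite size_polyX addn2.
rewrite big_ord_recl coefMX /= mul0r add0r; apply: eq_bigr => k _.
by rewrite /bump /= add1n coefMX /= -iterS iterSr.
Qed.

Lemma polyop_op q F S : polyop q (op g F) S = op g (polyop q F) S.
Proof.
rewrite /polyop.
transitivity (\sum_(k < size q) q`_k * op g (iop k F) S).
  by apply: eq_bigr => k _; rewrite -iterSr iterS.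
under eq_bigr do rewrite mulr_sumr.
rewrite exchange_big /=; apply: eq_bigr => Y _; rewrite mulr_sumr.
by apply: eq_bigr => k _; rewrite mulrCA.
Qed.

Lemma polyopM p q F S : polyop (p * q) F S = polyop p (polyop q F) S.
Proof.
elim/poly_ind: p F S => [|p c IH] F S.
  by rewrite mul0r -[0 in LHS]/(0%:P) -[0 in RHS]/(0%:P) !polyopC !mul0r.
rewrite mulrDl !polyopD mulrAC !polyopMX IH.
rewrite (polyop_ext p (polyop_op q F)); congr (_ + _).
rewrite polyopC /polyop; rewrite mulr_sumr.
transitivity (\sum_(k < size q) (c%:P * q)`_k * iop k F S).
  apply: polyop_widen; apply: leq_trans (size_polyMleq _ _) _.
  by rewrite size_polyC; case: (c != 0); rewrite ?add1n //= leq_pred.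
by apply: eq_bigr => k _; rewrite coefCM mulrA.
Qed.

Lemma polyopX q j F S : iter j (polyop q) F S = polyop (q ^+ j) F S.
Proof.
elim: j S => [|j IH] S; first by rewrite expr0 polyopC mul1r.
by rewrite iterS exprS polyopM; apply: polyop_ext.
Qed.

Hypothesis g0 : forall S, 0 <= g S.

Lemma op_mono F : mono F -> mono (op g F).
Proof.
move=> h S S' SS'; apply: ler_sum => Y _; apply: ler_wpM2l => //.
by apply: h; exact: finset.setSU.
Qed.

Lemma iop_mono k F : mono F -> mono (iop k F).
Proof. by move=> h; elim: k => //= k; exact: op_mono. Qed.

Lemma iop_ge0 k F : (forall S, 0 <= F S) -> forall S, 0 <= iop k F S.
Proof. by move=> h S; exact: iter_op_ge0. Qed.

Lemma polyop_ge0 q F : (forall k, 0 <= q`_k) -> (forall S, 0 <= F S) ->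
  forall S, 0 <= polyop q F S.
Proof.
by move=> hq F0 S; apply: sumr_ge0 => k _; rewrite mulr_ge0 // iop_ge0.
Qed.

Lemma polyop_mono q F : (forall k, 0 <= q`_k) -> mono F -> mono (polyop q F).
Proof.
move=> hq h S S' SS'; apply: ler_sum => k _; apply: ler_wpM2l => //.
exact: iop_mono.
Qed.

Lemma op_shift m F S S' : op m (fun Y => F (S' :|: Y)) S = op m F (S' :|: S).
Proof. by apply: eq_bigr => Y _; rewrite finset.setUA. Qed.

Lemma iop_shift k F S S' : iop k (fun Y => F (S' :|: Y)) S = iop k F (S' :|: S).
Proof.
by elim: k S => //= k IH S; rewrite -op_shift; apply: op_ext => Y; rewrite IH.
Qed.

Hypothesis g1 : mass g = 1.

Lemma iop_cst k a S : iop k (fun=> a) S = a.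
Proof.
elim: k S => //= k IH S; rewrite (op_ext _ IH) /op -mulr_suml.
by rewrite -[X in X * _]/(mass g) g1 mul1r.
Qed.

Lemma polyop_cst q a S : polyop q (fun=> a) S = q.[1] * a.
Proof.
rewrite horner_coef /polyop mulr_suml; apply: eq_bigr => k _.
by rewrite iop_cst expr1n mulr1.
Qed.

Lemma iop_le k F F' : (forall S, F S <= F' S) ->
  forall S, iop k F S <= iop k F' S.
Proof.
by move=> h; elim: k => //= k IH S; apply: ler_sum => Y _; apply: ler_wpM2l.
Qed.

Lemma iop_incr F S : mono F -> {homo (fun k => iop k F S) : k l / (k <= l)%N >-> k <= l}.
Proof.
move=> Fm; apply: homo_leq => [//|? ? ?|k]; first exact: le_trans.
rewrite iterSr; apply: iop_le => Y.
rewrite -[leLHS](iop_cst 1 _ Y); apply: ler_sum => Y' _.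
by apply: ler_wpM2l => //; apply: Fm; exact: finset.subsetUl.
Qed.

Variable F : {set X} -> R.
Hypotheses (Fm : mono F) (F01 : forall S, 0 <= F S <= 1).

Let h k := iop k F finset.set0.

Let h01 k : 0 <= h k <= 1.
Proof.
rewrite /h iop_ge0 /=; last by move=> S; case/andP: (F01 S).
by rewrite -[leRHS](iop_cst k _ finset.set0) iop_le // => S; case/andP: (F01 S).
Qed.

(* With [N] marks drawn independently from [g], [F] of their union has
   conditional mean [h N]; the generating function of [N] at [e] controls the
   event [N > t]. *)
Lemma pois_le_polyop m q t : (forall S, 0 <= m S) -> (forall k, 0 <= q`_k) ->
  (forall F', mono F' -> (forall S, 0 <= F' S) ->
     op m F' finset.set0 <= polyop q F' finset.set0) ->
  pois m F <= iop t F finset.set0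
    + expR (- t%:R) * expR (q.[expR 1] - q.[1]).
Proof.
move=> m0 q0 dom.
have Lam : mass m <= q.[1].
  have := dom (fun=> 1) (fun _ _ _ => lexx _) (fun=> ler01).
  by rewrite polyop_cst mulr1 /op; under eq_bigr do rewrite mulr1.
(* Empty marks raise the mass to the total rate [q.[1]], so that the prefactor of the Poisson series
   is [expR (- q.[1])]. *)
pose m' S := m S + if S == finset.set0 then q.[1] - mass m else 0.
have m'0 S : 0 <= m' S.
  by rewrite addr_ge0 //; case: ifP => // _; rewrite subr_ge0.
have mm' : mass m' = q.[1].
  rewrite /mass /m' big_split /= -big_mkcond big_pred1_eq.
  by rewrite addrC subrK.
have opm' F' S : op m' F' S = op m F' S + (q.[1] - mass m) * F' S.
  rewrite /op /m'; under eq_bigr do rewrite mulrDl.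
  rewrite big_split /=; congr (_ + _).
  rewrite (bigD1 finset.set0) //= eqxx finset.setU0 big1 ?addr0 //.
  by move=> Y /negbTE ->; rewrite mul0r.
have dom' F' S : mono F' -> (forall S, 0 <= F' S) ->
    op m' F' S <= polyop q F' S.
  move=> F'm F'0; rewrite opm'.
  (* [dom] is available at the empty set only. Translating by [S] and subtracting [F' S] keeps the
     function monotone and nonnegative; the subtracted terms, moved across, are exactly the
     contribution of the empty marks. *)
  pose G Y := F' (S :|: Y) + (- F' S) * 1.
  have := dom G _ _.
  rewrite /G op_lin op_shift finset.setU0.
  have -> : polyop q G finset.set0 = polyop q F' S - q.[1] * F' S.
    rewrite /polyop horner_coef mulr_suml -sumrB; apply: eq_bigr => k _.
    rewrite /G iter_op_lin iop_shift finset.setU0 iop_cst expr1n; ring.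
  have -> : op m (fun=> 1) finset.set0 = mass m.
    by rewrite /op; under eq_bigr do rewrite mulr1.
  rewrite -/G => H.
  have : op m F' S + - F' S * mass m <= polyop q F' S - q.[1] * F' S.
    apply: H => [Y Y' YY'|Y]; rewrite /G mulr1.
      by rewrite lerD2r; apply: F'm; exact: finset.setUS.
    by rewrite subr_ge0; apply: F'm; exact: finset.subsetUl.
  lra.
rewrite (@pois_off0 _ _ m m'); last first.
  by move=> S /negbTE; rewrite /m' => ->; rewrite addr0.
have dj j S : iter j (op m') F S <= iter j (polyop q) F S.
  have mj i : mono (iter i (polyop q) F).
    by elim: i => //= i; exact: polyop_mono.
  have pj i S' : 0 <= iter i (polyop q) F S'.
    elim: i S' => [|i IH] S' /=; first by case/andP: (F01 S').
    exact: polyop_ge0.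
  elim: j S => //= j IH S; apply: le_trans (dom' _ S (mj j) (pj j)).
  by apply: ler_sum => Y _; apply: ler_wpM2l.
(* Up to [t] draws monotonicity suffices; beyond [t], [h k <= 1] and the exponential is at least
   1. *)
have hk k : h k <= h t + expR (- t%:R) * expR 1 ^+ k.
  have [kt|tk] := leqP k t.
    apply: le_trans (iop_incr _ Fm kt) _.
    by rewrite lerDl mulr_ge0 // ?exprn_ge0 ?expR_ge0.
  have /andP[ht0 _] := h01 t; have /andP[_ hk1] := h01 k.
  apply: le_trans hk1 _; rewrite -expRM_natl mulr1 -expRD.
  rewrite -[leLHS]add0r lerD // -[X in X <= _]expR0 ler_expR.
  by have : (t%:R : R) <= k%:R; [rewrite ler_nat ltnW|lra].
have qj j i : 0 <= (q ^+ j)`_i.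
  elim: j i => [|j IH] i; first by rewrite expr0 coef1; case: (i == 0%N).
  by rewrite exprS coefM; apply: sumr_ge0 => l _; rewrite mulr_ge0.
have step j : iter j (op m') F finset.set0 <=
    h t * q.[1] ^+ j + expR (- t%:R) * q.[expR 1] ^+ j.
  apply: le_trans (dj j _) _; rewrite polyopX -!horner_exp !horner_coef.
  rewrite !mulr_sumr -big_split /=; apply: ler_sum => k _.
  apply: le_trans (ler_wpM2l (qj j k) (hk k)) _.
  rewrite expr1n mulr1 mulrDr lerD // ?(mulrC (h t)) //.
  by rewrite mulrCA.
have cv : (expR (- q.[1]) * (h t * (\sum_(0 <= j < J) q.[1] ^+ j / j`!%:R)
    + expR (- t%:R) * (\sum_(0 <= j < J) q.[expR 1] ^+ j / j`!%:R)))
    @[J --> \oo] -->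
    expR (- q.[1]) * (h t * expR q.[1] + expR (- t%:R) * expR q.[expR 1]).
  apply: cvgM; first exact: cvg_cst.
  by apply: cvgD; apply: cvgM; try exact: cvg_cst; exact: cvg_expR_series.
apply: le_trans (cvg_seq_le (psum_cvg (m := m') (F := F)) cv _) _.
  move=> J; rewrite /psum mm'; apply: ler_wpM2l; first exact: expR_ge0.
  rewrite !mulr_sumr -big_split /=; apply: ler_sum => j _.
  by rewrite !mulrA -mulrDl ler_wpM2r.
rewrite expRD -/(h t).
have e1 : expR (- q.[1]) * expR q.[1] = 1 by rewrite -expRD addNr expR0.
rewrite mulrDr mulrCA e1 mulr1 lerD2l le_eqVlt; apply/orP; left; apply/eqP; ring.
Qed.

(** The companion lower bound: the number [N] of draws is Poisson of mean [lam], and the mean of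
    exp(t - N) bounds the probability of fewer than [t] draws. *)
Lemma pois_ge_iter lam t : 0 <= lam ->
  iop t F finset.set0 - expR t%:R * expR (lam * (expR (-1) - 1))
    <= pois (fun S => lam * g S) F.
Proof.
move=> lam0.
have ml : mass (fun S => lam * g S) = lam.
  by rewrite /mass -mulr_sumr -[X in _ * X]/(mass g) g1 mulr1.
have il j S : iter j (op (fun S => lam * g S)) F S = lam ^+ j * iop j F S.
  elim: j S => [|j IH] S; first by rewrite expr0 mul1r.
  rewrite iterS (op_ext _ IH) /= /op exprS mulr_sumr; apply: eq_bigr => Y _.
  ring.
have hk k : h t * (1 - expR t%:R * expR (-1) ^+ k) <= h k.
  have /andP[ht0 _] := h01 t; have /andP[hk0 _] := h01 k.
  rewrite -expRM_natl mulrN1 -expRD.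
  have [kt|tk] := leqP t k.
    apply: le_trans (iop_incr _ Fm kt); rewrite -/(h t).
    by rewrite ler_piMr // lerBlDr lerDl expR_ge0.
  apply: le_trans hk0; apply: mulr_ge0_le0 => //.
  rewrite subr_le0 -[X in X <= _]expR0 ler_expR.
  by have : (k%:R : R) <= t%:R; [rewrite ler_nat ltnW|lra].
have cv : (expR (- lam) * (h t * (\sum_(0 <= j < J) lam ^+ j / j`!%:R
    - expR t%:R * (\sum_(0 <= j < J) (lam * expR (-1)) ^+ j / j`!%:R))))
    @[J --> \oo] -->
    expR (- lam) * (h t * (expR lam - expR t%:R * expR (lam * expR (-1)))).
  apply: cvgM; first exact: cvg_cst.
  apply: cvgM; first exact: cvg_cst.
  apply: cvgB; first exact: cvg_expR_series.
  by apply: cvgM; [exact: cvg_cst|exact: cvg_expR_series].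
have := cvg_seq_le cv (psum_cvg (m := fun S => lam * g S) (F := F)) _.
move=> H; apply: le_trans (H _).
  have /andP[ht0 ht1] := h01 t.
  have -> : lam * (expR (-1) - 1) = - lam + lam * expR (-1) by ring.
  have e1 : expR (- lam) * expR lam = 1 by rewrite -expRD addNr expR0.
  rewrite -/(h t) expRD.
  set a := expR (- lam) in e1 *; set b := expR (lam * _).
  have -> : a * (h t * (expR lam - expR t%:R * b)) =
    h t * (a * expR lam) - h t * (expR t%:R * (a * b)) by ring.
  by rewrite e1 mulr1 lerD2l lerN2 ler_piMl // !mulr_ge0 ?expR_ge0.
move=> J; rewrite /psum ml ler_wpM2l ?expR_ge0 // mulr_sumr -sumrB mulr_sumr.
apply: ler_sum => j _; rewrite il -/(h j) exprMn.
have -> : h t * (lam ^+ j / j`!%:R - expR t%:R * (lam ^+ j * expR (-1) ^+ j / j`!%:R))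
  = lam ^+ j / j`!%:R * (h t * (1 - expR t%:R * expR (-1) ^+ j)) by ring.
rewrite [leRHS]mulrAC ler_wpM2l ?divr_ge0 ?exprn_ge0 //.
Qed.

End PolyOp.

(** * Absorption of the returning walks by a higher level *)

Section Sprinkling.
Variables (R : realType) (X : finType).
Implicit Types (F : {set X} -> R) (S : {set X}).

Lemma expR1_le3 : expR 1 <= 3 :> R.
Proof.
have h : (7 / 8 : R) <= expR (- (1 / 8)).
  by apply: le_trans (expR_ge1Dx _); lra.
have e : expR 1 * expR (- (1 / 8)) ^+ 8 = 1 :> R.
  rewrite -expRM_natl -expRD (_ : 1 + _ = 0) ?expR0 //; lra.
have h8 : (7 / 8 : R) ^+ 8 <= expR (- (1 / 8)) ^+ 8.
  by apply: lerXn2r => //; rewrite nnegrE ?expR_ge0 //; lra.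
have := @expR_ge0 R 1; move: e h8; move: (expR 1) (_ ^+ 8) => x y xy h8 x0.
have h3 : (1 / 3 : R) <= (7 / 8) ^+ 8 by rewrite !exprS expr0; lra.
nra.
Qed.

Lemma expRN1_le : expR (-1) <= 1 / 2 :> R.
Proof.
have e : expR 1 * expR (- 1) = 1 :> R by rewrite -expRD subrr expR0.
have h : 2 <= expR 1 :> R by apply: le_trans (expR_ge1Dx _); lra.
have h0 := @expR_ge0 R (-1).
nra.
Qed.

Lemma polyop_mono_term (g : {set X} -> R) c k F S :
  polyop g (c%:P * 'X^k) F S = c * iter k (op g) F S.
Proof.
rewrite polyopM polyopC; congr (_ * _).
elim: k F S => [|k IH] F S; first by rewrite expr0 polyopC mul1r.
by rewrite exprSr polyopMX IH iterSr.
Qed.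

Lemma polyop_sum (g : {set X} -> R) n (p : nat -> {poly R}) F S :
  polyop g (\sum_(l < n) p l) F S = \sum_(l < n) polyop g (p l) F S.
Proof.
elim: n => [|n IH]; first by rewrite !big_ord0 -[0 in LHS]/(0%:P) polyopC mul0r.
by rewrite !big_ord_recr polyopD IH.
Qed.

Lemma geometric_half (r : R) n : 0 <= r <= 1 / 2 ->
  \sum_(l < n) r ^+ l.+1 <= 2 * r.
Proof.
move=> hr; suff : \sum_(l < n) r ^+ l.+1 <= 2 * r * (1 - r ^+ n).
  have : 0 <= r ^+ n by apply: exprn_ge0; lra.
  nra.
elim: n => [|n IH]; first by rewrite big_ord0 expr0 subrr mulr0.
rewrite big_ord_recr /= exprS; have : 0 <= r ^+ n by apply: exprn_ge0; lra.
move: IH; set A := \sum_(_ < _) _; move: (r ^+ n) => y hA y0.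
have : 0 <= r * y * (1 - 2 * r) by rewrite !mulr_ge0 //; lra.
lra.
Qed.

Variables (gc m1 m2 : {set X} -> R) (a u del : R) (n : nat).
Hypotheses (a0 : 0 < a) (u0 : 0 <= u) (del01 : 0 < del <= 1).
Hypotheses (gc0 : forall S, 0 <= gc S) (m20 : forall S, 0 <= m2 S).
Hypothesis single : forall S, gc S / 2 <= m1 S.
Hypothesis multi : forall F, mono F -> (forall S, 0 <= F S) ->
  op m2 F finset.set0 <=
    \sum_(l < n) a ^+ l.+1 * iter l.+2 (op gc) F finset.set0.
Hypothesis small : a * mass gc <= del / 288.

Let err := expR (- (del ^+ 2 * u / (4608 * a))).

(** The common mass of the padded excursion law. Since [a * g = del / 288], the bound 18 u g (a g)
    found in [qe] equals [u * g * del / 16], and 16 times 288 is the 4608 of [err]. *)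
Let g := del / (288 * a).
Let g_gt0 : 0 < g.
Proof. by rewrite divr_gt0 ?mulr_gt0 //; case/andP: del01. Qed.
Let ag : a * g = del / 288.
Proof. by rewrite /g invfM; field; rewrite gt_eqF. Qed.

(* [gc] padded with empty marks up to total mass [g], then normalised *)
Let gam S := (gc S + if S == finset.set0 then g - mass gc else 0) / g.

Let mass_gc : mass gc <= g.
Proof. by rewrite -(ler_pM2l a0) ag. Qed.

Let gam0 S : 0 <= gam S.
Proof.
rewrite divr_ge0 ?(ltW g_gt0) // addr_ge0 //; case: ifP => // _.
by rewrite subr_ge0.
Qed.

Let gam1 : mass gam = 1.
Proof.
rewrite /mass -mulr_suml big_split /= -big_mkcond big_pred1_eq.
by rewrite -[X in X + _]/(mass gc) addrC subrK divff // gt_eqF.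
Qed.

Let gam_gc k F S : (forall S, 0 <= F S) ->
  iter k (op gc) F S <= g ^+ k * iter k (op gam) F S.
Proof.
move=> F0; elim: k S => [|k IH] S; first by rewrite mul1r.
rewrite !iterS.
apply: (@le_trans _ _ (op gc (fun S => g ^+ k * iter k (op gam) F S) S)).
  by apply: ler_sum => Y _; apply: ler_wpM2l.
rewrite /op mulr_sumr; apply: ler_sum => Y _.
set I := iter k _ F _.
have e : gam Y * g = gc Y + if Y == finset.set0 then g - mass gc else 0.
  by rewrite divfK // gt_eqF.
have -> : g ^+ k.+1 * (gam Y * I) = (gam Y * g) * (g ^+ k * I).
  by rewrite exprS; ring.
rewrite e.
apply: ler_wpM2r.
  by rewrite mulr_ge0 ?exprn_ge0 ?(ltW g_gt0) // iter_op_ge0.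
by rewrite lerDl; case: ifP => // _; rewrite subr_ge0.
Qed.

(** The right side of [multi] times [u], each excursion of intensity [gc] being replaced by [g]
    times a draw from [gam]. Degrees start at 2 because a returning walk makes at least two
    excursions. *)
Let q : {poly R} := \sum_(l < n) ((u * (a ^+ l.+1 * g ^+ l.+2))%:P * 'X^(l.+2)).

Let q0 k : 0 <= q`_k.
Proof.
rewrite coef_sum; apply: sumr_ge0 => l _; rewrite coefCM coefXn.
apply: mulr_ge0; last exact: ler0n.
by apply: mulr_ge0 => //; apply: mulr_ge0; apply/exprn_ge0/ltW.
Qed.

Let q_dom F : mono F -> (forall S, 0 <= F S) ->
  op (fun S => u * m2 S) F finset.set0 <= polyop gam q F finset.set0.
Proof.
move=> Fm F0; rewrite /q (polyop_sum gam n
  (fun l => (u * (a ^+ l.+1 * g ^+ l.+2))%:P * 'X^(l.+2))).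
have -> : op (fun S => u * m2 S) F finset.set0 = u * op m2 F finset.set0.
  by rewrite /op mulr_sumr; apply: eq_bigr => S _; rewrite mulrA.
apply: le_trans (ler_wpM2l u0 (multi Fm F0)) _.
rewrite mulr_sumr; apply: ler_sum => l _; rewrite polyop_mono_term.
rewrite -(mulrA u) -(mulrA (a ^+ _)); apply: ler_wpM2l => //.
by apply: ler_wpM2l; [apply/exprn_ge0/ltW|exact: gam_gc].
Qed.

(** The returns form a geometric series whose ratio [r = a * g * expR 1] is at most 1/2, hence of
    sum at most [2 * r]. Together with the outer factor e, and e <= 3, this gives the constant 2 e^2
    <= 18. *)
Let qe : q.[expR 1] - q.[1] <= u * g * del / 16.
Proof.
have q1 : 0 <= q.[1].
  rewrite horner_coef; apply: sumr_ge0 => k _.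
  by rewrite expr1n mulr1.
have -> : u * g * del / 16 = 18 * (u * g * (a * g)) by rewrite ag; field.
rewrite lerBlDr -[leLHS]addr0 lerD //.
have e3 := expR1_le3; have e0 := @expR_gt0 R 1.
pose r := a * g * expR 1.
have -> : q.[expR 1] = u * g * expR 1 * \sum_(l < n) r ^+ l.+1.
  rewrite horner_sum mulr_sumr; apply: eq_bigr => l _.
  by rewrite hornerCM hornerXn /r; move: (g) => g'; rewrite !exprMn !exprS; ring.
have d1 : 0 < del <= 1 := del01.
have hr : 0 <= r <= 1 / 2 by rewrite /r ag; apply/andP; split; nra.
have := geometric_half n hr.
set Sg := \sum_(_ < _) _ => hS.
have ug : 0 <= u * g by rewrite mulr_ge0 // ltW.
apply: (@le_trans _ _ (u * g * expR 1 * (2 * r))).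
  by apply: ler_wpM2l => //; rewrite mulr_ge0 // ltW.
rewrite /r.
have -> : u * g * expR 1 * (2 * (a * g * expR 1)) =
   (expR 1 * expR 1 * 2) * (u * g * (a * g)) by ring.
apply: ler_wpM2r; first by rewrite mulr_ge0 // ag; lra.
nra.
Qed.

(** By [single], the extra single walks at level [u * del] dominate a Poisson number of draws from
    [gam] of mean [lam]. By [qe] the returning walks bring few draws, and a threshold separates the
    two numbers. *)
Let multi_le_single F : mono F -> (forall S, 0 <= F S <= 1) ->
  pois (fun S => u * m2 S) F <= pois (fun S => u * del * m1 S) F + 4 * err.
Proof.
move=> Fm F01.
have [d0 d1] := andP del01.
pose lam := u * del * g / 2.
have ud : 0 <= u * del by rewrite mulr_ge0 // ltW.
have lam0 : 0 <= lam by rewrite divr_ge0 // mulr_ge0 // ltW.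
(* A quarter of the mean serves both tails, as [err] is exp(-lam/8): the upper tail has exponent at
   most 1 - lam/8, the lower one at most -lam/4. With e <= 3 the errors add up to [4 * err]. *)
pose t := Num.trunc (lam / 4).
have /andP[t1 t2] : t%:R <= lam / 4 < t.+1%:R.
  by apply: truncn_itv; rewrite divr_ge0.
have um20 S : 0 <= u * m2 S by rewrite mulr_ge0.
have up := pois_le_polyop gam0 gam1 Fm F01 t um20 q0 q_dom.
have lo := pois_ge_iter gam0 gam1 Fm F01 t lam0.
have le1 : pois (fun S => lam * gam S) F <= pois (fun S => u * del * m1 S) F.
  apply: pois_mono => // S; first by rewrite mulr_ge0.
  move=> /negbTE Sn0; rewrite /gam Sn0 addr0 /lam.
  have -> : u * del * g / 2 * (gc S / g) = u * del * (gc S / 2).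
    by field; rewrite gt_eqF.
  exact: ler_wpM2l.
have errE : err = expR (- (u * g * del / 16)).
  by congr expR; rewrite /g; field; rewrite gt_eqF.
have e1 : expR (- t%:R) * expR (q.[expR 1] - q.[1]) <= 3 * err.
  apply: (@le_trans _ _ (expR 1 * err)); last first.
    by rewrite ler_wpM2r ?expR_ge0 // expR1_le3.
  rewrite errE -!expRD ler_expR.
  have := qe; move: t2; rewrite -(natr1 t).
  have -> : u * g * del = 2 * lam by rewrite /lam; move: (g) => ?; field.
  move: (q.[expR 1] - _) (t%:R) (lam) => *; lra.
have e2 : expR t%:R * expR (lam * (expR (-1) - 1)) <= err.
  rewrite errE -!expRD ler_expR.
  have := expRN1_le.
  have -> : u * g * del = 2 * lam by rewrite /lam; move: (g) => ?; field.
  move: t1 lam0; move: (t%:R) (lam) (expR (-1)) => *; nra.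
lra.
Qed.

(** Given the trace [S] of the single walks at level [u], this is [multi_le_single] for [F] of the
    union with [S]. *)
Lemma pois_sprinkle F : mono F -> (forall S, 0 <= F S <= 1) ->
  pois (fun S => u * (m1 S + m2 S)) F <=
    pois (fun S => (1 + del) * u * m1 S) F + 4 * err.
Proof.
move=> Fm F01; have [d0 d1] := andP del01.
have m10 S : 0 <= m1 S by apply: le_trans (single S); rewrite divr_ge0.
have um10 S : 0 <= u * m1 S by rewrite mulr_ge0.
rewrite (@pois_off0 _ _ _ (fun S => u * m1 S + u * m2 S)); last first.
  by move=> S _; rewrite mulrDr.
rewrite (@pois_off0 _ _ (fun S => (1 + del) * u * m1 S)
  (fun S => u * m1 S + u * del * m1 S)); last by move=> S _; ring.
rewrite !poisD -[X in _ + X](pois_cst (fun S => u * m1 S)).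
rewrite -lerBlDl -poisB [leLHS]/pois.
rewrite -[leLHS]/(pois _ _).
apply: pois_le => // S; rewrite lerBlDl; apply: multi_le_single => // [Y Y' YY'].
by apply: Fm; exact: finset.setUS.
Qed.

End Sprinkling.

(** * Reversible walks *)

Lemma cvg_mul_sumr (R : realType) (I : Type) (r : seq I) (c : I -> R)
    (f : I -> nat -> R) (l : I -> R) :
  (forall i, f i n @[n --> \oo] --> l i) ->
  (\sum_(i <- r) c i * f i n) @[n --> \oo] --> \sum_(i <- r) c i * l i.
Proof.
move=> h; apply: (@cvg_rsum _ _ _ (fun i n => c i * f i n)) => i.
by apply: cvgM; [exact: cvg_cst|exact: h].
Qed.

(** Dominated convergence for a convolution: for [n] below a fixed [N] the time [T - n] is large and
    [b] is near its limit; from [N] on, the difference is at most 1 and the tail of the series is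
    small. *)
Lemma cvg_conv_diff (R : realType) (a b : nat -> R) (al be : R) :
  (forall n, 0 <= a n) -> (\sum_(n < N) a n) @[N --> \oo] --> al ->
  (forall n, be <= b n <= be + 1) -> b @ \oo --> be ->
  (\sum_(n < T.+1) a n * (b (T - n)%N - be)) @[T --> \oo] --> 0.
Proof.
move=> a0 cva hb cvb.
have ale N : \sum_(n < N) a n <= al.
  rewrite -(cvg_lim (@Rhausdorff R) cva).
  apply: (nondecreasing_cvgn_le (u_ := fun N => \sum_(n < N) a n)).
    by apply/nondecreasing_seqP => n; rewrite big_ord_recr lerDl.
  by apply/cvg_ex; exists al.
have al0 : 0 <= al by apply: le_trans (ale 0%N); rewrite big_ord0.
apply/cvgrPdist_le => e e0.
have /cvgrPdist_le/(_ (e / 2)) : (\sum_(n < N) a n) @[N --> \oo] --> al by [].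
case; first by rewrite divr_gt0.
move=> N _ hN; have {}hN := hN N (leqnn N); rewrite /= in hN.
move/cvgrPdist_le : cvb => /(_ (e / (2 * (al + 1)))).
case; first by rewrite divr_gt0 // mulr_gt0 // ltr_wpDl.
move=> M _ hM.
near=> T; have TNM : (N + M <= T)%N by near: T; exists (N + M)%N.
rewrite sub0r normrN ger0_norm; last first.
  apply: sumr_ge0 => n _; rewrite mulr_ge0 // subr_ge0.
  by case/andP: (hb (T - n)%N).
apply: (@le_trans _ _ (\sum_(n < T.+1)
    (a n * (e / (2 * (al + 1))) + a n * (N <= n)%:R))).
  apply: ler_sum => n _; rewrite -mulrDr ler_wpM2l //.
  have [Nn|nN] := leqP N n.
    apply: ler_wpDl; first by rewrite divr_ge0 ?(ltW e0) // mulr_ge0 // addr_ge0.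
    by case/andP: (hb (T - n)%N) => _; rewrite lerBlDr addrC.
  rewrite addr0; have := hM (T - n)%N _; rewrite /= distrC => /(_ _)/ler_normlW.
  by apply; rewrite leq_subRL; [rewrite (leq_trans _ TNM)// leq_add2r ltnW
    |rewrite (leq_trans (ltnW nN))// (leq_trans _ TNM)// leq_addr].
rewrite big_split /= -[X in X + _]mulr_suml.
rewrite [leRHS](_ : e = e / 2 + e / 2); last by field.
apply: lerD.
  apply: (@le_trans _ _ (al * (e / (2 * (al + 1))))).
    apply: ler_wpM2r; last exact: ale.
    by rewrite divr_ge0 ?(ltW e0) // mulr_ge0 // addr_ge0.
  have -> : al * (e / (2 * (al + 1))) = (e / 2) * (al / (al + 1)).
    by field; rewrite gt_eqF // ltr_wpDl.
  by rewrite ler_piMr ?divr_ge0 ?(ltW e0) // ler_pdivrMr ?mul1r ?lerDl// ltr_wpDl.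
have NT : (N <= T.+1)%N by rewrite (leq_trans _ (leqnSn T)) // (leq_trans _ TNM) // leq_addr.
have hs : \sum_(n < T.+1) a n * (N <= n)%:R = \sum_(n < T.+1) a n - \sum_(n < N) a n.
  rewrite (big_ord_widen _ a NT) [X in _ - X]big_mkcond -sumrB.
  apply: eq_bigr => n _; case: (leqP N n) => h; rewrite ?mulr1 ?subr0 ?mulr0 ?subrr //.
rewrite hs; have := ale T.+1; have := ler_normlW hN; lra.
Unshelve. all: by end_near. Qed.

Section Walk.
Variables (R : realType) (E : choiceType) (nb : E -> seq E).
Variables (p : E -> E -> R) (rho : E -> R).
Hypotheses (nb_uniq : forall x, uniq (nb x)).
Hypotheses (nb_sym : forall x y, (y \in nb x) = (x \in nb y)).
Hypotheses (p_ge0 : forall x y, 0 <= p x y).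
Hypotheses (p_sum : forall x, \sum_(y <- nb x) p x y = 1).
Hypotheses (p_rev : forall x y, rho x * p x y = rho y * p y x).
Implicit Types (x y z : E) (f : E -> R) (C K : pred E).

Definition step f x : R := \sum_(y <- nb x) p x y * f y.

(* The probabilities to avoid [C] at times [1..n], for [tau], and [0..n], for
   [esc]; [walkA K] and [walkB K] are the transition probabilities in [n] steps of
   the walk that avoids [K] at times [1..n] and [0..n-1] respectively. *)
Fixpoint tau C n x : R :=
  if n is n'.+1 then step (fun y => if C y then 0 else tau C n' y) x else 1.

Definition esc C n x : R := if C x then 0 else tau C n x.

Fixpoint walkA K n x y : R :=
  if n is n'.+1 then step (fun z => if K z then 0 else walkA K n' z y) x
  else (x == y)%:R.

Fixpoint walkB K n x y : R :=
  if n is n'.+1 then if K x then 0 else step (fun z => walkB K n' z y) x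
  else (x == y)%:R.

Lemma le_step f f' x : (forall y, y \in nb x -> f y <= f' y) ->
  step f x <= step f' x.
Proof.
by move=> h; rewrite /step !big_seq; apply: ler_sum => y yx;
  rewrite ler_wpM2l // h.
Qed.

Lemma eq_step f f' x : (forall y, y \in nb x -> f y = f' y) ->
  step f x = step f' x.
Proof. by move=> h; apply: eq_big_seq => y /h ->. Qed.

Lemma step_cst a x : step (fun=> a) x = a.
Proof. by rewrite /step -mulr_suml p_sum mul1r. Qed.

Lemma step_ge0 f x : (forall y, 0 <= f y) -> 0 <= step f x.
Proof. by move=> h; apply: sumr_ge0 => y _; rewrite mulr_ge0. Qed.

Lemma stepD f f' x : step (fun y => f y + f' y) x = step f x + step f' x.
Proof.
by rewrite /step -big_split /=; apply: eq_bigr => y _; rewrite mulrDr.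
Qed.

Lemma stepZ a f x : step (fun y => a * f y) x = a * step f x.
Proof. by rewrite /step mulr_sumr; apply: eq_bigr => y _; rewrite mulrCA. Qed.

Lemma step_sum (I : Type) (r : seq I) (f : I -> E -> R) x :
  step (fun y => \sum_(i <- r) f i y) x = \sum_(i <- r) step (f i) x.
Proof.
rewrite /step exchange_big /=; apply: eq_bigr => y _.
by rewrite mulr_sumr.
Qed.

Lemma tau_ge0_le1 C n x : 0 <= tau C n x <= 1.
Proof.
elim: n x => [|n IH] x /=; first by rewrite ler01 lexx.
apply/andP; split.
  by apply: step_ge0 => y; case: ifP => // _; case/andP: (IH y).
rewrite -[leRHS](step_cst 1 x); apply: le_step => y _.
by case: ifP => // _; case/andP: (IH y).
Qed.

Lemma tau_decr C n x : tau C n.+1 x <= tau C n x.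
Proof.
elim: n x => [|n IH] x; first by case/andP: (tau_ge0_le1 C 1 x).
by apply: le_step => y _; case: ifP => _ //; exact: IH.
Qed.

Lemma tau_nonincr C x : nonincreasing_seq (fun n => tau C n x).
Proof. by apply/nonincreasing_seqP => n; exact: tau_decr. Qed.

Definition tauoo C x : R := limn (fun n => tau C n x).

Lemma tau_cvg C x : tau C n x @[n --> \oo] --> tauoo C x.
Proof.
suff : cvgn (fun n => tau C n x) by [].
apply: nonincreasing_is_cvgn; first exact: tau_nonincr.
by exists 0 => _ [n _ <-]; case/andP: (tau_ge0_le1 C n x).
Qed.

Lemma tauoo_le C n x : tauoo C x <= tau C n x.
Proof.
apply: (nonincreasing_cvgn_ge (u_ := fun n => tau C n x)).
  exact: tau_nonincr.
by apply/cvg_ex; exists (tauoo C x); exact: tau_cvg.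
Qed.

Lemma tauoo_ge0 C x : 0 <= tauoo C x.
Proof.
apply: (cvg_seq_le (cvg_cst 0) (tau_cvg (C := C) (x := x))) => n.
by case/andP: (tau_ge0_le1 C n x).
Qed.

Definition escoo C x : R := if C x then 0 else tauoo C x.

Lemma tauoo_step C x : tauoo C x = step (escoo C) x.
Proof.
have h1 : tau C n.+1 x @[n --> \oo] --> tauoo C x.
  by have := tau_cvg (C := C) (x := x); rewrite -(cvg_shiftS _).
have h2 : tau C n.+1 x @[n --> \oo] --> step (escoo C) x.
  apply: cvg_mul_sumr => y; rewrite /escoo; case: ifP => _; first exact: cvg_cst.
  exact: tau_cvg.
exact: (cvg_unique _ h1 h2).
Qed.

Lemma walkA_ge0 K n x y : 0 <= walkA K n x y.
Proof.
by elim: n x => [|n IH] x /=; rewrite ?ler0n //; apply: step_ge0 => z; case: ifP.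
Qed.

Lemma walkB_ge0 K n x y : 0 <= walkB K n x y.
Proof.
elim: n x => [|n IH] x /=; rewrite ?ler0n //.
by case: ifP => // _; apply: step_ge0 => z.
Qed.

Lemma walkA_le K n x y : walkA K n x y <= walkA pred0 n x y.
Proof.
elim: n x => [|n IH] x //=; apply: le_step => z _.
by case: ifP => // _; exact: walkA_ge0.
Qed.

Lemma walkA_recr K n x y : walkA K n.+1 x y =
  \sum_(z <- nb y) walkA K n x z * (p z y * (~~ K y)%:R).
Proof.
have kE z (t : R) : (if K z then 0 else t) = (~~ K z)%:R * t.
  by case: (K z); rewrite ?mul0r ?mul1r.
elim: n x => [|n IH] x.
  rewrite /= /step; transitivity ((y \in nb x)%:R * (p x y * (~~ K y)%:R)).
    have [yx|yx] := boolP (y \in nb x).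
      rewrite (big_rem y) //= eqxx kE mulr1 mul1r big_seq big1 ?addr0 // => z.
      rewrite mem_rem_uniq // !inE => /andP[/negbTE -> _].
      by rewrite kE !mulr0.
    rewrite mul0r big_seq big1 // => z zx; case: eqP => [e|_].
      by rewrite -e zx in yx.
    by rewrite kE !mulr0.
  rewrite nb_sym; have [xy|xy] := boolP (x \in nb y).
    rewrite (big_rem x) //= eqxx big_seq big1 ?addr0 // => z.
    rewrite mem_rem_uniq // !inE eq_sym => /andP[/negbTE -> _].
    by rewrite mul0r.
  rewrite mul0r big_seq big1 // => z zy; case: eqP => [e|_].
    by rewrite e zy in xy.
  by rewrite mul0r.
rewrite [LHS]/= {1}/step.
under eq_bigr => z _ do rewrite kE -/(walkA K n.+1 z y) IH mulr_sumr mulr_sumr.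
rewrite exchange_big /=; apply: eq_bigr => z _.
rewrite /step mulr_suml; apply: eq_bigr => t _; rewrite kE; ring.
Qed.

(** Reversal exchanges avoidance at times 1..n with avoidance at times 0..n-1, which is why both
    variants exist. The definitions peel off the first step, and [walkA_recr] supplies the last
    one. *)
Lemma walk_rev K n x y : rho x * walkA K n x y = rho y * walkB K n y x.
Proof.
elim: n y => [|n IH] y.
  by rewrite /=; case: (eqVneq x y) => [->|_]; rewrite ?mulr0.
rewrite walkA_recr mulr_sumr /=; case: (K y).
  by rewrite mulr0 big1 // => z _; rewrite !mulr0.
rewrite /step mulr_sumr; apply: eq_bigr => z _.
by rewrite mulr1 mulrA IH mulrAC p_rev -mulrA.
Qed.

(** A path counted by [walkB] that ends in [ks] ends at its first visit there, so the double sum is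
    the probability of a visit up to time [n]. *)
Lemma esc_hitB (ks : seq E) n x : uniq ks ->
  \sum_(m < n.+1) \sum_(y <- ks) walkB (mem ks) m x y = 1 - esc (mem ks) n x.
Proof.
move=> uk; rewrite /esc; elim: n x => [|n IH] x.
  rewrite big_ord_recl big_ord0 addr0 /=; case: ifP => xk.
    rewrite (big_rem x) //= eqxx big_seq big1 ?addr0 ?subr0 // => y.
    by rewrite mem_rem_uniq // !inE eq_sym => /andP[/negbTE -> _].
  rewrite subrr big_seq big1 // => y yk; case: eqP => // e.
  by rewrite e yk in xk.
rewrite big_ord_recl /=; have [xk|/negbTE xk] := boolP (x \in ks).
  rewrite (big_rem x) //= eqxx big_seq big1; last first.
    by move=> y; rewrite mem_rem_uniq // !inE eq_sym => /andP[/negbTE -> _].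
  rewrite addr0 subr0 big1 ?addr0 // => m _; rewrite big1 // => y _ /=.
rewrite big_seq big1 ?add0r; last first.
  by move=> y yk; case: eqP => // e; rewrite e yk in xk.
rewrite -[X in X - _](step_cst 1 x) -[X in _ - X]mul1r -mulNr.
rewrite -stepZ -stepD -(eq_step (f := fun z => \sum_(m < n.+1) \sum_(y <- ks) walkB (mem ks) m z y)); last first.
  by move=> z _; rewrite IH mulN1r.
rewrite step_sum; apply: eq_bigr => m _; rewrite step_sum.
by apply: eq_bigr => y _; rewrite /= ?xk.
Qed.

(* Decomposition at the last visit to [cs] before time [n]. *)
Lemma last_exit K (cs : seq E) n x : uniq cs -> (forall y, K y -> y \in cs) ->
  tau K n x = esc (mem cs) n x
    + \sum_(m < n.+1) \sum_(y <- cs) walkA K m x y * tau (mem cs) (n - m) y.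
Proof.
move=> uc Kc.
have sel f z : \sum_(y <- cs) (z == y)%:R * f y = if z \in cs then f z else 0.
  case: ifP => zc.
    rewrite (big_rem z) //= eqxx mul1r big_seq big1 ?addr0 // => y.
    rewrite mem_rem_uniq // !inE eq_sym => /andP[/negbTE -> _].
    by rewrite mul0r.
  rewrite big_seq big1 // => y yc; case: eqP => [e|_]; last by rewrite mul0r.
  by rewrite e yc in zc.
elim: n x => [|n IH] x.
  rewrite big_ord_recl big_ord0 addr0 /= sel /esc /=.
  by case: ifP; rewrite ?add0r ?addr0.
transitivity (tau (mem cs) n.+1 x + \sum_(m < n.+1) \sum_(y <- cs)
    walkA K m.+1 x y * tau (mem cs) (n - m) y); last first.
  rewrite [in RHS]big_ord_recl addrA; congr (_ + _).
  have h0 : \sum_(y <- cs) walkA K (@ord0 n.+1) x y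
      * tau (mem cs) (n.+1 - @ord0 n.+1) y
      = if x \in cs then tau (mem cs) n.+1 x else 0 := sel _ _.
  apply: etrans (congr1 (fun t => esc (mem cs) n.+1 x + t) (esym h0)).
  by rewrite /esc inE; case: ifP; rewrite ?add0r ?addr0.
rewrite /= (eq_step (f' := fun y => esc (mem cs) n y + (if K y then 0 else
   \sum_(m < n.+1) \sum_(z <- cs) walkA K m y z * tau (mem cs) (n - m) z))).
  rewrite stepD; congr (_ + _).
  transitivity (\sum_(m < n.+1) \sum_(z <- cs)
     step (fun y => tau (mem cs) (n - m) z * (if K y then 0 else walkA K m y z)) x).
    under [RHS]eq_bigr do rewrite -step_sum.
    rewrite -step_sum; apply: eq_step => y _; case: ifP => _.
      by rewrite big1 // => m _; rewrite big1 // => z _; rewrite mulr0.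
    by apply: eq_bigr => m _; apply: eq_bigr => z _; rewrite mulrC.
  apply: eq_bigr => m _; apply: eq_bigr => z _.
  by rewrite stepZ mulrC.
move=> y _; case: ifP => Ky; last exact: IH.
by rewrite /esc /= (Kc y Ky) addr0.
Qed.

End Walk.

(** * Equilibrium measure, capacity and entrance law *)

Section Potential.
Variables (R : realType) (E : choiceType) (nb : E -> seq E).
Variables (p : E -> E -> R) (rho : E -> R).
Hypotheses (nb_uniq : forall x, uniq (nb x)).
Hypotheses (nb_sym : forall x y, (y \in nb x) = (x \in nb y)).
Hypotheses (p_ge0 : forall x y, 0 <= p x y).
Hypotheses (p_sum : forall x, \sum_(y <- nb x) p x y = 1).
Hypotheses (rho_gt0 : forall x, 0 < rho x).
Hypotheses (p_rev : forall x y, rho x * p x y = rho y * p y x).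
Variable g : E -> E -> R.
Local Notation tau := (tau nb p).
Local Notation esc := (esc nb p).
Local Notation tauoo := (tauoo nb p).
Local Notation escoo := (escoo nb p).
Local Notation step := (step nb p).
Local Notation walkA := (walkA nb p).
Local Notation walkB := (walkB nb p).
Hypothesis green_cvg : forall x y,
  (\sum_(n < N) walkA pred0 n x y) @[N --> \oo] --> g x y * rho y.
Implicit Types (x y z : E) (C K : pred E) (cs ks : seq E).

Lemma green_le K x y N : \sum_(n < N) walkA K n x y <= g x y * rho y.
Proof.
apply: (@le_trans _ _ (\sum_(n < N) walkA pred0 n x y)).
  by apply: ler_sum => n _; apply: walkA_le.
rewrite -(cvg_lim (@Rhausdorff R) (@green_cvg x y)).
apply: (nondecreasing_cvgn_le (u_ := fun N => \sum_(n < N) walkA pred0 n x y)).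
  by apply/nondecreasing_seqP => n; rewrite big_ord_recr lerDl; apply: walkA_ge0.
by apply/cvg_ex; exists (g x y * rho y); exact: green_cvg.
Qed.

Lemma killed_green_cvg K x y :
  exists al : R, (\sum_(n < N) walkA K n x y) @[N --> \oo] --> al.
Proof.
exists (limn (fun N => \sum_(n < N) walkA K n x y)).
suff : cvgn (fun N => \sum_(n < N) walkA K n x y) by [].
apply: nondecreasing_is_cvgn.
  by apply/nondecreasing_seqP => n; rewrite big_ord_recr lerDl; apply: walkA_ge0.
by exists (g x y * rho y) => _ [N _ <-]; exact: green_le.
Qed.

Definition capac cs : R := \sum_(y <- cs) rho y * tauoo (mem cs) y.

(** The error made in the last-exit decomposition when not returning in the remaining time is
    replaced by never returning. *)
Definition lag K cs x y T : R := \sum_(m < T.+1)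
  walkA K m x y * (tau (mem cs) (T - m)%N y - tauoo (mem cs) y).

Lemma lag_cvg K cs x y : lag K cs x y @ \oo --> 0.
Proof.
have [al hal] := killed_green_cvg K x y.
refine (@cvg_conv_diff _ (fun n => walkA K n x y) (fun n => tau (mem cs) n y) al _ _ hal _ _).
- by move=> n; apply: walkA_ge0.
- move=> n; rewrite tauoo_le //=.
  have := tauoo_ge0 p_ge0 p_sum (mem cs) y.
  by have /andP[_] := tau_ge0_le1 p_ge0 p_sum (mem cs) n y; lra.
- exact: tau_cvg.
Qed.

(** The equilibrium measure of [cs] swept onto [ks] has the capacity of [ks] as its mass. Reversing
    the first entrance into [ks] turns the left side into the last-exit decomposition from [ks], up
    to [lag]. This is how walks started on [cs] reproduce the given avoidance probabilities of all
    subsets. *)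
Lemma sweeping cs ks : uniq cs -> uniq ks -> {subset ks <= cs} ->
  (\sum_(y <- cs) rho y * tauoo (mem cs) y * (1 - esc (mem ks) T y))
    @[T --> \oo] --> capac ks.
Proof.
move=> uc uk kc.
pose D T := \sum_(x <- ks) rho x * \sum_(y <- cs) lag (mem ks) cs x y T.
have D0 : D T @[T --> \oo] --> (0 : R).
  rewrite [X in _ --> X](_ : _ = \sum_(x <- ks) rho x * \sum_(y <- cs) (0 : R));
    last by rewrite big1 // => x _; rewrite big1 ?mulr0.
  apply: cvg_mul_sumr => x.
  by apply: (@cvg_rsum _ _ cs (lag (mem ks) cs x)) => y; exact: lag_cvg.
have cvk : (\sum_(x <- ks) rho x * tau (mem ks) T x) @[T --> \oo] --> capac ks.
  apply: (@cvg_mul_sumr _ _ ks rho (fun x T => tau (mem ks) T x)) => x.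
  exact: (tau_cvg p_ge0 p_sum).
suff key T : \sum_(y <- cs) rho y * tauoo (mem cs) y * (1 - esc (mem ks) T y) =
    \sum_(x <- ks) rho x * tau (mem ks) T x - D T.
  by under eq_cvg do rewrite key; rewrite -[capac ks]subr0; exact: cvgB.
rewrite /D /lag -sumrB /=.
transitivity (\sum_(x <- ks) \sum_(y <- cs) \sum_(m < T.+1)
   rho x * walkA (mem ks) m x y * tauoo (mem cs) y).
  rewrite exchange_big /=; apply: eq_bigr => y _.
  rewrite -(esc_hitB p_sum T y uk) [X in _ * X]exchange_big /= mulr_sumr.
  apply: eq_bigr => x _; rewrite mulr_sumr; apply: eq_bigr => m _.
  by rewrite (walk_rev nb_uniq nb_sym p_rev); ring.
rewrite !big_seq; apply: eq_bigr => x xk; rewrite (last_exit nb p T x uc) //.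
rewrite /esc inE kc // add0r [X in _ * X - _]exchange_big /=.
rewrite -mulrBr -sumrB mulr_sumr; apply: eq_bigr => y _.
rewrite -sumrB mulr_sumr; apply: eq_bigr => m _.
by rewrite -mulrBr subKr mulrA.
Qed.

(** The Green density from [x], integrated against the equilibrium measure of [cs], is the
    probability of a last visit to [cs], hence at most 1. *)
Lemma capac_le cs x (kap : R) : uniq cs -> (forall y, y \in cs -> kap <= g x y) ->
  kap * capac cs <= 1.
Proof.
move=> uc hk.
have c1 : (\sum_(y <- cs) tauoo (mem cs) y * \sum_(m < T) walkA pred0 m x y)
    @[T --> \oo] --> \sum_(y <- cs) tauoo (mem cs) y * (g x y * rho y).
  by apply: cvg_mul_sumr => y; exact: green_cvg.
apply: (@le_trans _ _ (\sum_(y <- cs) tauoo (mem cs) y * (g x y * rho y))).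
  rewrite /capac mulr_sumr !big_seq; apply: ler_sum => y yc.
  rewrite mulrA [X in X <= _]mulrC; apply: ler_wpM2l; first exact: tauoo_ge0.
  by rewrite ler_wpM2r ?hk // ltW.
have c2 := c1; rewrite -(cvg_shiftS _) in c2.
apply: (cvg_seq_le (v := fun=> 1) c2); first exact: cvg_cst.
move=> T /=.
have := @last_exit _ _ nb p pred0 cs T x uc.
have -> : tau pred0 T x = 1.
  elim: T x {hk c1 c2} => [|T IH] x //=.
  by rewrite (@eq_step _ _ nb p _ (fun=> 1)) ?step_cst // => z _; rewrite IH.
move=> -> //; rewrite -[leLHS]add0r lerD //.
  rewrite /esc; case: ifP => // _.
  by case/andP: (tau_ge0_le1 p_ge0 p_sum (mem cs) T x).
rewrite exchange_big /=; apply: ler_sum => y _; rewrite mulr_sumr.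
apply: ler_sum => m _; rewrite mulrC; apply: ler_wpM2l.
  exact: walkA_ge0.
exact: tauoo_le.
Qed.

(** The same last-exit decomposition used in the other direction; here the finite remaining time has
    to be removed, which is [lag_cvg]. *)
Lemma hit_le cs x (kap : R) : uniq cs -> (forall y, y \in cs -> g x y <= kap) ->
  1 - escoo (mem cs) x <= kap * capac cs.
Proof.
move=> uc hk.
have c1 : (esc (mem cs) T x + \sum_(y <- cs) lag pred0 cs x y T
  + \sum_(y <- cs) tauoo (mem cs) y * (g x y * rho y))
    @[T --> \oo] --> escoo (mem cs) x + \sum_(y <- cs) (0 : R)
       + \sum_(y <- cs) tauoo (mem cs) y * (g x y * rho y).
  apply: cvgD; last exact: cvg_cst.
  apply: cvgD; last first.
    by apply: (@cvg_rsum _ _ cs (lag pred0 cs x)) => y; exact: lag_cvg.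
  rewrite /esc /escoo; case: ifP => _; first exact: cvg_cst.
  exact: tau_cvg.
have : 1 <= escoo (mem cs) x + \sum_(y <- cs) (0 : R)
       + \sum_(y <- cs) tauoo (mem cs) y * (g x y * rho y).
  apply: (cvg_seq_le (u := fun=> 1) _ c1); first exact: cvg_cst.
  move=> T /=.
  have := @last_exit _ _ nb p pred0 cs T x uc.
  have -> : tau pred0 T x = 1.
    elim: T x {hk c1} => [|T IH] x //=.
    by rewrite (@eq_step _ _ nb p _ (fun=> 1)) ?step_cst // => z _; rewrite IH.
  move=> -> //; rewrite -addrA lerD2l exchange_big -big_split /=.
  apply: ler_sum => y _; rewrite -lerBlDl /lag -sumrB.
  under eq_bigr do rewrite -mulrBr subKr.
  rewrite -mulr_suml mulrC; apply: ler_wpM2l; first exact: tauoo_ge0.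
  exact: green_le.
rewrite big1 ?addr0 // -lerBlDl => /le_trans; apply.
rewrite /capac mulr_sumr !big_seq; apply: ler_sum => y yc.
have -> : kap * (rho y * tauoo (mem cs) y) =
  tauoo (mem cs) y * (kap * rho y) by ring.
apply: ler_wpM2l; first exact: tauoo_ge0.
by rewrite ler_wpM2r ?hk // ltW.
Qed.

(* Reversing time turns the entrance law into the Green function killed on
   [cs], which on [near] is compared with the escape probability through the
   maximum principle. *)
Lemma entrance_le cs (near : pred E) (kap : R) (x y : E) N : uniq cs ->
  (forall y, y \in cs -> near y) -> 0 <= kap ->
  (forall y z, near y -> z \in nb y -> ~~ near z ->
     1 / 2 <= escoo (mem cs) z /\ g z x <= kap) ->
  ~~ near x -> y \in cs ->
  \sum_(n < N) walkB (mem cs) n x y <= 2 * kap * (rho y * tauoo (mem cs) y).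
Proof.
move=> uc cn kap0 bd xn yc.
pose good z := near z \/ (1 / 2 <= escoo (mem cs) z /\ g z x <= kap).
(* Maximum principle by induction on the number of steps. Outside [near] the two bounds of [bd] give
   the claim directly; inside, both sides are averaged over one step, the term of time 0 vanishing
   because [x] is not in [near]. *)
have claim M z : good z -> z \notin cs ->
    \sum_(n < M) walkA (mem cs) n z x <= 2 * kap * rho x * escoo (mem cs) z.
  elim: M z => [|M IH] z gz zc.
    rewrite big_ord0 !mulr_ge0 ?(ltW (rho_gt0 _)) //.
    by rewrite /escoo; case: ifP => // _; exact: tauoo_ge0.
  have far : 1 / 2 <= escoo (mem cs) z /\ g z x <= kap ->
      \sum_(n < M.+1) walkA (mem cs) n z x <= 2 * kap * rho x * escoo (mem cs) z.
    move=> [h1 h2]; apply: le_trans (green_le _ _ _ _) _.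
    apply: (@le_trans _ _ (kap * rho x)); first by rewrite ler_wpM2r // ltW.
    have : 0 <= kap * rho x by rewrite mulr_ge0 // ltW.
    nra.
  case: gz => // nz.
  rewrite big_ord_recl /=; case: eqP => [e|_]; first by rewrite -e nz in xn.
  rewrite add0r -step_sum /escoo inE (negbTE zc) tauoo_step // -stepZ.
  apply: le_step => // t tz; rewrite /escoo inE.
  case: ifP => tc; first by rewrite big1 ?mulr0.
  have := IH t; rewrite /escoo inE tc; apply => //.
  by have [nt|nt] := boolP (near t); [left|right; exact: bd nz tz nt].
case: N => [|N].
  by rewrite big_ord0 !mulr_ge0 ?(ltW (rho_gt0 _)) // tauoo_ge0.
rewrite big_ord_recl [walkB _ _ _ _]/=.
case: eqP => [e|_]; first by rewrite e (cn _ yc) in xn.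
rewrite add0r -(ler_pM2l (rho_gt0 x)) mulr_sumr.
under eq_bigr do rewrite -(walk_rev nb_uniq nb_sym p_rev).
rewrite -mulr_sumr.
have -> : rho x * (2 * kap * (rho y * tauoo (mem cs) y)) =
  rho y * (2 * kap * rho x * tauoo (mem cs) y) by ring.
apply: ler_wpM2l; first exact: ltW.
rewrite tauoo_step // -stepZ /= -step_sum; apply: le_step => // z zy.
rewrite /escoo inE; case: ifP => zc; first by rewrite big1 ?mulr0.
have := claim N z; rewrite /escoo inE zc; apply => //.
by have [nt|nt] := boolP (near z); [left|right; exact: bd (cn _ yc) zy nt].
Qed.

End Potential.

(** * Traces of the walk *)

Lemma op_sum (R : realType) (X : finType) (m : {set X} -> R) n (c : nat -> R)
    (f : nat -> {set X} -> R) S :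
  op m (fun Y => \sum_(l < n) c l * f l Y) S = \sum_(l < n) c l * op m (f l) S.
Proof.
rewrite /op; under eq_bigr do rewrite mulr_sumr.
rewrite exchange_big; apply: eq_bigr => l _ /=; rewrite mulr_sumr.
by apply: eq_bigr => S' _; rewrite mulrCA.
Qed.

Section Trace.
Variables (R : realType) (E : choiceType) (nb : E -> seq E).
Variables (p : E -> E -> R).
Hypotheses (p_ge0 : forall x y, 0 <= p x y).
Hypotheses (p_sum : forall x, \sum_(y <- nb x) p x y = 1).
Local Notation tau := (tau nb p).
Local Notation esc := (esc nb p).
Local Notation step := (step nb p).
Local Notation walkB := (walkB nb p).
Variable cs : seq E.
Local Notation X := (seq_sub cs).
Implicit Types (F : {set X} -> R) (S : {set X}) (x y : E).

Definition point_trace x : {set X} := [set i : X | ssval i == x]%SET.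

Lemma point_trace_notin x : x \notin cs -> point_trace x = finset.set0.
Proof.
move=> xc; apply/finset.setP => i; rewrite !inE; apply/eqP => e.
by rewrite -e (valP i) in xc.
Qed.

(* The mean of [F] of [S] joined with the trace left on [cs] until time [n] or
   the exit from [U], a path that exits at [y] with [k] steps to go being
   weighted by [c k y]. *)
Fixpoint trace (U : pred E) (c : nat -> E -> R) n F x S : R :=
  match n with
  | 0%N => if U x then F (S :|: point_trace x) else c 0%N x * F S
  | k.+1 => if U x then step (fun y => trace U c k F y (S :|: point_trace x)) x
            else c n x * F S
  end.

Lemma trace_ext U c n F F' x S : F =1 F' -> trace U c n F x S = trace U c n F' x S.
Proof.
move=> h; elim: n x S => [|n IH] x S /=; first by rewrite !h.
by rewrite h; case: ifP => // _; apply: eq_step => y _.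
Qed.

Lemma trace_lin U c n a F F' x S :
  trace U c n (fun S => F S + a * F' S) x S =
  trace U c n F x S + a * trace U c n F' x S.
Proof.
elim: n x S => [|n IH] x S /=; case: ifP => // _; try by ring.
rewrite -stepZ -stepD; apply: eq_step => y _; exact: IH.
Qed.

Lemma trace0 U c n x S : trace U c n (fun=> 0) x S = 0.
Proof.
have := trace_lin U c n (-1) (fun=> 0) (fun=> 0) x S.
rewrite (@trace_ext U c n _ (fun=> 0)); last by move=> ?; rewrite mulr0 addr0.
by rewrite mulN1r subrr.
Qed.

Lemma trace_sum U c n (I : Type) (r : seq I) (a : I -> R) (F : I -> {set X} -> R) x S :
  trace U c n (fun S => \sum_(i <- r) a i * F i S) x S =
  \sum_(i <- r) a i * trace U c n (F i) x S.
Proof.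
elim: r => [|i r IH].
  rewrite big_nil -[RHS](trace0 U c n x S); apply: trace_ext => S'.
  by rewrite big_nil.
rewrite big_cons -IH addrC -trace_lin; apply: trace_ext => S'.
by rewrite big_cons addrC.
Qed.

Lemma trace_shift U c n F x S0 S :
  trace U c n (fun S => F (S0 :|: S)) x S = trace U c n F x (S0 :|: S).
Proof.
elim: n x S => [|n IH] x S /=; case: ifP => // _; first by rewrite finset.setUA.
by apply: eq_step => y _; rewrite IH finset.setUA.
Qed.

(** The walk ignores the set it is joined to, so it acts on functions as a convolution with the
    weights of its traces. This turns walks into Poisson marks. *)
Lemma trace_kernel U c n F x S : trace U c n F x S =
  \sum_S' trace U c n (fun S => (S == S')%:R) x finset.set0 * F (S :|: S').
Proof.
rewrite -[S in LHS]finset.setU0 -trace_shift.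
rewrite (@trace_ext U c n _ (fun Y => \sum_S' F (S :|: S') * (Y == S')%:R)).
  by rewrite trace_sum; apply: eq_bigr => S' _; rewrite mulrC.
move=> Y; rewrite (bigD1 Y) //= eqxx mulr1 big1 ?addr0 // => i /negbTE.
by rewrite eq_sym => ->; rewrite mulr0.
Qed.

Lemma trace_ge0 U c n F x S : (forall k y, 0 <= c k y) ->
  (forall S, 0 <= F S) -> 0 <= trace U c n F x S.
Proof.
move=> c0 F0; elim: n x S => [|n IH] x S /=; case: ifP => _ //;
  rewrite ?mulr_ge0 //.
by apply: step_ge0.
Qed.

Lemma trace_le U c n F F' x S : (forall k y, 0 <= c k y) ->
  (forall S, F S <= F' S) -> trace U c n F x S <= trace U c n F' x S.
Proof.
move=> c0 h; rewrite -subr_ge0 -[X in _ - X]mul1r -mulNr -trace_lin.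
by apply: trace_ge0 => // S'; rewrite mulN1r subr_ge0.
Qed.

Lemma trace_mono U c n F x : (forall k y, 0 <= c k y) -> mono F ->
  mono (trace U c n F x).
Proof.
move=> c0 Fm S S' SS'; rewrite -[S]finset.setU0 -[S']finset.setU0.
rewrite -!trace_shift; apply: trace_le => // Y.
by apply: Fm; exact: finset.setSU.
Qed.

(** No step leads from [U1] to [U2]; a path started off [U2] therefore leaves its whole trace up to
    the exit from [U] inside [U1]. *)
Lemma trace_support (U U1 U2 : pred E) c n F x S :
  (forall y, U y -> U1 y || U2 y) ->
  (forall y z, U1 y -> z \in nb y -> ~~ U2 z) -> ~~ U2 x ->
  (forall S', S' \subset [set i : X | U1 (ssval i)]%SET -> F (S :|: S') = 0) ->
  trace U c n F x S = 0.
Proof.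
move=> U12 nadj.
elim: n x S => [|n IH] x S xU2 F0 /=; have FS : F S = 0 by
  rewrite -[S]finset.setU0; apply: F0; exact: finset.sub0set.
all: rewrite FS mulr0; case: ifP => // Ux.
all: have U1x : U1 x by have := U12 _ Ux; rewrite (negbTE xU2) orbF.
all: have trU : point_trace x \subset [set i : X | U1 (ssval i)]%SET by
  apply/fintype.subsetP => i; rewrite !inE => /eqP ->.
  by apply: F0.
rewrite (@eq_step _ _ nb p _ (fun=> 0)) ?/step; last first.
  move=> y yx; apply: IH => [|S' S'1]; first exact: nadj yx.
  by rewrite -finset.setUA F0 // finset.subUset trU.
by rewrite /step big1 // => y _; rewrite mulr0.
Qed.

Hypothesis cs_uniq : uniq cs.
Variable U : pred E.
Hypothesis csU : forall y, y \in cs -> U y.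

(* The walk until time [n], the walk until its exit from [U], and the latter on
   the event that [cs] is not visited between the exit and time [n]. *)
Definition full := trace predT (fun _ _ => 1).
Definition exc := trace U (fun _ _ => 1).
Definition one := trace U (esc (mem cs)).

Let esc_ge0_le1 C k y : 0 <= esc C k y <= 1.
Proof.
by rewrite /esc; case: ifP; rewrite ?lexx ?ler01 // => _; exact: tau_ge0_le1.
Qed.

Let tauE C k y : tau C k.+1 y = step (esc C k) y.
Proof. by []. Qed.

Lemma exc_cst n a x S : exc n (fun=> a) x S = a.
Proof.
rewrite /exc; elim: n x S => [|n IH] x S /=; case: ifP; rewrite ?mul1r // => _.
by rewrite (@eq_step _ _ nb p _ (fun=> a)) ?step_cst.
Qed.

Lemma full_cst n a x S : full n (fun=> a) x S = a.
Proof.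
rewrite /full; elim: n x S => [|n IH] x S //=.
by rewrite (@eq_step _ _ nb p _ (fun=> a)) ?step_cst.
Qed.

Lemma full_incr n F x S : mono F -> full n F x S <= full n.+1 F x S.
Proof.
move=> Fm; rewrite /full; elim: n x S => [|n IH] x S.
  rewrite /= -[leLHS](step_cst p_sum _ x); apply: le_step => // y _.
  by apply: Fm; exact: finset.subsetUl.
by apply: le_step => // y _; exact: IH.
Qed.

Lemma full_homo F x S : mono F ->
  {homo (fun n => full n F x S) : k l / (k <= l)%N >-> k <= l}.
Proof.
move=> Fm; apply: homo_leq => [//|? ? ?|k]; first exact: le_trans.
exact: full_incr.
Qed.

Lemma exc_incr n F x S : mono F -> exc n F x S <= exc n.+1 F x S.
Proof.
move=> Fm; rewrite /exc; elim: n x S => [|n IH] x S.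
  rewrite /=; case: ifP => // Ux.
  rewrite -[leLHS](step_cst p_sum _ x); apply: le_step => // y _.
  case: ifP => _; last by rewrite mul1r.
  by apply: Fm; exact: finset.subsetUl.
rewrite [leRHS]/= [leLHS]/=; case: ifP => // _.
by apply: le_step => // y _; exact: IH.
Qed.

Lemma exc_homo F x S : mono F ->
  {homo (fun n => exc n F x S) : k l / (k <= l)%N >-> k <= l}.
Proof.
move=> Fm; apply: homo_leq => [//|? ? ?|k]; first exact: le_trans.
exact: exc_incr.
Qed.

Lemma one_le_exc n F x S : (forall S, 0 <= F S) -> one n F x S <= exc n F x S.
Proof.
move=> F0; rewrite /one /exc; elim: n x S => [|n IH] x S.
  rewrite /=; case: ifP => // _; apply: ler_wpM2r => //.
  by case/andP: (esc_ge0_le1 (mem cs) 0 x).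
rewrite [leRHS]/= [leLHS]/=; case: ifP => // _.
  by apply: le_step => // y _.
apply: ler_wpM2r => //; by case/andP: (esc_ge0_le1 (mem cs) n.+1 x).
Qed.

(** Paths that avoid [cs] add nothing to [S], and the remaining paths contribute nonnegatively. *)
Lemma esc_le_full n F x S : (forall S, 0 <= F S) -> x \notin cs ->
  esc (mem cs) n x * F S <= full n F x S.
Proof.
move=> F0; rewrite /full; elim: n x S => [|n IH] x S xc.
  by rewrite /= point_trace_notin // finset.setU0 ler_piMl //;
     case/andP: (esc_ge0_le1 (mem cs) 0 x).
rewrite /= point_trace_notin // finset.setU0 {1}/esc inE (negbTE xc) tauE mulrC -stepZ.
apply: le_step => // y _; have [yc|yc] := boolP (y \in cs).
  by rewrite /esc inE yc mulr0; apply: trace_ge0.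
by rewrite mulrC; exact: IH.
Qed.

Lemma one_le_full n F x S : (forall S, 0 <= F S) -> one n F x S <= full n F x S.
Proof.
move=> F0.
have out k y Y : U y = false -> esc (mem cs) k y * F Y <= full k F y Y.
  by move=> Uy; apply: esc_le_full => //; apply/negP => /csU; rewrite Uy.
elim: n x S => [|n IH] x S.
  have := out 0%N x S; rewrite /one /full /=; case: ifP => // _; exact.
rewrite {1}/one [leLHS]/=; case: ifP => [_|]; last exact: out.
by apply: le_step => // y _; exact: IH.
Qed.

Lemma one_ge_half_exc n F x S : (forall S, 0 <= F S) ->
  (forall k y, ~~ U y -> 1 / 2 <= esc (mem cs) k y) ->
  exc n F x S / 2 <= one n F x S.
Proof.
move=> F0 h; rewrite mulrC.
have h' k y : U y = false -> 2^-1 <= esc (mem cs) k y.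
  by move=> Uy; rewrite -[2^-1]mul1r; apply: h; rewrite Uy.
elim: n x S => [|n IH] x S; rewrite /one /exc /=; case: ifP => Ux.
- by rewrite ler_piMl //; lra.
- by rewrite mul1r ler_wpM2r // h'.
- by rewrite -stepZ; apply: le_step => // y _; exact: IH.
- by rewrite mul1r ler_wpM2r // h'.
Qed.

(** Decomposition at the first entrance into [cs]. It takes at least one step, so at most [n] steps
    remain, and monotonicity raises the remaining time to exactly [n]. *)
Lemma full_first_entrance n F x S : mono F -> x \notin cs ->
  full n.+1 F x S <= esc (mem cs) n.+1 x * F S
    + \sum_(y <- cs) (\sum_(m < n.+2) walkB (mem cs) m x y) * full n F y S.
Proof.
move=> Fm.
have Brec k z : z \notin cs -> \sum_(y <- cs) (\sum_(m < k.+2) walkB (mem cs) m z y) * full n F y S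
   = step (fun t => \sum_(y <- cs) (\sum_(m < k.+1) walkB (mem cs) m t y) * full n F y S) z.
  move=> zc; rewrite step_sum !big_seq; apply: eq_bigr => y yc.
  rewrite big_ord_recl [walkB _ _ _ _]/=.
  case: eqP => [e|_]; first by rewrite e yc in zc.
  rewrite add0r [X in step X z](_ : _ = fun t => full n F y S * \sum_(m < k.+1) walkB (mem cs) m t y); last first.
    by apply/funext => t; rewrite mulrC.
  rewrite stepZ mulrC; congr (_ * _); rewrite step_sum.
  by apply: eq_bigr => m _; rewrite /= (negbTE zc).
have Bin k t : t \in cs -> \sum_(y <- cs) (\sum_(m < k.+1) walkB (mem cs) m t y) * full n F y S
   = full n F t S.
  move=> tc; rewrite (big_rem t) //= [X in _ + X]big_seq [X in _ + X]big1 ?addr0.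
    rewrite big_ord_recl /= eqxx big1 ?addr0 ?mul1r // => m _ /=.
    by rewrite /= tc.
  move=> y; rewrite mem_rem_uniq // !inE eq_sym => /andP[/negbTE ty yc].
  rewrite big_ord_recl /= ty add0r big1 ?mul0r // => m _ /=.
  by rewrite /= tc.
have main k z : (k <= n)%N -> z \notin cs -> full k.+1 F z S <= esc (mem cs) k.+1 z * F S
    + \sum_(y <- cs) (\sum_(m < k.+2) walkB (mem cs) m z y) * full n F y S.
  elim: k z => [|k IH] z kn zc; rewrite Brec // {1}/esc inE (negbTE zc) tauE;
    rewrite {1}/full [trace _ _ _ _ _ _]/= point_trace_notin // finset.setU0 mulrC -stepZ -stepD;
    apply: le_step => // t _; have [tc|tc] := boolP (t \in cs).
  - rewrite Bin // /esc inE tc mulr0 add0r.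
    exact: (@full_homo F t S Fm 0%N n).
  - rewrite {1}point_trace_notin // finset.setU0 /esc inE (negbTE tc) mulr1 lerDl.
    rewrite big_seq; apply: sumr_ge0 => y yc.
    rewrite big_ord_recl big_ord0 addr0 /=.
    case: eqP => [e|_]; first by rewrite e yc in tc.
    by rewrite mul0r.
  - rewrite Bin // /esc inE tc mulr0 add0r -/(full k.+1 F t S).
    exact: (@full_homo F t S Fm k.+1 n).
  - rewrite [F S * _]mulrC; apply: IH => //; exact: ltnW.
exact: main.
Qed.

Variables (e : E -> R) (a : R).
Hypotheses (e0 : forall y, 0 <= e y) (a0 : 0 <= a).
Hypothesis entr : forall x y N, ~~ U x -> y \in cs ->
  \sum_(n < N) walkB (mem cs) n x y <= a * e y.

(** The walk started from the measure [e], which will be the equilibrium measure of [cs]; [kern] is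
    the resulting intensity of traces. *)
Definition mixed (ph : ({set X} -> R) -> E -> {set X} -> R) F S : R :=
  \sum_(y <- cs) e y * ph F y S.

Definition kern (ph : ({set X} -> R) -> E -> {set X} -> R) S' : R :=
  mixed ph (fun S => (S == S')%:R) finset.set0.

Lemma op_kern V c n F S : op (kern (trace V c n)) F S = mixed (trace V c n) F S.
Proof.
rewrite /op /kern /mixed; under [RHS]eq_bigr do rewrite trace_kernel mulr_sumr.
rewrite [RHS]exchange_big /=; apply: eq_bigr => S' _; rewrite mulr_suml.
by apply: eq_bigr => y _; rewrite mulrA.
Qed.

Lemma le_mixed ph ph' F F' S : (forall y, y \in cs -> ph F y S <= ph' F' y S) ->
  mixed ph F S <= mixed ph' F' S.
Proof.
move=> h; rewrite /mixed !big_seq; apply: ler_sum => y yc.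
by rewrite ler_wpM2l // h.
Qed.

(** A walk counted by [full] but not by [one] enters [cs] after leaving [U]. Its entrance law is at
    most [a * e] by [entr], so what follows the excursion is dominated by [a] times a fresh walk
    started from [e]. *)
Lemma full_sub_one_le n k F x S : mono F -> (forall S, 0 <= F S) -> (k <= n.+1)%N ->
  full k F x S - one k F x S <= a * exc k (mixed (full n) F) x S.
Proof.
move=> Fm F0.
have M0 Y : 0 <= mixed (full n) F Y.
  by apply: sumr_ge0 => y _; rewrite mulr_ge0 //; apply: trace_ge0.
have rhs0 j y Y : 0 <= a * exc j (mixed (full n) F) y Y.
  by rewrite mulr_ge0 //; apply: trace_ge0.
elim: k x S => [|k IH] x S kn.
  apply: le_trans (rhs0 0%N x S); rewrite subr_le0 /full /one /=.
  case: ifP => // /negbT Ux; have xc : x \notin cs by apply: contra Ux; exact: csU.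
  by rewrite point_trace_notin // finset.setU0 /esc inE (negbTE xc) mul1r.
rewrite /one /exc [trace U _ _ _ _ _]/= [X in _ <= _ * X]/=.
have [Ux|Ux] := boolP (U x).
  rewrite -[X in _ - X]mul1r -mulNr -!stepZ -stepD; apply: le_step => // y _.
  by rewrite mulN1r; apply: IH; exact: ltnW.
have xc : x \notin cs by apply: contra Ux; exact: csU.
rewrite mul1r lerBlDl; apply: le_trans (full_first_entrance _ _ Fm xc) _.
rewrite lerD2l /mixed mulr_sumr !big_seq; apply: ler_sum => y yc.
rewrite mulrA; apply: ler_pM.
- by apply: sumr_ge0 => m _; apply: walkB_ge0.
- by apply: trace_ge0.
- exact: entr.
- exact: full_homo.
Qed.

(** Repeating the comparison after every exit from [U] splits the walk into excursions, each return
    costing a factor [a]. The excursion horizon [T] is held fixed so that one kernel serves all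
    terms. *)
Lemma mixed_full_le n T F S : mono F -> (forall S, 0 <= F S) -> (n <= T)%N ->
  mixed (full n) F S <= \sum_(l < n.+1) a ^+ l * iter l.+1 (op (kern (exc T))) F S.
Proof.
move=> Fm F0; elim: n S => [|n IH] S nT.
  rewrite big_ord_recl big_ord0 addr0 expr0 mul1r /= op_kern.
  apply: le_mixed => y yc; apply: le_trans (exc_homo _ _ Fm nT).
  by rewrite /full /exc /= csU.
have Mm : mono (mixed (full n) F).
  move=> Y Y' YY'; apply: ler_sum => y _; rewrite ler_wpM2l //.
  by apply: trace_mono.
have st : mixed (full n.+1) F S <= op (kern (exc T)) F S
    + a * op (kern (exc T)) (mixed (full n) F) S.
  rewrite !op_kern /mixed mulr_sumr -big_split /=; apply: ler_sum => y _.
  rewrite [a * _]mulrCA -mulrDr ler_wpM2l //.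
  have := full_sub_one_le y S Fm F0 (leqnn n.+1).
  have h1 := one_le_exc n.+1 y S F0.
  have h2 : exc n.+1 F y S <= exc T F y S by exact: exc_homo.
  have h3 : a * exc n.+1 (mixed (full n) F) y S <= a * exc T (mixed (full n) F) y S.
    by rewrite ler_wpM2l //; exact: exc_homo.
  move=> h4; apply: (@le_trans _ _ (exc T F y S + a * exc T (mixed (full n) F) y S)) => //.
  lra.
apply: le_trans st _; rewrite big_ord_recl expr0 mul1r lerD2l.
have -> : \sum_(i < n.+1) a ^+ (lift ord0 i) * iter (lift ord0 i).+1 (op (kern (exc T))) F S
  = a * op (kern (exc T)) (fun Y => \sum_(l < n.+1) a ^+ l * iter l.+1 (op (kern (exc T))) F Y) S.
  rewrite (@op_sum _ _ _ _ (fun l => a ^+ l)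
    (fun l Y => iter l.+1 (op (kern (exc T))) F Y)) mulr_sumr.
  by apply: eq_bigr => l _; rewrite exprS -mulrA.
rewrite ler_wpM2l // !op_kern; apply: le_mixed => y _.
by apply: trace_le => // Y; apply: IH; exact: ltnW.
Qed.

Definition kern2 n S' : R := kern (full n) S' - kern (one n) S'.

Lemma kern_exc_ge0 n S : 0 <= kern (exc n) S.
Proof.
by apply: sumr_ge0 => y _; rewrite mulr_ge0 //; apply: trace_ge0 => // S';
  rewrite ler0n.
Qed.

Lemma kern2_ge0 n S : 0 <= kern2 n S.
Proof.
rewrite subr_ge0; apply: le_mixed => y _; exact: one_le_full.
Qed.

Lemma kern_one_ge n S : (forall k y, ~~ U y -> 1 / 2 <= esc (mem cs) k y) ->
  kern (exc n) S / 2 <= kern (one n) S.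
Proof.
move=> h; rewrite /kern /mixed mulr_suml; apply: ler_sum => y _.
rewrite -mulrA ler_wpM2l //; exact: one_ge_half_exc.
Qed.

Lemma mass_kern_exc n : mass (kern (exc n)) = \sum_(y <- cs) e y.
Proof.
have : op (kern (exc n)) (fun=> 1) finset.set0 = \sum_(y <- cs) e y.
  by rewrite op_kern; apply: eq_bigr => y _; rewrite -/(exc _) exc_cst mulr1.
by rewrite /op; under eq_bigr do rewrite mulr1.
Qed.

(** The difference that defines [kern2] forces a first excursion and one return, so the series
    starts with one factor [a] and two excursions. *)
Lemma op_kern2_le n F : mono F -> (forall S, 0 <= F S) ->
  op (kern2 n.+1) F finset.set0 <=
    \sum_(l < n.+1) a ^+ l.+1 * iter l.+2 (op (kern (exc n.+1))) F finset.set0.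
Proof.
move=> Fm F0.
have -> : op (kern2 n.+1) F finset.set0 =
    mixed (full n.+1) F finset.set0 - mixed (one n.+1) F finset.set0.
  rewrite -!op_kern /op -sumrB; apply: eq_bigr => S _.
  by rewrite -mulrBl.
apply: (@le_trans _ _ (a * op (kern (exc n.+1)) (mixed (full n) F) finset.set0)).
  rewrite op_kern /mixed -sumrB mulr_sumr; apply: ler_sum => y _.
  by rewrite -mulrBr mulrCA ler_wpM2l //; exact: full_sub_one_le.
have -> : \sum_(l < n.+1) a ^+ l.+1 * iter l.+2 (op (kern (exc n.+1))) F finset.set0
  = a * op (kern (exc n.+1)) (fun Y => \sum_(l < n.+1) a ^+ l * iter l.+1 (op (kern (exc n.+1))) F Y) finset.set0.
  rewrite (@op_sum _ _ _ _ (fun l => a ^+ l)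
    (fun l Y => iter l.+1 (op (kern (exc n.+1))) F Y)) mulr_sumr.
  by apply: eq_bigr => l _; rewrite exprS -mulrA.
rewrite ler_wpM2l // !op_kern; apply: le_mixed => y _.
by apply: trace_le => // Y; apply: mixed_full_le.
Qed.

Lemma full_avoid (K : {set X}) n x S :
  full n (avoid R K) x S =
  avoid R K S * esc (mem [seq ssval i | i <- enum K]) n x.
Proof.
have av y : avoid R K (point_trace y) = (y \notin [seq ssval i | i <- enum K])%:R.
  rewrite /avoid; congr (nat_of_bool _)%:R; apply/eqP/idP => [h|h].
    apply/negP => /mapP[i]; rewrite mem_enum => iK yi.
    have : i \in point_trace y :&: K by rewrite !inE iK yi eqxx.
    by rewrite h inE.
  apply/finset.setP => i; rewrite !inE; apply/negP => /andP[/eqP iy iK].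
  by move/negP : h; apply; apply/mapP; exists i; rewrite ?mem_enum.
rewrite /full; elim: n x S => [|n IH] x S.
  by rewrite /= avoidU av /esc inE; case: (_ \in _).
rewrite /= (@eq_step _ _ nb p _ (fun y => avoid R K S * avoid R K (point_trace x) * esc (mem [seq ssval i | i <- enum K]) n y)); last first.
  by move=> y _; rewrite IH avoidU.
rewrite stepZ av {2}/esc inE; case: (_ \in _) => /=; first by rewrite !(mulr0, mul0r).
by rewrite mulr1.
Qed.

(** Both kernels together are that of the unrestricted walk, and its rate of visiting [K] is the
    quantity whose limit [sweeping] computes. *)
Lemma hit_kern n (K : {set X}) : hit (fun S => kern (one n) S + kern2 n S) K =
  \sum_(y <- cs) e y * (1 - esc (mem [seq ssval i | i <- enum K]) n y).
Proof.
transitivity (op (kern (full n)) (fun S => 1 + (-1) * avoid R K S) finset.set0).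
  apply: eq_bigr => S _; rewrite finset.set0U mulN1r /kern2.
  by rewrite addrC subrK.
rewrite op_lin !op_kern /mixed mulN1r -sumrB; apply: eq_bigr => y _.
rewrite -mulrBr; congr (_ * (_ - _)); first exact: full_cst.
by rewrite [LHS]full_avoid avoid0 mul1r.
Qed.

Lemma kern_one_support n S' (U1 U2 : pred E) :
  (forall y, U y = U1 y || U2 y) -> (forall y, ~~ (U1 y && U2 y)) ->
  (forall y z, U1 y -> z \in nb y -> ~~ U2 z) ->
  (forall y z, U2 y -> z \in nb y -> ~~ U1 z) ->
  kern (one n) S' != 0 ->
  (S' \subset [set i : X | U1 (ssval i)]%SET)
    || (S' \subset [set i : X | U2 (ssval i)]%SET).
Proof.
move=> U12 dis n12 n21; apply: contraNT; rewrite negb_or => /andP[h1 h2].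
rewrite /kern /mixed big_seq big1 // => y yc.
have z W : ~~ (S' \subset W) ->
    forall S, S \subset W -> ((finset.set0 :|: S == S')%:R : R) = 0.
  move=> h S SW; rewrite finset.set0U; case: eqP => // e'.
  by rewrite -e' SW in h.
have := csU yc; rewrite U12; have := dis y.
case Uy1 : (U1 y) => /=.
  move=> nU2 _; rewrite /one (@trace_support U U1 U2) ?mulr0 //.
    by move=> ?; rewrite U12.
  exact: z.
move=> _ Uy2; rewrite /one (@trace_support U U2 U1) ?mulr0 ?Uy1 //.
  by move=> ?; rewrite U12 orbC.
exact: z.
Qed.

End Trace.

(** * Decoupling *)

Section FiniteLaw.
Variables (R : realType) (E : choiceType).
Variables (d : measure_display) (Omega : measurableType d).
Variables (mu : probability Omega R) (I : Omega -> set E).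
Hypothesis Im : forall x, measurable [set om | I om x].
Variable cs : seq E.
Local Notation X := (seq_sub cs).
Implicit Types (S K : {set X}) (A : set (E -> bool)).

Definition trace_on om : {set X} := [set i : X | ssval i \in I om]%SET.

Lemma measurable_trace_on S : measurable [set om | trace_on om = S].
Proof.
rewrite (_ : mkset _ = \bigcap_(i in [set: X])
   (if i \in S then [set om | I om (ssval i)] else ~` [set om | I om (ssval i)])).
  apply: fin_bigcap_measurable => // i _; case: ifP => _ //.
  exact: measurableC.
apply/seteqP; split => om /=.
  move=> <- i _; rewrite inE; case: ifPn => [|/negP] /= h; first exact: set_mem.
  by move=> h'; apply: h; exact: mem_set.
move=> h; apply/finset.setP => i; have := h i Logic.I; rewrite inE.
by case: ifP => _ /= h'; [apply/mem_set|apply/negP => /set_mem].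
Qed.

Definition trace_law S : R := fine (mu [set om | trace_on om = S]).

Lemma prob_trace_on (B : pred {set X}) :
  mu [set om | B (trace_on om)] = (\sum_S trace_law S * (B S)%:R)%:E /\
  measurable [set om | B (trace_on om)].
Proof.
have e : [set om | B (trace_on om)] = \bigcup_(S in [set S | B S]) [set om | trace_on om = S].
  apply/seteqP; split => om /=; first by move=> h; exists (trace_on om).
  by move=> [S /= BS ->].
have fD : finite_set [set S | B S] by exact: finite_finset.
split; rewrite e; last first.
  by apply: fin_bigcup_measurable => // S _; exact: measurable_trace_on.
rewrite measure_fin_bigcup //; last 2 first.
- by move=> S S' _ _ [om [/= <- <-]].
- by move=> S _; exact: measurable_trace_on.
rewrite (eq_fsbigr (fun S => (trace_law S)%:E)); last first.
  by move=> S _; rewrite /trace_law fineK // fin_num_measure //; exact: measurable_trace_on.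
rewrite fsbig_finite //= -[RHS]sumEFin.
rewrite [RHS](eq_bigr (fun S => if B S then (trace_law S)%:E else 0%E)); last first.
  by move=> S _; case: (B S); rewrite ?mulr1 ?mulr0.
rewrite -[RHS]big_mkcond /= -[RHS]big_filter; apply: perm_big.
apply: uniq_perm.
- exact: finmap.fset_uniq.
- by rewrite filter_uniq // index_enum_uniq.
move=> S; rewrite mem_filter mem_index_enum andbT in_fset_set //.
by apply/idP/idP => [/set_mem|/mem_set].
Qed.

Definition config S : E -> bool := fun x => x \in [seq ssval i | i <- enum S].

(** Stands in for measurability with respect to the coordinates in [C], and transfers at once to
    configurations carried by a finite set. *)
Definition local (C : pred E) A :=
  forall w w' : E -> bool, (forall x, C x -> w x = w' x) -> A w -> A w'.

Definition indic A S : R := `[< A (config S) >]%:R.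

Lemma config_trace om x : x \in cs -> config (trace_on om) x = (x \in I om).
Proof.
move=> xc; apply/mapP/idP => [[i]|xI].
  by rewrite mem_enum inE => h ->.
by exists (SeqSub xc) => //; rewrite mem_enum inE.
Qed.

Lemma localE A om : local (mem cs) A ->
  A (fun x => x \in I om) <-> A (config (trace_on om)).
Proof.
move=> h; split; apply: h => x /= xc; rewrite config_trace //.
Qed.

Lemma event_trace A : local (mem cs) A ->
  mu [set om | A (fun x => x \in I om)] = (\sum_S trace_law S * indic A S)%:E /\
  measurable [set om | A (fun x => x \in I om)].
Proof.
move=> h; have := prob_trace_on (fun S => `[< A (config S) >]).
rewrite (_ : [set om | _] = [set om | A (fun x => x \in I om)]) //.
apply/seteqP; split => om /=; first by move=> /asboolP/(localE _ h).
by move=> hA; apply/asboolP/(localE _ h).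
Qed.

Lemma trace_law_avoid K : (\sum_S trace_law S * avoid R K S)%:E =
  mu [set om | forall x, x \in [seq ssval i | i <- enum K] -> ~ I om x].
Proof.
rewrite -(prob_trace_on (fun S => S :&: K == finset.set0)).1; congr (mu _).
apply/seteqP; split => om /=.
  move=> /eqP h x /mapP[i]; rewrite mem_enum => iK -> Ii.
  have : i \in trace_on om :&: K by rewrite !inE iK andbT; exact: mem_set.
  by rewrite h inE.
move=> h; apply/eqP/finset.setP => i; rewrite !inE; apply/negP => /andP[iI iK].
apply: (h (ssval i)); last exact: set_mem.
by apply/mapP; exists i; rewrite ?mem_enum.
Qed.

End FiniteLaw.

(** * Decoupling of two pieces of a finite set *)

Section Decoupling.
Variables (R : realType) (E : choiceType) (nb : E -> seq E).
Variables (p : E -> E -> R) (rho : E -> R).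
Hypotheses (nb_uniq : forall x, uniq (nb x)).
Hypotheses (nb_sym : forall x y, (y \in nb x) = (x \in nb y)).
Hypotheses (p_ge0 : forall x y, 0 <= p x y).
Hypotheses (p_sum : forall x, \sum_(y <- nb x) p x y = 1).
Hypotheses (rho_gt0 : forall x, 0 < rho x).
Hypotheses (p_rev : forall x y, rho x * p x y = rho y * p y x).
Variable g : E -> E -> R.
Hypothesis green_cvg : forall x y,
  (\sum_(n < N) walkA nb p pred0 n x y) @[N --> \oo] --> g x y * rho y.
Local Notation capac := (capac nb p rho).
Variables (d : measure_display) (Omega : measurableType d).
Variables (mu : probability Omega R) (I : R -> Omega -> set E).
Hypothesis Im : forall (u : R) x, 0 <= u -> measurable [set om | I u om x].
Hypothesis Ilaw : forall (u : R) ks, 0 <= u -> uniq ks ->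
  mu [set om | forall x, x \in ks -> ~ I u om x] = (expR (- (u * capac ks)))%:E.

Definition prob (A : set (E -> bool)) (u : R) : R := fine (mu (event_at I A u)).

Variables (cs : seq E) (U1 U2 near : pred E) (kap del u : R).
Hypotheses (cs_uniq : uniq cs) (csn : forall y, y \in cs -> near y).
Hypothesis nearU : forall y, near y -> U1 y || U2 y.
Hypothesis boundary : forall y z, near y -> z \in nb y -> ~~ near z ->
  (forall x, x \in cs -> g z x <= kap) /\
  (forall x, ~~ (U1 x || U2 x) -> g z x <= kap).
Hypotheses (kap0 : 0 < kap) (del01 : 0 < del <= 1) (u0 : 0 <= u).
Hypothesis kapcap : kap * capac cs <= del / 576.
Hypothesis U_dis : forall y, ~~ (U1 y && U2 y).
Hypothesis U12 : forall y z, U1 y -> z \in nb y -> ~~ U2 z.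
Hypothesis U21 : forall y z, U2 y -> z \in nb y -> ~~ U1 z.
Local Notation X := (seq_sub cs).
Local Notation U := (fun y => U1 y || U2 y).

Let e y : R := rho y * tauoo nb p (mem cs) y.
Let a := 2 * kap.

Let e0 y : 0 <= e y.
Proof. by rewrite mulr_ge0 ?(ltW (rho_gt0 _)) // tauoo_ge0. Qed.

Let csU y : y \in cs -> U y.
Proof. by move=> /csn/nearU. Qed.

(** Points just outside [near] hit [cs] with probability at most [kap * capac cs], by [hit_le]. This
    is below 1/2, which is the escape bound that [entrance_le] asks for. *)
Let entr x y N : ~~ U x -> y \in cs ->
  \sum_(n < N) walkB nb p (mem cs) n x y <= a * e y.
Proof.
move=> xU yc; have kap0' := ltW kap0.
apply: (entrance_le nb_uniq nb_sym p_ge0 p_sum rho_gt0 p_rev green_cvg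
  N cs_uniq csn kap0') => //.
  move=> y' z ny' zy' nz; have [h1 h2] := boundary ny' zy' nz; split; last exact: h2.
  have := hit_le p_ge0 p_sum rho_gt0 green_cvg cs_uniq h1.
  by case/andP: del01 => _; move: kapcap; lra.
by apply: contra xU => /nearU.
Qed.

Let esc_half k y : ~~ U y -> 1 / 2 <= esc nb p (mem cs) k y.
Proof.
move=> yU; have := esc_hitB p_sum k y cs_uniq.
rewrite exchange_big /=.
have : \sum_(x <- cs) \sum_(m < k.+1) walkB nb p (mem cs) m y x <= a * capac cs.
  rewrite /capac mulr_sumr !big_seq; apply: ler_sum => x xc.
  by apply: entr.
by case/andP: del01 => _; move: kapcap; rewrite /a; lra.
Qed.

Let one_k n := kern e (one nb p (cs := cs) U n).
Let two_k n := @kern2 _ _ nb p cs U e n.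
Let exc_k n := kern e (exc nb p (cs := cs) U n).

Let exc0 n S : 0 <= exc_k n S.
Proof. exact: kern_exc_ge0. Qed.
Let two0 n S : 0 <= two_k n S.
Proof. exact: kern2_ge0. Qed.
Let one_half n S : exc_k n S / 2 <= one_k n S.
Proof. exact: kern_one_ge. Qed.
Let one0 n S : 0 <= one_k n S.
Proof. by apply: le_trans (one_half n S); rewrite divr_ge0. Qed.

(** 9216 is twice the 4608 of the sprinkling because [a = 2 * kap]; for the same reason 576 in
    [kapcap] is twice 288. *)
Let err := 4 * expR (- (del ^+ 2 * u / (9216 * kap))).

Let sprinkle n F : mono F -> (forall S, 0 <= F S <= 1) ->
  pois (fun S => u * (one_k n.+1 S + two_k n.+1 S)) F <=
  pois (fun S => (1 + del) * u * one_k n.+1 S) F + err.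
Proof.
move=> Fm F01.
have a0 : 0 < a by rewrite mulr_gt0.
have := @pois_sprinkle R X (exc_k n.+1) (one_k n.+1) (two_k n.+1) a u del n.+1
  a0 u0 del01 (exc0 _) (two0 _) (one_half _) _ _ F Fm F01.
rewrite /err /a (_ : 4608 * (2 * kap) = 9216 * kap); last by ring.
apply.
  move=> F' F'm F'0; apply: (op_kern2_le p_ge0 p_sum cs_uniq csU e0 _ entr) => //.
  exact: ltW.
rewrite mass_kern_exc // -[X in _ * X <= _]/(capac cs).
by move: kapcap; rewrite -mulrA; lra.
Qed.

(** As the horizon grows, the rates of hitting subsets of [cs] tend to [v] times their capacities by
    [sweeping], and avoidance probabilities identify the limit as the law of the interlacement on
    [cs]. *)
Let full_cvg v F : 0 <= v ->
  pois (fun S => v * (one_k n.+1 S + two_k n.+1 S)) F @[n --> \oo] -->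
  \sum_S trace_law mu (I v) S * F S.
Proof.
move=> v0; apply: weight_cvg => K.
have ku : uniq [seq ssval i | i <- enum K].
  by rewrite map_inj_uniq ?enum_uniq //; exact: val_inj.
have -> : \sum_S trace_law mu (I v) S * avoid R K S =
    expR (- (v * capac [seq ssval i | i <- enum K])).
  by apply: EFin_inj; rewrite trace_law_avoid ?Ilaw // => x; exact: Im.
under eq_cvg do rewrite -/(pois _ _) pois_avoid.
apply: (@cvg_comp _ _ _ (fun n => - hit (fun S => v * (one_k n.+1 S + two_k n.+1 S)) K)
  expR); last exact: continuous_expR.
apply: cvgN.
have hE n : hit (fun S => v * (one_k n.+1 S + two_k n.+1 S)) K = v *
    \sum_(y <- cs) e y * (1 - esc nb p (mem [seq ssval i | i <- enum K]) n.+1 y).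
  rewrite -(hit_kern p_sum U e n.+1) /hit mulr_sumr; apply: eq_bigr => S _.
  by rewrite mulrA.
under eq_cvg do rewrite hE.
apply: cvgM; first exact: cvg_cst.
have ks : {subset [seq ssval i | i <- enum K] <= cs}.
  by move=> x /mapP[i _ ->]; exact: valP.
have := sweeping nb_uniq nb_sym p_ge0 p_sum p_rev green_cvg cs_uniq ku ks.
by rewrite -(cvg_shiftS _).
Qed.

Variables A1 A2 : set (E -> bool).
Hypothesis loc1 : local (fun x => (x \in cs) && U1 x) A1.
Hypothesis loc2 : local (fun x => (x \in cs) && U2 x) A2.

Let lc1 : local (mem cs) A1.
Proof. by move=> w w' h; apply: loc1 => x /andP[xc _]; exact: h. Qed.
Let lc2 : local (mem cs) A2.
Proof. by move=> w w' h; apply: loc2 => x /andP[xc _]; exact: h. Qed.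
Let lc12 : local (mem cs) (A1 `&` A2).
Proof. by move=> w w' h [a1 a2]; split; [exact: lc1 a1|exact: lc2 a2]. Qed.

Let F1 := indic R (cs := cs) A1.
Let F2 := indic R (cs := cs) A2.

Let probE v A : 0 <= v -> local (mem cs) A ->
  prob A v = \sum_S trace_law mu (I v) S * indic R (cs := cs) A S.
Proof.
by move=> v0 hA; rewrite /prob /event_at (event_trace mu _ hA).1 // => x; exact: Im.
Qed.

Let indicI S : indic R (cs := cs) (A1 `&` A2) S = F1 S * F2 S.
Proof. by rewrite /F1 /F2 /indic -natrM mulnb asbool_and. Qed.

Let F01 A S : 0 <= indic R (cs := cs) A S <= 1.
Proof. by rewrite /indic ler0n lern1; case: asbool. Qed.

Let indic_loc (V : pred E) A S : local (fun x => (x \in cs) && V x) A ->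
  indic R A S = indic R A (S :&: [set i : X | V (ssval i)]%SET).
Proof.
move=> hA; congr (nat_of_bool _)%:R; apply: asbool_equiv_eq.
have h x : (x \in cs) && V x ->
    config S x = config (S :&: [set i : X | V (ssval i)]%SET) x.
  move=> /andP[xc Vx]; apply/mapP/mapP => -[i iS xi]; exists i => //;
    move: iS; rewrite !mem_enum !inE; last by case/andP.
  by rewrite -xi Vx andbT.
by split; apply: hA => x /h.
Qed.

Let single v n : pois (fun S => v * one_k n S) (fun S => F1 S * F2 S) =
  pois (fun S => v * one_k n S) F1 * pois (fun S => v * one_k n S) F2.
Proof.
apply: (@pois_indep _ _ _ [set i : X | U1 (ssval i)]%SET [set i : X | U2 (ssval i)]%SET).
- apply/finset.setP => i; rewrite !inE; exact/negbTE.
- move=> S; rewrite mulf_eq0 negb_or => /andP[_ h].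
  exact: (kern_one_support csU _ U_dis U12 U21 h).
- by move=> S; exact: indic_loc.
- by move=> S; exact: indic_loc.
Qed.

Let u'0 : 0 <= (1 + del) * u.
Proof. by rewrite mulr_ge0 // addr_ge0 // ltW //; case/andP: del01. Qed.

Let pois01 (m F : {set X} -> R) : (forall S, 0 <= m S) -> (forall S, 0 <= F S <= 1) ->
  0 <= pois m F <= 1.
Proof.
move=> m0 h; apply/andP; split.
  by apply: pois_ge0 => // S; case/andP: (h S).
rewrite -[leRHS](pois_cst m); apply: pois_le => // S.
by case/andP: (h S).
Qed.

Let sng0 v n S : 0 <= v -> 0 <= v * one_k n S.
Proof. by move=> ?; rewrite mulr_ge0. Qed.
Let al v F n := pois (fun S => v * (one_k n.+1 S + two_k n.+1 S)) F.
Let W v (F : {set X} -> R) : R := \sum_S trace_law mu (I v) S * F S.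
Let u' := (1 + del) * u.

(** At each horizon, raising the level absorbs the returning walks, the single walks factor over the
    two pieces, and putting the returning walks back at the higher level only increases each
    factor. *)
Lemma decouple_increasing : increasing_event A1 -> increasing_event A2 ->
  prob (A1 `&` A2) u <= prob A1 ((1 + del) * u) * prob A2 ((1 + del) * u) + err.
Proof.
move=> i1 i2; rewrite !probE //.
have indm A : increasing_event A -> mono (indic R (cs := cs) A).
  move=> iA S S' SS'; rewrite /indic ler_nat.
  case: asboolP => // hA; rewrite lt0b; apply/asboolP.
  apply: iA hA => x /mapP[i]; rewrite mem_enum => iS ->.
  by apply/mapP; exists i; rewrite ?mem_enum // (fintype.subsetP SS').
rewrite (eq_bigr (fun S => trace_law mu (I u) S * (F1 S * F2 S))); last first.
  by move=> S _; rewrite indicI.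
have cv : (al u' F1 n * al u' F2 n + err) @[n --> \oo] -->
    W u' F1 * W u' F2 + err.
  by apply: cvgD; [apply: cvgM; exact: full_cvg|exact: cvg_cst].
refine (cvg_seq_le (@full_cvg _ (fun S => F1 S * F2 S) u0) cv _) => n.
rewrite [leRHS]/=.
apply: le_trans (sprinkle n _ _) _.
- move=> S S' SS'; have /andP[a1 _] := F01 A1 S; have /andP[a2 _] := F01 A2 S.
  by apply: ler_pM => //; apply: indm.
- move=> S; have /andP[a1 b1] := F01 A1 S; have /andP[a2 b2] := F01 A2 S.
  by rewrite mulr_ge0 //= mulr_ile1.
rewrite lerD2r single.
have st F : mono F -> pois (fun S => (1 + del) * u * one_k n.+1 S) F
   <= pois (fun S => (1 + del) * u * (one_k n.+1 S + two_k n.+1 S)) F.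
  by move=> Fm; apply: pois_mono => // [S|S _]; [exact: sng0|
    rewrite ler_wpM2l // lerDl].
apply: ler_pM; [| |exact: st (indm _ i1)|exact: st (indm _ i2)].
- by case/andP: (pois01 (fun S => sng0 n.+1 S u'0) (F01 A1)).
- by case/andP: (pois01 (fun S => sng0 n.+1 S u'0) (F01 A2)).
Qed.

(** At the higher level the returning walks are dropped and the single walks factor; the sprinkling
    is then applied to [1 - indic] for each event separately. The error therefore sits inside both
    factors. *)
Lemma decouple_decreasing : decreasing_event A1 -> decreasing_event A2 ->
  prob (A1 `&` A2) ((1 + del) * u) <= (prob A1 u + err) * (prob A2 u + err).
Proof.
move=> i1 i2; rewrite !probE //.
have indm A : decreasing_event A -> mono (fun S => 1 - indic R (cs := cs) A S).
  move=> iA S S' SS'; rewrite lerD2l lerN2 /indic ler_nat.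
  case: asboolP => // hA; rewrite lt0b; apply/asboolP.
  apply: iA hA => x /mapP[i]; rewrite mem_enum => iS ->.
  by apply/mapP; exists i; rewrite ?mem_enum // (fintype.subsetP SS').
rewrite (eq_bigr (fun S => trace_law mu (I ((1 + del) * u)) S * (F1 S * F2 S))); last first.
  by move=> S _; rewrite indicI.
have cv : ((al u F1 n + err) * (al u F2 n + err)) @[n --> \oo] -->
    (W u F1 + err) * (W u F2 + err).
  by apply: cvgM; apply: cvgD; try exact: cvg_cst; exact: full_cvg.
refine (cvg_seq_le (@full_cvg _ (fun S => F1 S * F2 S) u'0) cv _) => n.
rewrite [leRHS]/=.
pose m1 := fun S => (1 + del) * u * one_k n.+1 S.
have m10 S : 0 <= m1 S by exact: sng0.
have up A : decreasing_event A -> pois m1 (indic R A)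
    <= pois (fun S => u * (one_k n.+1 S + two_k n.+1 S)) (indic R A) + err.
  move=> iA; have := sprinkle n (indm _ iA) _.
  rewrite !poisB !pois_cst -/m1 => h.
  have : forall S : {set X}, 0 <= 1 - indic R A S <= 1.
    by move=> S; have := F01 A S; lra.
  by move=> /h; lra.
apply: (@le_trans _ _ (pois m1 (fun S => F1 S * F2 S))).
  rewrite -[X in X <= _](subKr 1) -[X in _ <= X](subKr 1) lerD2l lerN2.
  rewrite -[X in X - _ <= _](pois_cst m1).
  rewrite -[X in _ <= X - _](pois_cst (fun S => (1 + del) * u * (one_k n.+1 S + two_k n.+1 S))).
  rewrite -!poisB; apply: pois_mono => // [S _|].
    by rewrite ler_wpM2l // lerDl.
  move=> S S' SS'; rewrite lerD2l lerN2.
  have /andP[a1 _] := F01 A1 S'; have /andP[a2 _] := F01 A2 S'.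
  have := indm _ i1 _ _ SS'; have := indm _ i2 _ _ SS'.
  by rewrite !lerD2l !lerN2 => ? ?; apply: ler_pM.
rewrite single; apply: ler_pM; [| |exact: up|exact: up].
- by case/andP: (pois01 m10 (F01 A1)).
- by case/andP: (pois01 m10 (F01 A2)).
Qed.

End Decoupling.

(** * The walk on the graph *)

Section GraphE.
Variables (R : realType) (V : pointedType) (G : weighted_graph R V).
Local Notation E := (V * int)%type.
Implicit Types (x y : E).

Lemma adjE_sym x y : adjE G x y = adjE G y x.
Proof. by rewrite /adjE adj_sym [x.1 == _]eq_sym [x.2 == _]eq_sym distrC. Qed.

Lemma finite_adjE x : finite_set [set y | adjE G x y].
Proof.
have [D hD] := graph_bounded_degree G.
have f1 : finite_set [set y' | adj G x.1 y'].
  exact: card_le_finite (hD x.1) (finite_II D).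
apply: (@sub_finite_set _ _ (([set y' | adj G x.1 y'] `*` [set x.2]) `|`
  ([set x.1] `*` [set x.2 - 1; x.2 + 1]))).
  move=> [y z]; rewrite /adjE /= => /orP[/andP[h /eqP ->]|/andP[/eqP <- h]]; [left|right] => //=.
  split => //; move: h; rewrite eqr_norml => /andP[/orP[] /eqP h _]; [left|right]; lra.
by rewrite finite_setU; split; apply: finite_setX.
Qed.

Definition nbE x : seq E := finmap.enum_fset (fset_set [set y | adjE G x y]).

Lemma nbE_uniq x : uniq (nbE x).
Proof. exact: finmap.fset_uniq. Qed.

Lemma mem_nbE x y : (y \in nbE x) = adjE G x y.
Proof.
rewrite in_fset_set; last exact: finite_adjE.
by apply/idP/idP => [/set_mem|/mem_set].
Qed.

Lemma nbE_sym x y : (y \in nbE x) = (x \in nbE y).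
Proof. by rewrite !mem_nbE adjE_sym. Qed.

Lemma weightE_ge0 x y : 0 <= weightE G x y.
Proof. by rewrite /weightE; case: ifP => _; [exact: weight_ge0|case: ifP]. Qed.

Lemma weightE_sym x y : weightE G x y = weightE G y x.
Proof.
by rewrite /weightE adj_sym [x.1 == _]eq_sym [x.2 == _]eq_sym distrC weight_sym.
Qed.

Lemma rhoE_sum x : rhoE G x = \sum_(y <- nbE x) weightE G x y.
Proof. by rewrite /rhoE /vertex_weight fsbig_finite //; exact: finite_adjE. Qed.

Lemma rhoE_gt0 x : 0 < rhoE G x.
Proof.
rewrite rhoE_sum.
have h : (x.1, x.2 + 1) \in nbE x.
  by rewrite mem_nbE /adjE /= eqxx /= opprD addrA subrr add0r normrN1 eqxx orbT.
rewrite (big_rem _ h) /= ltr_pwDl //; last first.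
  by apply: sumr_ge0 => y _; exact: weightE_ge0.
rewrite /weightE /= adj_irr /= eqxx /= opprD addrA subrr add0r normrN1 eqxx.
exact: ltr01.
Qed.

Definition pE x y : R := weightE G x y / rhoE G x.

Lemma pE_ge0 x y : 0 <= pE x y.
Proof. by rewrite divr_ge0 ?weightE_ge0 // ltW // rhoE_gt0. Qed.

Lemma pE_sum x : \sum_(y <- nbE x) pE x y = 1.
Proof. by rewrite -mulr_suml -rhoE_sum divff // gt_eqF // rhoE_gt0. Qed.

Lemma pE_rev x y : rhoE G x * pE x y = rhoE G y * pE y x.
Proof.
by rewrite /pE [LHS]mulrC [RHS]mulrC !divfK ?gt_eqF ?rhoE_gt0 // weightE_sym.
Qed.

Variable P : E -> probability (paths E) R.
Hypothesis hP : walk_law G P.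
Local Notation step := (step nbE pE).

Lemma measurable_coord (i : nat) (Y : set E) :
  measurable [set w : paths E | Y (w i)].
Proof.
apply: sub_sigma_algebra; exists i => //; exists Y => //.
by rewrite setTI.
Qed.

Lemma measurable_forall (Q : set nat) (Y : nat -> set E) :
  measurable [set w : paths E | forall i, Q i -> Y i (w i)].
Proof.
rewrite (_ : mkset _ = \bigcap_(i in Q) [set w : paths E | Y i (w i)]) //.
by apply: bigcap_measurableType => i _; exact: measurable_coord.
Qed.

Lemma measure_coord_seq x (A : set (paths E)) (i : nat) (s : seq E) :
  measurable A -> uniq s ->
  P x (A `&` [set w | w i \in s]) =
  (\sum_(y <- s) P x (A `&` [set w | w i = y]))%E.
Proof.
move=> mA; elim: s => [|y s IH].
  by rewrite big_nil (_ : _ `&` _ = set0) ?measure0 //; apply/seteqP; split => w // [].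
move=> /= /andP[ys us]; rewrite big_cons -IH // -measureU.
- congr (P x _); rewrite -setIUr; congr (_ `&` _); apply/seteqP; split => w /=.
    by rewrite inE => /orP[/eqP|]; [left|right].
  by case=> h; rewrite inE ?h ?eqxx ?orbT.
- exact: measurableI (measurable_coord i [set y]).
- exact: measurableI (measurable_coord i [set z | z \in s]).
- apply/seteqP; split => w // [[_ /= wy] [_ /= ws]].
  by rewrite wy (negbTE ys) in ws.
Qed.

Definition cyl (s : nat -> E) (k : nat) : set (paths E) :=
  [set w | forall i, (i <= k)%N -> w i = s i].

Lemma measurable_cyl s k : measurable (cyl s k).
Proof. exact: (measurable_forall [set i | (i <= k)%N] (fun i => [set s i])). Qed.

Definition cyl_weight x (s : nat -> E) k : R :=
  (s 0%N == x)%:R * \prod_(i < k) pE (s i) (s i.+1).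

Lemma P_cyl x s k : P x (cyl s k) = (cyl_weight x s k)%:E.
Proof. exact: hP. Qed.

Definition extend_at (s : nat -> E) k y : nat -> E :=
  fun i => if (i <= k)%N then s i else y.

Lemma cyl_extend s k y : cyl s k `&` [set w | w k.+1 = y] = cyl (extend_at s k y) k.+1.
Proof.
apply/seteqP; split => w /=.
  move=> [h1 h2] i ik; rewrite /extend_at; case: leqP => h; first exact: h1.
  by rewrite (_ : i = k.+1) //; apply/eqP; rewrite eqn_leq ik.
move=> h; split; last by rewrite h // /extend_at ltnn.
by move=> i ik; rewrite h ?(leqW ik) // /extend_at ik.
Qed.

Lemma cyl_weight_extend x s k y : cyl_weight x (extend_at s k y) k.+1 = cyl_weight x s k * pE (s k) y.
Proof.
rewrite /cyl_weight big_ord_recr /= mulrA; congr (_ * _ * _).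
  by apply: eq_bigr => i _; rewrite /extend_at ltn_ord (ltnW (ltn_ord i)).
by rewrite /extend_at leqnn ltnn.
Qed.

(** [pE] sums to 1 over the neighbours, so the one-step extensions to neighbours exhaust the mass of
    the cylinder and any other continuation is null. *)
Lemma P_cyl_nb x s k (A : set (paths E)) : measurable A -> A `<=` cyl s k ->
  P x A = (\sum_(y <- nbE (s k)) P x (A `&` [set w | w k.+1 = y]))%E.
Proof.
move=> mA Ac; rewrite -measure_coord_seq ?nbE_uniq //.
set N := [set w : paths E | w k.+1 \in nbE (s k)].
have mN : measurable N by exact: (measurable_coord k.+1 [set z | z \in nbE (s k)]).
have c1 : P x (cyl s k) = (P x (cyl s k `&` N) + P x (cyl s k `&` ~` N))%E.
  rewrite -measureU ?setICr -?setIUr ?setUv ?setIT //.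
  - by apply: measurableI => //; exact: measurable_cyl.
  - by apply: measurableI; [exact: measurable_cyl|exact: measurableC].
  - by rewrite setIACA setICr setI0.
have c2 : P x (cyl s k `&` N) = (cyl_weight x s k)%:E.
  rewrite measure_coord_seq ?nbE_uniq //; last exact: measurable_cyl.
  under eq_bigr do rewrite cyl_extend P_cyl cyl_weight_extend.
  by rewrite sumEFin -mulr_sumr pE_sum mulr1.
have c0 : P x (cyl s k `&` ~` N) = 0%E.
  move: c1; rewrite c2 P_cyl.
  have : (P x (cyl s k `&` ~` N) \is a fin_num).
    apply: fin_num_measure.
    by apply: measurableI; [exact: measurable_cyl|exact: measurableC].
  move=> /fineK <-; rewrite -EFinD => -[]; move: (fine _) => r e.
  by congr (_%:E); lra.
have cA : P x (A `&` ~` N) = 0%E.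
  apply/eqP; rewrite eq_le measure_ge0 andbT -c0; apply: le_measure.
  - by rewrite inE; apply: measurableI => //; exact: measurableC.
  - by rewrite inE; apply: measurableI; [exact: measurable_cyl|exact: measurableC].
  - by apply: setSI.
have c3 : P x A = (P x (A `&` N) + P x (A `&` ~` N))%E.
  rewrite -measureU ?setICr -?setIUr ?setUv ?setIT //.
  - exact: measurableI.
  - by apply: measurableI => //; exact: measurableC.
  - by rewrite setIACA setICr setI0.
by rewrite c3 cA adde0.
Qed.

(** Time-dependent constraints treat two events at once: [H] constantly the complement of [ks] gives
    [tau], and [H] restrictive at the final time only gives the transition probabilities. *)
Fixpoint stay_prob (H : nat -> pred E) m k y : R :=
  if m is m'.+1 then step (fun z => if H k.+1 z then stay_prob H m' k.+1 z else 0) y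
  else 1.

Lemma P_cyl_stay x (H : nat -> pred E) m k s :
  P x [set w | (forall i, (i <= k)%N -> w i = s i) /\
        (forall i, (k < i <= k + m)%N -> H i (w i))] =
  (cyl_weight x s k * stay_prob H m k (s k))%:E.
Proof.
elim: m k s => [|m IH] k s.
  rewrite mulr1 -P_cyl; congr (P x _); apply/seteqP; split => w /=; first by case.
  by move=> h; split => // i; rewrite addn0 => /andP[h1 h2]; rewrite leqNgt h1 in h2.
rewrite (@P_cyl_nb x s k); last 2 first.
- apply: measurableI (measurable_cyl s k) _.
  exact: (measurable_forall [set i | (k < i <= k + m.+1)%N] (fun i => [set z | H i z])).
- by move=> w [].
rewrite /= /step mulr_sumr -sumEFin; apply: eq_bigr => y _.
case: ifPn => Hy; last first.
  rewrite !mulr0 (_ : _ `&` _ = set0) ?measure0 //.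
  apply/seteqP; split => w // [[_ /= h] wy].
  by have := h k.+1; rewrite ltnSn addnS ltnS leq_addr wy (negbTE Hy) => /(_ isT).
rewrite mulrA -cyl_weight_extend [X in stay_prob _ _ _ X](_ : y = extend_at s k y k.+1); last first.
  by rewrite /extend_at ltnn.
rewrite -IH; congr (P x _); apply/seteqP; split => w /=.
  move=> [[h1 h2] h3]; split.
    by have : cyl (extend_at s k y) k.+1 w by rewrite -cyl_extend; split.
  by move=> i /andP[ki im]; apply: h2; rewrite (ltn_trans _ ki) //= addnS -addSn.
move=> [h1 h2]; have : cyl (extend_at s k y) k.+1 w by [].
rewrite -cyl_extend => -[h3 /= h4]; split => //; split => // i /andP[ki im].
have [e|ne] := eqVneq i k.+1; first by rewrite e h4.
by apply: h2; rewrite ltn_neqAle eq_sym ne ki addSn -addnS.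
Qed.

Lemma P_start x (A : set (paths E)) : measurable A ->
  P x A = P x (cyl (fun=> x) 0 `&` A).
Proof.
move=> mA; have mc := measurable_cyl (fun=> x) 0.
have c1 : P x (~` cyl (fun=> x) 0) = 0%E.
  by rewrite probability_setC // P_cyl /cyl_weight big_ord0 eqxx mulr1 subee.
have : P x (~` cyl (fun=> x) 0 `&` A) = 0%E.
  apply/eqP; rewrite eq_le measure_ge0 andbT -c1; apply: le_measure.
  - by rewrite inE; apply: measurableI => //; exact: measurableC.
  - by rewrite inE; exact: measurableC.
  - exact: subIsetl.
move=> c2.
have c3 : P x A = (P x (cyl (fun=> x) 0 `&` A) + P x (~` cyl (fun=> x) 0 `&` A))%E.
  rewrite -measureU -?setIUl ?setUv ?setTI //.
  - exact: measurableI.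
  - by apply: measurableI => //; exact: measurableC.
  - by rewrite setIACA setICr set0I.
by rewrite c3 c2 adde0.
Qed.

Lemma P_stay x (H : nat -> pred E) n :
  P x [set w | forall i, (0 < i <= n)%N -> H i (w i)] = (stay_prob H n 0 x)%:E.
Proof.
rewrite P_start; last first.
  exact: (measurable_forall [set i | (0 < i <= n)%N] (fun i => [set z | H i z])).
have := P_cyl_stay x H n 0 (fun=> x).
by rewrite /cyl_weight big_ord0 eqxx mulr1 mul1r => <-.
Qed.

Lemma P_walk x y n : P x [set w | w n = y] = (walkA nbE pE pred0 n x y)%:E.
Proof.
case: n => [|n].
  rewrite P_start; last exact: (measurable_coord 0 [set y]).
  have [<-|xy] := eqVneq x y.
    have -> : cyl (fun=> x) 0 `&` [set w | w 0%N = x] = cyl (fun=> x) 0.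
      by apply/seteqP; split => w; [case|move=> h; split => //; exact: h].
    by rewrite P_cyl /cyl_weight big_ord0 mulr1 /= eqxx.
  rewrite (_ : _ `&` _ = set0) ?measure0 /= ?(negbTE xy) //.
  apply/seteqP; split => w // [h /= wy]; move/eqP: xy; apply.
  by rewrite -wy h.
pose H i : pred E := if i == n.+1 then pred1 y else predT.
have hv m k z : (k + m = n.+1)%N -> (if H k z then stay_prob H m k z else 0) =
    walkA nbE pE pred0 m z y.
  elim: m k z => [|m IH] k z.
    by rewrite addn0 => ->; rewrite /H eqxx /=; case: eqP.
  move=> km; rewrite /H (_ : (k == n.+1) = false) /=; last first.
    by apply/negbTE; rewrite neq_ltn -km addnS ltnS leq_addr.
  by apply: eq_step => t _; rewrite IH // addSn -addnS.
rewrite -(hv n.+1 0%N) //= -[X in _ = X%:E]/(stay_prob H n.+1 0 x) -P_stay.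
congr (P x _); apply/seteqP; split => w /=.
  by move=> wy i _; rewrite /H; case: eqP => [->|] //=; rewrite wy.
by move=> /(_ n.+1); rewrite /H eqxx ltnS leqnn => /(_ isT)/eqP.
Qed.

Lemma P_avoid x (ks : seq E) n :
  P x [set w | forall i, (0 < i <= n)%N -> w i \notin ks] =
  (tau nbE pE (mem ks) n x)%:E.
Proof.
rewrite (P_stay x (fun=> [pred z | z \notin ks])); congr (_%:E).
elim: n 0%N x => [|n IH] k x //=; apply: eq_step => y _.
by rewrite IH if_neg.
Qed.

Lemma P_escape x (ks : seq E) :
  P x [set w | forall n, (1 <= n)%N -> ~ [set` ks] (w n)] =
  (tauoo nbE pE (mem ks) x)%:E.
Proof.
pose F n := [set w : paths E | forall i, (0 < i <= n)%N -> w i \notin ks].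
have mF n : measurable (F n).
  exact: (measurable_forall [set i | (0 < i <= n)%N] (fun=> [set z | z \notin ks])).
have e : [set w : paths E | forall n, (1 <= n)%N -> ~ [set` ks] (w n)] = \bigcap_n F n.
  apply/seteqP; split => w /=.
    by move=> h n _ i /andP[i0 _]; apply/negP; exact: h.
  by move=> h n n1; apply/negP; apply: (h n Logic.I); rewrite n1 leqnn.
have h1 : (P x \o F) n @[n --> \oo] --> P x (\bigcap_n F n).
  apply: nonincreasing_cvg_mu => //.
  - by rewrite (le_lt_trans (probability_le1 _ _)) // ltry.
  - exact: bigcapT_measurable.
  - move=> m n mn; apply/subsetPset => w /= h i /andP[i0 im]; apply: h.
    by rewrite i0 (leq_trans im).
have h2 : (P x \o F) n @[n --> \oo] --> (tauoo nbE pE (mem ks) x)%:E.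
  rewrite (_ : P x \o F = fun n => (tau nbE pE (mem ks) n x)%:E); last first.
    by apply/funext => n /=; exact: P_avoid.
  by apply: cvg_EFin; [exact: nearW|exact: (tau_cvg pE_ge0 pE_sum)].
rewrite e; exact: (cvg_unique _ h1 h2).
Qed.

Lemma cap_capac (ks : seq E) : uniq ks ->
  cap G P [set` ks] = capac nbE pE (rhoE G) ks.
Proof.
move=> uk; rewrite /cap -fsbig_seq //; apply: eq_bigr => x _.
by rewrite P_escape /= mulrC.
Qed.

Lemma green_walk_cvg beta nu : green_bounds G P beta nu -> forall x y,
  (\sum_(n < N) walkA nbE pE pred0 n x y) @[N --> \oo] -->
    fine (green G P x y) * rhoE G y.
Proof.
move=> [c [c' [c0 hg]]] x y.
have /andP[l1 l2] := hg x y.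
have fg : green G P x y \is a fin_num.
  rewrite fin_numElt (lt_le_trans (ltNyr _) l1) /=.
  exact: le_lt_trans l2 (ltry _).
have h1 : (\sum_(0 <= n < N) P x [set w | w n = y] * (rhoE G y)^-1%:E)%E
    @[N --> \oo] --> (fine (green G P x y))%:E.
  rewrite fineK //; apply: is_cvg_nneseries => n _ _.
  by rewrite mule_ge0 // lee_fin invr_ge0 ltW // rhoE_gt0.
have h2 : (\sum_(0 <= n < N) walkA nbE pE pred0 n x y / rhoE G y) @[N --> \oo] -->
    fine (green G P x y).
  have := fine_cvg h1; rewrite (_ : _ \o _ =
    fun N => \sum_(0 <= n < N) walkA nbE pE pred0 n x y / rhoE G y); last first.
    apply/funext => N /=.
    by under eq_bigr do rewrite P_walk -EFinM; rewrite sumEFin.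
  exact.
have rg := rhoE_gt0 y.
have -> : (fun N => \sum_(n < N) walkA nbE pE pred0 n x y) =
    (fun N => (\sum_(0 <= n < N) walkA nbE pE pred0 n x y / rhoE G y) * rhoE G y).
  apply/funext => N; rewrite -mulr_suml divfK ?gt_eqF //.
  by rewrite big_mkord.
by apply: cvgM => //; exact: cvg_cst.
Qed.

End GraphE.

(** As [s <= 1], each of the ratios a/(a+b) and b/(a+b) is at most its power [s], and they add up to
    1. With [s = 2 / beta] this is the triangle inequality for the vertical part of the distance. *)
Lemma powR_le_add (R : realType) (s a b : R) : 0 < s <= 1 -> 0 <= a -> 0 <= b ->
  (a + b) `^ s <= a `^ s + b `^ s.
Proof.
move=> /andP[s0 s1] a0 b0.
have [->|ab0] := eqVneq (a + b) 0.
  by rewrite powR0 ?gt_eqF // addr_ge0 ?powR_ge0.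
have abp : 0 < a + b by rewrite lt_neqAle eq_sym ab0 addr_ge0.
have h t : 0 <= t -> t <= a + b -> t / (a + b) * (a + b) `^ s <= t `^ s.
  move=> t0 tab; have [->|tn0] := eqVneq t 0.
    by rewrite !mul0r powR_ge0.
  rewrite -[in leRHS](divfK ab0 t) powRM ?divr_ge0 ?(ltW abp) //.
  apply: ler_wpM2r; first exact: powR_ge0.
  apply: ger1_powR => //; apply/andP; split.
    by apply: divr_gt0 => //; rewrite lt_neqAle eq_sym tn0.
  by rewrite ler_pdivrMr // mul1r.
apply: (@le_trans _ _ (a / (a + b) * (a + b) `^ s + b / (a + b) * (a + b) `^ s)).
  by rewrite -mulrDl -mulrDl divff // mul1r.
by apply: lerD; apply: h => //; rewrite ?lerDl ?lerDr.
Qed.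

(** * The metric on the product graph *)

Section Distance.
Variables (R : realType) (V : pointedType) (G : weighted_graph R V).
Local Notation E := (V * int)%type.

Local Notation lens y y' :=
  [set ((size p)%:R : R) | p in [set p | path (adj G) y p /\ last y p = y']].

Let lens_lb y y' : has_lbound (lens y y').
Proof. by exists 0 => _ [p _ <-]. Qed.

Let lens_n0 y y' : lens y y' !=set0.
Proof.
have [p hp hl] := graph_connected G y y'.
by exists (size p)%:R; exists p.
Qed.

Lemma gdist_le y p : path (adj G) y p -> gdist G y (last y p) <= (size p)%:R.
Proof. by move=> h; apply: ge_inf => //; exists p. Qed.

Lemma gdist_ge y y' (r : R) :
  (forall p, path (adj G) y p -> last y p = y' -> r <= (size p)%:R) ->
  r <= gdist G y y'.
Proof. by move=> h; apply: lb_le_inf => // _ [p [? ?] <-]; exact: h. Qed.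

Lemma gdist_ge0 y y' : 0 <= gdist G y y'.
Proof. exact: gdist_ge. Qed.

Lemma gdist0 y : gdist G y y = 0.
Proof.
by apply/eqP; rewrite eq_le gdist_ge0 andbT; exact: (@gdist_le y [::]).
Qed.

Lemma gdist_adj y y' : adj G y y' -> gdist G y y' <= 1.
Proof. by move=> h; apply: (@gdist_le y [:: y']); rewrite /= h. Qed.

Lemma gdist_sym_le y y' : gdist G y' y <= gdist G y y'.
Proof.
apply: gdist_ge => p hp <-.
have := @gdist_le (last y p) (rev (belast y p)).
rewrite rev_path size_rev size_belast; case: p hp => [|z p] hp.
  by move=> /(_ isT).
rewrite [belast _ _]/= rev_cons last_rcons; apply.
by move: hp; congr (is_true _); apply: eq_path => a b; exact: adj_sym.
Qed.

Lemma gdist_sym y y' : gdist G y y' = gdist G y' y.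
Proof. by apply/eqP; rewrite eq_le !gdist_sym_le. Qed.

Lemma gdist_triangle y y' z : gdist G y z <= gdist G y y' + gdist G y' z.
Proof.
rewrite -lerBlDl; apply: gdist_ge => q hq hz.
rewrite lerBlDl -lerBlDr; apply: gdist_ge => p hp hy.
rewrite lerBlDr -natrD -size_cat -hz -hy -last_cat; apply: gdist_le.
by rewrite cat_path hp hy hq.
Qed.

Lemma finite_gball y (r : R) : finite_set (gball G y r).
Proof.
have [D hD] := graph_bounded_degree G.
pose S n := [set y' | exists2 p, path (adj G) y p & last y p = y' /\ size p = n].
have fS n : finite_set (S n).
  elim: n => [|n IH].
    apply: (@sub_finite_set _ _ [set y]) => //.
    by move=> y' [p _ [<- /size0nil ->]].
  apply: (@sub_finite_set _ _ (\bigcup_(z in S n) [set y' | adj G z y'])).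
    move=> y' [p]; case/lastP: p => [|p z]; first by move=> _ [].
    rewrite rcons_path last_rcons size_rcons => /andP[hp hz] [<- [sn]].
    by exists (last y p) => //; exists p.
  apply: bigcup_finite => // z _.
  exact: card_le_finite (hD z) (finite_II D).
apply: (@sub_finite_set _ _ (\bigcup_(n in `I_(Num.trunc (r + 1)).+1) S n)).
  move=> y' /= yr.
  (* [gdist] is an infimum, so a path of length below [gdist + 1] is taken instead of a shortest
     one; hence the radius [r + 1]. *)
  have [||_ [p [hp hl] <-] hlt] := @inf_adherent R (lens y y') 1.
  - exact: ltr01.
  - by split.
  exists (size p); last by exists p.
  rewrite /= ltnS -ltnS.
  have : (size p)%:R < (Num.trunc (r + 1)).+1%:R :> R.
    apply: (@le_lt_trans _ _ (r + 1)).
      by apply/ltW/(lt_le_trans hlt); rewrite lerD2r.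
    have /andP[//] : (Num.trunc (r + 1))%:R <= r + 1 < (Num.trunc (r + 1)).+1%:R.
    apply: truncn_itv; rewrite addr_ge0 //.
    exact: le_trans (gdist_ge0 y y') yr.
  by rewrite ltr_nat.
by apply: bigcup_finite => //; exact: finite_II.
Qed.

Variables (beta : R).
Hypothesis hbeta : 2 <= beta.
Local Notation dist := (distE G beta).
Implicit Types x y z : E.

Let s01 : 0 < 2 / beta <= 1.
Proof.
have b0 : 0 < beta by apply: lt_le_trans hbeta; lra.
by rewrite divr_gt0 //= ler_pdivrMr // mul1r.
Qed.
Let s0 : 0 < 2 / beta. Proof. by case/andP: s01. Qed.

Lemma distE_sym x y : dist x y = dist y x.
Proof. by rewrite /distE gdist_sym distrC. Qed.

Lemma distE_triangle x y z : dist x z <= dist x y + dist y z.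
Proof.
rewrite ge_max; apply/andP; split.
  by apply: le_trans (gdist_triangle _ y.1 _) _; rewrite lerD // le_max lexx.
apply: (@le_trans _ _ ((`|x.2 - y.2| + `|y.2 - z.2|)%:~R `^ (2 / beta))).
  apply: ge0_ler_powR; rewrite ?nnegrE ?ler0z ?addr_ge0 ?(ltW s0) //.
  by rewrite ler_int ler_distD.
rewrite intrD; apply: le_trans (powR_le_add s01 _ _) _; rewrite ?ler0z //.
by apply: lerD; rewrite le_max lexx orbT.
Qed.

Lemma distE_adj x y : adjE G x y -> dist x y <= 1.
Proof.
rewrite /adjE ge_max => /orP[/andP[h /eqP e]|/andP[/eqP e /eqP h]].
  by rewrite gdist_adj // e subrr normr0 powR0 ?gt_eqF // ler01.
by rewrite e gdist0 ler01 h powR1 lexx.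
Qed.

Lemma finite_ballE x (r : R) : finite_set (Defs.ballE G beta x r).
Proof.
pose N := (Num.trunc (r `^ (2 / beta)^-1)).+1.
apply: (@sub_finite_set _ _ (gball G x.1 r `*`
   ([set x.2 + n%:Z | n in `I_N] `|` [set x.2 - n%:Z | n in `I_N]))).
  move=> [y z]; rewrite /Defs.ballE /= /distE ge_max /= => /andP[h1 h2]; split => //=.
  have hn : (`|x.2 - z|%N < N)%N.
    rewrite -(ltr_nat R).
    have r0 : 0 <= r by apply: le_trans h2; exact: powR_ge0.
    apply: (@le_lt_trans _ _ (r `^ (2 / beta)^-1)); last first.
      by have /andP[] := truncn_itv (powR_ge0 r (2 / beta)^-1).
    rewrite natr_absz.
    have -> : `|x.2 - z|%:~R = (`|x.2 - z|%:~R `^ (2 / beta)) `^ (2 / beta)^-1 :> R.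
      by rewrite -powRrM divff ?gt_eqF // powRr1 // ler0z.
    by apply: ge0_ler_powR; rewrite ?nnegrE ?powR_ge0 // invr_ge0 ltW.
  have [zx|zx] := leP z x.2; [right|left]; exists `|x.2 - z|%N => //.
    by rewrite gez0_abs ?subr_ge0 // opprB addrC subrK.
  by rewrite distnC gez0_abs ?subr_ge0 ?(ltW zx) // addrCA subrr addr0.
apply: finite_setX; first exact: finite_gball.
by rewrite finite_setU; split; apply: finite_image; exact: finite_II.
Qed.

End Distance.

(** * One decoupling step *)

Section Step.
Variables (R : realType) (V : pointedType) (G : weighted_graph R V).
Local Notation E := (V * int)%type.
Variables (beta nu : R).
Hypotheses (hbeta : 2 <= beta) (nu0 : 0 < nu).
Variable P : E -> probability (paths E) R.
Hypothesis hP : walk_law G P.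
Variables (cg cg' : R).
Hypothesis cg0 : 0 < cg.
Local Notation dist := (distE G beta).
Local Notation dnu x y := (Num.max (dist x y) 1 `^ (- nu)).
Hypothesis hgreen : forall x x',
  ((cg * dnu x x')%:E <= green G P x x' <= (cg' * dnu x x')%:E)%E.
Local Notation capac := (capac (@nbE R V G) (@pE R V G) (rhoE G)).

Let g x y : R := fine (green G P x y).

Let green_cvg x y : (\sum_(n < N) walkA (@nbE R V G) (@pE R V G) pred0 n x y)
  @[N --> \oo] --> g x y * rhoE G y.
Proof.
apply: (green_walk_cvg hP (beta := beta) (nu := nu)).
by exists cg, cg'.
Qed.

Let g_bounds x y : cg * dnu x y <= g x y <= cg' * dnu x y.
Proof.
have /andP[l1 l2] := hgreen x y.
have fg : green G P x y \is a fin_num.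
  rewrite fin_numElt (lt_le_trans (ltNyr _) l1) /=.
  exact: le_lt_trans l2 (ltry _).
by rewrite -!lee_fin fineK // l1 l2.
Qed.

Lemma green_cst_gt0 : 0 < cg'.
Proof.
have /andP[l1 l2] := g_bounds point point.
have d0 : 0 < dnu point point by rewrite powR_gt0 // lt_max ltr01 orbT.
have := le_trans l1 l2; rewrite ler_pM2r // => h.
exact: lt_le_trans h.
Qed.

Let dnu_le x y (r : R) : 0 < r -> r <= Num.max (dist x y) 1 -> dnu x y <= r `^ (- nu).
Proof.
move=> r0 h; rewrite !powRN lef_pV2 ?posrE ?powR_gt0 //; last first.
  by rewrite (lt_le_trans r0).
by apply: ge0_ler_powR; rewrite ?nnegrE ?(ltW nu0) ?(ltW r0) // (le_trans _ h) // ltW.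
Qed.

(** Subadditivity: enlarging a set lowers the escape probability at each of its points, so the
    equilibrium measure of [cs] is dominated pointwise by the sum of those of the pieces. *)
Lemma capac_sub (cs : seq E) (J : finType) (cj : J -> seq E) :
  uniq cs -> (forall j, uniq (cj j)) ->
  (forall j, {subset cj j <= cs}) -> (forall x, x \in cs -> exists j, x \in cj j) ->
  capac cs <= \sum_j capac (cj j).
Proof.
move=> uc uj sub cov.
have tau_anti (C C' : pred E) n x : (forall y, C' y -> C y) ->
    tau (@nbE R V G) (@pE R V G) C n x <= tau (@nbE R V G) (@pE R V G) C' n x.
  move=> CC'; elim: n x => [|n IH] x //=; apply: le_step => [|y _].
    exact: pE_ge0.
  case: ifP => Cy; case: ifP => C'y //; last by rewrite (CC' _ C'y) in Cy.
  by case/andP: (tau_ge0_le1 (@pE_ge0 R V G) (@pE_sum R V G) C' n y).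
have tauoo_anti (C C' : pred E) x : (forall y, C' y -> C y) ->
    tauoo (@nbE R V G) (@pE R V G) C x <= tauoo (@nbE R V G) (@pE R V G) C' x.
  move=> CC'; have cv := @tau_cvg _ _ _ _ (@pE_ge0 R V G) (@pE_sum R V G).
  by refine (cvg_seq_le (cv C x) (cv C' x) _) => n; exact: tau_anti.
have pos x j : 0 <= rhoE G x * tauoo (@nbE R V G) (@pE R V G) (mem (cj j)) x.
  by rewrite mulr_ge0 ?(ltW (rhoE_gt0 G x)) // tauoo_ge0 //; [exact: pE_ge0|exact: pE_sum].
apply: (@le_trans _ _ (\sum_(x <- cs) \sum_j (x \in cj j)%:R *
    (rhoE G x * tauoo (@nbE R V G) (@pE R V G) (mem (cj j)) x))).
  rewrite /capac !big_seq; apply: ler_sum => x /cov[j xj].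
  rewrite (bigD1 j) //= xj mul1r -[leLHS]addr0 lerD //.
    rewrite ler_wpM2l ?(ltW (rhoE_gt0 G x)) //; apply: tauoo_anti => y.
    exact: sub.
  by apply: sumr_ge0 => i _; rewrite mulr_ge0.
rewrite exchange_big /=; apply: ler_sum => j _.
rewrite /capac.
rewrite (eq_bigr (fun x => if x \in cj j then
   rhoE G x * tauoo (@nbE R V G) (@pE R V G) (mem (cj j)) x else 0)); last first.
  by move=> x _; case: (_ \in _); rewrite ?mul1r ?mul0r.
rewrite -big_mkcond /= -big_filter (perm_big (cj j)) //.
apply: uniq_perm; rewrite ?filter_uniq // => x.
by rewrite mem_filter; apply/andP/idP => [[]|h] //; split => //; exact: sub h.
Qed.

(** The Green density from the centre is at least [cg] times r^(-nu) on the ball, so [capac_le]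
    applies. *)
Lemma capac_ball (cs : seq E) x (r : R) : uniq cs -> 1 <= r ->
  (forall y, y \in cs -> dist x y <= r) -> capac cs <= r `^ nu / cg.
Proof.
move=> uc r1 h.
have r0 : 0 < r by apply: lt_le_trans r1.
have hk y : y \in cs -> cg * r `^ (- nu) <= g x y.
  move=> yc; have /andP[+ _] := g_bounds x y; apply: le_trans.
  rewrite ler_pM2l //= !powRN lef_pV2 ?posrE ?powR_gt0 ?lt_max ?ltr01 ?orbT //.
  apply: ge0_ler_powR; rewrite ?nnegrE ?(ltW nu0) ?(ltW r0) // ?le_max ?ler01 ?orbT //.
  by rewrite ge_max h.
have := capac_le (@pE_ge0 R V G) (@pE_sum R V G) (@rhoE_gt0 R V G)
  green_cvg uc hk.
rewrite powRN mulrAC ler_pdivrMr ?powR_gt0 // mul1r => h2.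
by rewrite ler_pdivlMr // mulrC.
Qed.

Variables (d : measure_display) (Omega : measurableType d).
Variables (mu : probability Omega R) (I : R -> Omega -> set E).
Hypothesis hI : random_interlacements G P mu I.

Let Im (u : R) x : 0 <= u -> measurable [set om | I u om x].
Proof. by case: hI => h _ _; exact: h. Qed.

Let Ilaw (u : R) ks : 0 <= u -> uniq ks ->
  mu [set om | forall x, x \in ks -> ~ I u om x] = (expR (- (u * capac ks)))%:E.
Proof.
case: hI => _ _ h u0 uk; rewrite -(cap_capac hP) // -h //; congr (mu _).
apply/seteqP; split => om /=.
  by move=> hx; apply/seteqP; split => x // [Ix xk]; exact: hx Ix.
move=> hx x xk Ix; suff : (I u om `&` [set` ks]) x by rewrite hx.
by split.
Qed.

Local Notation prob := (prob mu I).

Lemma prob_ge0 A u : 0 <= prob A u.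
Proof. by rewrite /prob fine_ge0. Qed.

Variables (cs : seq E) (x1 x2 : E) (r del u : R).
Hypothesis cs_uniq : uniq cs.
Hypothesis r_ge : 1 <= r.
Hypothesis x12 : 12 * r <= dist x1 x2.
Hypothesis cs12 : forall x, x \in cs ->
  dist x1 x <= r \/ dist x2 x <= r.
Hypotheses (del01 : 0 < del <= 1) (u0 : 0 <= u).
Let kap := cg' * r `^ (- nu).
Hypothesis kapcap : kap * capac cs <= del / 576.

(** The square root of the decoupling error, whence 18432 as twice 9216. In this form it can be put
    into both factors: (p1 + e)(p2 + e) is at least p1 p2 + e^2. *)
Definition step_err : R := 2 * expR (- (del ^+ 2 * u / (18432 * kap))).

Let kap0 : 0 < kap.
Proof. by rewrite mulr_gt0 ?green_cst_gt0 // powR_gt0 //; move: r_ge; lra. Qed.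

(** A step out of [near] ends more than 2r from both centres, hence more than r from [cs], and
    within 2r + 1 <= 3r of one centre, hence at least r from any point outside [U1] and [U2]. As 8r
    + 1 < 12r, the two sets are disjoint and not adjacent. *)
Let U1 y := dist x1 y <= 4 * r.
Let U2 y := dist x2 y <= 4 * r.
Let near y := (dist x1 y <= 2 * r) || (dist x2 y <= 2 * r).

Let g_far x y : r <= dist x y -> g x y <= kap.
Proof.
move=> h; have /andP[_] := g_bounds x y => /le_trans; apply.
rewrite ler_pM2l ?green_cst_gt0 //; apply: dnu_le; first by move: r_ge; lra.
by rewrite le_max h.
Qed.

Let csn y : y \in cs -> near y.
Proof.
by move=> /cs12 h; apply/orP; case: h => h; [left|right]; move: r_ge; lra.
Qed.

Let nearU y : near y -> U1 y || U2 y.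
Proof.
by move=> /orP h; apply/orP; rewrite /U1 /U2; case: h => h; [left|right]; move: r_ge; lra.
Qed.

Let boundary y z : near y -> z \in @nbE R V G y -> ~~ near z ->
  (forall x, x \in cs -> g z x <= kap) /\
  (forall x, ~~ (U1 x || U2 x) -> g z x <= kap).
Proof.
rewrite mem_nbE => ny /(distE_adj hbeta) yz.
rewrite negb_or -!ltNge => /andP[z1 z2]; split => x.
  move=> /cs12[] xc; apply: g_far.
    by have := distE_triangle G hbeta x1 x z; rewrite [dist x z]distE_sym; move: r_ge; lra.
  by have := distE_triangle G hbeta x2 x z; rewrite [dist x z]distE_sym; move: r_ge; lra.
rewrite negb_or /U1 /U2 -!ltNge => /andP[h1 h2]; apply: g_far.
case/orP: ny => ny.
  have := distE_triangle G hbeta x1 y z; have := distE_triangle G hbeta x1 z x.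
  by move: r_ge; lra.
have := distE_triangle G hbeta x2 y z; have := distE_triangle G hbeta x2 z x.
by move: r_ge; lra.
Qed.

Let U_dis y : ~~ (U1 y && U2 y).
Proof.
apply/negP => /andP[h1 h2]; have := distE_triangle G hbeta x1 y x2.
by rewrite [dist y x2]distE_sym; move: h1 h2 x12 r_ge; rewrite /U1 /U2; lra.
Qed.

Let U12 y z : U1 y -> z \in @nbE R V G y -> ~~ U2 z.
Proof.
rewrite mem_nbE => h1 /(distE_adj hbeta) yz; apply/negP => h2.
have := distE_triangle G hbeta x1 y x2; have := distE_triangle G hbeta y z x2.
by rewrite [dist z x2]distE_sym; move: h1 h2 x12 r_ge; rewrite /U1 /U2; lra.
Qed.

Let U21 y z : U2 y -> z \in @nbE R V G y -> ~~ U1 z.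
Proof.
move=> h2; rewrite nbE_sym => yz; apply/negP => h1.
by have := U12 h1 yz; rewrite h2.
Qed.

Variables A1 A2 : set (E -> bool).
Hypothesis loc1 : local (fun x => (x \in cs) && (dist x1 x <= r)) A1.
Hypothesis loc2 : local (fun x => (x \in cs) && (dist x2 x <= r)) A2.

Let l1 : local (fun x => (x \in cs) && U1 x) A1.
Proof.
move=> w w' h; apply: loc1 => x /andP[xc x1x]; apply: h; rewrite xc /=.
by move: x1x; rewrite /U1; move: r_ge; lra.
Qed.

Let l2 : local (fun x => (x \in cs) && U2 x) A2.
Proof.
move=> w w' h; apply: loc2 => x /andP[xc x1x]; apply: h; rewrite xc /=.
by move: x1x; rewrite /U2; move: r_ge; lra.
Qed.

Let errE : 4 * expR (- (del ^+ 2 * u / (9216 * kap))) = step_err * step_err.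
Proof.
rewrite /step_err mulrACA -expRD; congr (_ * expR _); first by lra.
by field; rewrite gt_eqF.
Qed.

Let se0 : 0 <= step_err.
Proof. by rewrite mulr_ge0 ?expR_ge0. Qed.

Lemma step_increasing : increasing_event A1 -> increasing_event A2 ->
  prob (A1 `&` A2) u <= (prob A1 ((1 + del) * u) + step_err)
                        * (prob A2 ((1 + del) * u) + step_err).
Proof.
move=> i1 i2.
have := decouple_increasing (@nbE_uniq R V G) (@nbE_sym R V G) (@pE_ge0 R V G)
  (@pE_sum R V G) (@rhoE_gt0 R V G) (@pE_rev R V G) green_cvg Im Ilaw cs_uniq
  csn nearU boundary kap0 del01 u0 kapcap U_dis U12 U21 l1 l2 i1 i2.
rewrite errE => /le_trans; apply.
have := prob_ge0 A1 ((1 + del) * u); have := prob_ge0 A2 ((1 + del) * u).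
move: (prob _ _) (prob _ _) se0 => a b; nra.
Qed.

Lemma step_decreasing : decreasing_event A1 -> decreasing_event A2 ->
  prob (A1 `&` A2) ((1 + del) * u) <=
    (prob A1 u + step_err) * (prob A2 u + step_err).
Proof.
move=> i1 i2.
have p1 := prob_ge0 A1 u; have p2 := prob_ge0 A2 u.
(* The decoupling error is the square of [step_err], and is at most [step_err] when the latter is at
   most 1. Otherwise the right side already exceeds 1. *)
have [e1|e1] := leP step_err 1; last first.
  apply: (@le_trans _ _ 1).
    have lc : local (mem cs) (A1 `&` A2).
      move=> w w' h [h1 h2]; split.
        by apply: l1 h1 => x /andP[xc _]; exact: h.
      by apply: l2 h2 => x /andP[xc _]; exact: h.
    have h x : measurable [set om | I ((1 + del) * u) om x].
      by apply: Im; rewrite mulr_ge0 // addr_ge0 //; case/andP: del01 => /ltW.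
    have m := (event_trace mu h lc).2.
    rewrite /prob -(@lee_fin R) fineK; first exact: probability_le1.
    exact: fin_num_measure.
  by move: (prob _ _) (prob _ _) p1 p2 => a b; nra.
have := decouple_decreasing (@nbE_uniq R V G) (@nbE_sym R V G) (@pE_ge0 R V G)
  (@pE_sum R V G) (@rhoE_gt0 R V G) (@pE_rev R V G) green_cvg Im Ilaw cs_uniq
  csn nearU boundary kap0 del01 u0 kapcap U_dis U12 U21 l1 l2 i1 i2.
rewrite errE => /le_trans; apply.
have h : step_err * step_err <= step_err by rewrite ler_piMl.
move: p1 p2 se0 h; move: step_err (prob _ _) (prob _ _) => e a b a0 b0 e0 h.
have ee0 : 0 <= e * e by apply: mulr_ge0.
by apply: ler_pM; rewrite ?lerD2l //; apply: addr_ge0.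
Qed.

End Step.

(** * Dyadic trees *)

Lemma prod_add_ge (R : realType) (I : finType) (a : I -> R) (b : R) :
  (0 < #|I|)%N -> (forall i, 0 <= a i) -> 0 <= b ->
  \prod_i a i + b ^+ #|I| <= \prod_i (a i + b).
Proof.
move=> cI a0 b0; rewrite cardE.
have e (F : I -> R) : \prod_i F i = \prod_(i <- enum I) F i by rewrite big_enum.
rewrite !e {e}.
move: cI; rewrite cardE; elim: (enum I) => //= i s IH _.
rewrite !big_cons exprS; case: s IH => [_|j s /(_ isT) IH].
  by rewrite !big_nil !mulr1.
apply: (@le_trans _ _ ((a i + b) * (\prod_(k <- j :: s) a k + b ^+ size (j :: s)))).
  have p0 : 0 <= \prod_(k <- j :: s) a k by apply: prodr_ge0.
  have q0 : 0 <= b ^+ size (j :: s) by apply: exprn_ge0.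
  rewrite mulrDl !mulrDr; have := mulr_ge0 (a0 i) q0; have := mulr_ge0 b0 p0.
  lra.
by apply: ler_wpM2l => //; apply: addr_ge0.
Qed.

Section Tree.
Variables (R : realType) (V : pointedType) (G : weighted_graph R V).
Local Notation E := (V * int)%type.
Variables (beta ell0 L0 : R).
Local Notation box := (box G beta ell0 L0).
Local Notation Lambda := (Lambda G beta ell0 L0).
Local Notation scale := (scale ell0 L0).

Definition subtree n (T : n.+1.-bseq bool -> E) (b : bool) : n.-bseq bool -> E :=
  fun m => T (cons_bseq b m).

Lemma box_subtree n (T : n.+1.-bseq bool -> E) b m :
  box (subtree T b) m = box T (cons_bseq b m).
Proof. by rewrite /box /= subSS. Qed.

Lemma box_val n (T : n.-bseq bool -> E) (m m' : n.-bseq bool) :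
  m = m' :> seq bool -> box T m = box T m'.
Proof. by move=> h; congr (box T _); apply: val_inj. Qed.

Lemma Lambda_subtree n (T : n.+1.-bseq bool -> E) b :
  Lambda T -> Lambda (subtree T b).
Proof.
move=> hT m m1 m2 e1 e2.
have := hT (cons_bseq b m) (cons_bseq b m1) (cons_bseq b m2)
  (congr1 (cons b) e1) (congr1 (cons b) e2).
by rewrite !box_subtree /= subSS.
Qed.

Lemma leaf_box n (T : n.-bseq bool -> E) (t : n.-tuple bool) :
  Lambda T -> box T t `<=` box T [bseq].
Proof.
elim: n T t => [|n IH] T t hT.
  by rewrite (@box_val _ _ t [bseq]) // tuple0.
case/tupleP: t => b t.
have -> : box T [tuple of b :: t] = box (subtree T b) t.
  by rewrite box_subtree; apply: box_val.
apply: subset_trans (IH _ t (Lambda_subtree b hT)) _.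
rewrite box_subtree.
have [h _] := hT [bseq] [bseq of [:: false]] [bseq of [:: true]] erefl erefl.
case: b => x hx; apply: h; [right|left]; move: hx.
  by rewrite (@box_val _ T _ [bseq of [:: true]]).
by rewrite (@box_val _ T _ [bseq of [:: false]]).
Qed.

Lemma Lambda_root n (T : n.+1.-bseq bool -> E) : Lambda T ->
  scale n.+1 / 100 <= distE G beta (subtree T false [bseq]) (subtree T true [bseq]).
Proof.
move=> hT.
have [_] := hT [bseq] [bseq of [:: false]] [bseq of [:: true]] erefl erefl.
rewrite /= subn0 /subtree; congr (_ <= distE _ _ (T _) (T _)); exact: val_inj.
Qed.

Definition leaves n (T : n.-bseq bool -> E) : set E :=
  \bigcup_(t in [set: n.-tuple bool]) box T t.

Lemma prod_tuple_cons n (F : n.+1.-tuple bool -> R) :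
  \prod_t F t = (\prod_(t : n.-tuple bool) F [tuple of false :: t]) *
                (\prod_(t : n.-tuple bool) F [tuple of true :: t]).
Proof.
rewrite (reindex (fun p : bool * n.-tuple bool => [tuple of p.1 :: p.2])) /=.
  rewrite -(pair_bigA _ (fun (b : bool) (t : n.-tuple bool) => F [tuple of b :: t])) /=.
  by rewrite (bigD1 false) //= (big_pred1 true) // => -[].
exists (fun t => (thead t, [tuple of behead t])) => [[b t]|t] _ /=.
  by rewrite theadE; congr pair; exact: val_inj.
by rewrite -tuple_eta.
Qed.

Variables (prob : set (E -> bool) -> R -> R) (lev : nat -> R) (q : R).
Variable Q : set (E -> bool) -> Prop.
Hypothesis prob0 : forall A u, 0 <= prob A u.
Hypothesis q0 : 0 <= q.
Hypothesis Qcap : forall n (A : n.-tuple bool -> set (E -> bool)),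
  (forall m, Q (A m)) -> Q (\bigcap_m A m).
Hypothesis decouple : forall n (T : n.+1.-bseq bool -> E) A1 A2, Lambda T ->
  Q A1 -> Q A2 ->
  local (fun x => `[< leaves (subtree T false) x >]) A1 ->
  local (fun x => `[< leaves (subtree T true) x >]) A2 ->
  prob (A1 `&` A2) (lev n.+1) <=
    (prob A1 (lev n) + (2 * q ^+ n.+1) ^+ (2 ^ n))
    * (prob A2 (lev n) + (2 * q ^+ n.+1) ^+ (2 ^ n)).

(** 2^n is the number of leaves below each child of the root, so [prod_add_ge] turns the error of
    [decouple] into one term [2 * q ^+ n.+1] per leaf, and the depths add up to a geometric sum. [Q]
    is increasing or decreasing, with [lev] the sequence [u_minus] or [u_plus]. *)
Lemma tree_decouple n (T : n.-bseq bool -> E) (A : n.-tuple bool -> set (E -> bool)) :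
  Lambda T -> (forall m, Q (A m)) ->
  (forall m : n.-tuple bool, local (fun x => `[< box T m x >]) (A m)) ->
  prob (\bigcap_m A m) (lev n) <=
    \prod_m (prob (A m) (lev 0%N) + 2 * \sum_(k < n) q ^+ k.+1).
Proof.
elim: n T A => [|n IH] T A hT QA locA.
  rewrite big_ord0 mulr0 (big_pred1 [tuple]); last first.
    by move=> t; symmetry; apply/eqP; exact: tuple0.
  rewrite addr0 (_ : \bigcap_m A m = A [tuple]) //.
  apply/seteqP; split => w; first by apply.
  by move=> h t _; rewrite (tuple0 t).
pose Ab b (t : n.-tuple bool) := A [tuple of b :: t].
have capE : \bigcap_m A m = (\bigcap_m Ab false m) `&` (\bigcap_m Ab true m).
  apply/seteqP; split => w.
    by move=> h; split => t _; exact: h.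
  by move=> [h1 h2] t _; case/tupleP: t => -[] t; [exact: h2|exact: h1].
have locb b (t : n.-tuple bool) : local (fun x => `[< box (subtree T b) t x >]) (Ab b t).
  move=> w w' h; apply: locA => x /asboolP hx; apply: h; apply/asboolP.
  by move: hx; rewrite box_subtree (@box_val _ T _ (cons_bseq b t)).
have locl b : local (fun x => `[< leaves (subtree T b) x >]) (\bigcap_m Ab b m).
  move=> w w' h hA t _; apply: (locb b t) (hA t Logic.I) => x /asboolP hx; apply: h.
  by apply/asboolP; exists t.
rewrite capE prod_tuple_cons.
apply: le_trans (decouple hT (Qcap (fun m => QA _)) (Qcap (fun m => QA _))
  (locl false) (locl true)) _.
set e := 2 * q ^+ n.+1.
have e0 : 0 <= e by rewrite mulr_ge0 // exprn_ge0.
have sub b : prob (\bigcap_m Ab b m) (lev n) + e ^+ (2 ^ n) <=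
   \prod_(t : n.-tuple bool) (prob (Ab b t) (lev 0%N) + 2 * \sum_(k < n.+1) q ^+ k.+1).
  have s0 : 0 <= \sum_(k < n) q ^+ k.+1 by apply: sumr_ge0 => k _; exact: exprn_ge0.
  have a0 (t : n.-tuple bool) :
      0 <= prob (Ab b t) (lev 0%N) + 2 * \sum_(k < n) q ^+ k.+1.
    by rewrite addr_ge0 // mulr_ge0.
  have cn : #|{: n.-tuple bool}| = (2 ^ n)%N by rewrite card_tuple card_bool.
  have h := IH _ (Ab b) (Lambda_subtree b hT) (fun m => QA _) (locb b).
  rewrite -cn; apply: (@le_trans _ _ (\prod_(t : n.-tuple bool)
      (prob (Ab b t) (lev 0%N) + 2 * \sum_(k < n) q ^+ k.+1) + e ^+ #|{: n.-tuple bool}|)).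
    by rewrite lerD2r.
  apply: le_trans (prod_add_ge _ a0 e0) _; first by rewrite cn expn_gt0.
  by apply: ler_prod => t _; rewrite addr_ge0 //= big_ord_recr /= mulrDr addrA.
by apply: ler_pM; rewrite ?addr_ge0 ?exprn_ge0 //; exact: sub.
Qed.

End Tree.

(** * Numerical estimates *)

Lemma powR_ge_of (R : realType) (s B x : R) : 0 < s -> 0 <= B ->
  B `^ s^-1 <= x -> B <= x `^ s.
Proof.
move=> s0 B0 h; have x0 : 0 <= x by apply: le_trans h; exact: powR_ge0.
rewrite -[leLHS]powRr1 // -(mulVf (lt0r_neq0 s0)) powRrM.
by apply: ge0_ler_powR; rewrite ?nnegrE ?powR_ge0 // ltW.
Qed.

(** Telescoping: for the square roots x and y of m+1 and m+2, (y - x)(y + x) = 1 yields y^(-3) <=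
    2/x - 2/y. *)
Lemma sum_three_half (R : realType) n :
  \sum_(k < n) (k.+1%:R `^ (3 / 2))^-1 <= 3 :> R.
Proof.
pose b k : R := k%:R `^ (1 / 2).
have b2 k : b k ^+ 2 = k%:R.
  by rewrite /b -powR_mulrn ?powR_ge0 // -powRrM divfK ?powRr1 // pnatr_eq0.
have b0 k : 0 < b k.+1 by rewrite powR_gt0.
have b3 k : k.+1%:R `^ (3 / 2) = b k.+1 ^+ 3.
  rewrite /b -powR_mulrn ?powR_ge0 // -powRrM; congr (_ `^ _).
  by lra.
suff h m : \sum_(k < m.+1) (k.+1%:R `^ (3 / 2))^-1 <= 3 - 2 / b m.+1.
  case: n => [|n]; first by rewrite big_ord0.
  apply: le_trans (h n) _; rewrite gerBl divr_ge0 //; exact/ltW.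
elim: m => [|m IH].
  by rewrite big_ord_recl big_ord0 addr0 b3 /b powR1 expr1n invr1; lra.
rewrite big_ord_recr /= b3; apply: le_trans (lerD IH (lexx _)) _.
have h2 : b m.+2 ^+ 2 = b m.+1 ^+ 2 + 1 by rewrite !b2 -natr1.
have := b0 m; have := b0 m.+1; move: h2; move: (b m.+2) (b m.+1) => y x h2 y0 x0.
have xy : x <= y by rewrite -(@ler_pXn2r _ 2) ?nnegrE ?ltW // h2; lra.
have e : 2 / x - 2 / y = 2 / (x * y * (x + y)).
  have e1 : (y - x) * (y + x) = 1 by rewrite -subr_sqr h2; ring.
  have xy0 : x + y != 0 by rewrite gt_eqF // addr_gt0.
  transitivity (2 * ((y - x) * (y + x)) / (x * y * (x + y))).
    by field; rewrite xy0 !gt_eqF.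
  by rewrite e1 mulr1.
have h3 : y ^- 3 <= 2 / (x * y * (x + y)).
  have yy : 0 < y * y by rewrite mulr_gt0.
  rewrite ler_pdivlMr ?mulr_gt0 ?addr_gt0 // mulrC ler_pdivrMr ?exprn_gt0 //.
  have -> : 2 * y ^+ 3 = (y * y) * (y + y) by ring.
  apply: ler_pM; rewrite ?lerD2r //.
  - by apply/ltW/mulr_gt0.
  - by apply/ltW/addr_gt0.
  - by rewrite ler_pM2r.
lra.
Qed.

Lemma prod_1D_le (R : realType) (x : nat -> R) n : (forall k, 0 <= x k) ->
  1 <= \prod_(k < n) (1 + x k) <= expR (\sum_(k < n) x k).
Proof.
move=> x0; elim: n => [|n /andP[IH1 IH2]].
  by rewrite !big_ord0 expR0 lexx.
rewrite !big_ord_recr /= expRD; apply/andP; split.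
  by rewrite -[leLHS]mulr1; apply: ler_pM => //; rewrite lerDl.
apply: ler_pM => //; rewrite ?addr_ge0 ?(le_trans _ IH1) //.
exact: expR_ge1Dx.
Qed.

(** * The sequences of levels and their limits *)

Section Levels.
Variables (R : realType) (c1 K nu nu' ell0 u0 : R).
Hypotheses (c10 : 0 < c1) (u00 : 0 < u0).

Definition incr k : R :=
  c1 * (Num.sqrt K / k.+1%:R `^ (3 / 2)) * ell0 `^ (- ((nu - nu') / 2)).

Lemma incr_ge0 k : 0 <= incr k.
Proof.
by rewrite /incr !mulr_ge0 ?powR_ge0 ?(ltW c10) ?invr_ge0 ?sqrtr_ge0 ?powR_ge0.
Qed.

Let M := c1 * Num.sqrt K * ell0 `^ (- ((nu - nu') / 2)) * 3.

Let sum_incr n : \sum_(k < n) incr k <= M.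
Proof.
rewrite (eq_bigr (fun k : 'I_n => c1 * Num.sqrt K * ell0 `^ (- ((nu - nu') / 2))
   * (k.+1%:R `^ (3 / 2))^-1)); last by move=> k _; rewrite /incr; ring.
rewrite -mulr_sumr; apply: ler_wpM2l; last exact: sum_three_half.
by rewrite !mulr_ge0 ?powR_ge0 ?(ltW c10) ?sqrtr_ge0.
Qed.

Let pr n := \prod_(k < n) (1 + incr k).

Let pr_ge1 n : 1 <= pr n.
Proof. by case/andP: (prod_1D_le n incr_ge0). Qed.

Let pr_le n : pr n <= expR M.
Proof.
case/andP: (prod_1D_le n incr_ge0) => _ /le_trans; apply.
by rewrite ler_expR.
Qed.

Local Notation up := (u_plus c1 K nu nu' ell0 u0).
Local Notation um := (u_minus c1 K nu nu' ell0 u0).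

Lemma u_plusE n : up n = pr n * u0.
Proof. by []. Qed.

Lemma u_minusE n : um n = (pr n)^-1 * u0.
Proof. by rewrite /u_minus prodfV. Qed.

Lemma u_plusS n : up n.+1 = (1 + incr n) * up n.
Proof. by rewrite !u_plusE /pr big_ord_recr /= -mulrA mulrCA. Qed.

Lemma u_minusS n : um n = (1 + incr n) * um n.+1.
Proof.
have h : 1 + incr n != 0 by rewrite gt_eqF // ltr_wpDr // incr_ge0.
have h' : pr n != 0 by rewrite gt_eqF // (lt_le_trans ltr01).
by rewrite !u_minusE /pr big_ord_recr /= -/(pr n); field; rewrite h' h.
Qed.

Lemma u_plus_ge n : u0 <= up n.
Proof. by rewrite u_plusE ler_peMl // ltW. Qed.

Let up_ndecr : nondecreasing_seq up.
Proof.
apply/nondecreasing_seqP => n; rewrite u_plusS ler_peMl //.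
  exact: le_trans (ltW u00) (u_plus_ge n).
by rewrite lerDl incr_ge0.
Qed.

Let um_gt0 n : 0 < um n.
Proof. by rewrite u_minusE mulr_gt0 // invr_gt0 (lt_le_trans ltr01). Qed.

Let um_nincr : nonincreasing_seq um.
Proof.
apply/nonincreasing_seqP => n; rewrite [leRHS]u_minusS ler_peMl ?(ltW (um_gt0 _)) //.
by rewrite lerDl incr_ge0.
Qed.

Lemma u_plus_le_infty n : up n <= u_plus_infty c1 K nu nu' ell0 u0.
Proof.
apply: nondecreasing_cvgn_le => //; apply: nondecreasing_is_cvgn => //.
exists (expR M * u0) => _ [m _ <-]; rewrite u_plusE.
by apply: ler_wpM2r; [exact: ltW|exact: pr_le].
Qed.

Let um_cvg : cvgn um.
Proof.
by apply: nonincreasing_is_cvgn => //; exists 0 => _ [m _ <-]; exact: ltW.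
Qed.

Lemma u_minus_infty_le n : u_minus_infty c1 K nu nu' ell0 u0 <= um n.
Proof. exact: nonincreasing_cvgn_ge. Qed.

(** The partial products stay below [expR M] because (k+1)^(-3/2) is summable. Positivity makes the
    error term at the limiting level meaningful. *)
Lemma u_minus_infty_gt0 : 0 < u_minus_infty c1 K nu nu' ell0 u0.
Proof.
apply: (@lt_le_trans _ _ ((expR M)^-1 * u0)).
  by rewrite mulr_gt0 // invr_gt0 expR_gt0.
apply: (cvg_seq_le (cvg_cst _) um_cvg) => n; rewrite u_minusE.
apply: ler_wpM2r; first exact: ltW.
by rewrite lef_pV2 ?posrE ?expR_gt0 ?pr_le // (lt_le_trans ltr01).
Qed.

End Levels.

(** 2^n counts leaves; three of the factors [n.+1] come from the squared increment and one from the
    power [q ^+ n.+1]. This fixes the requirement ell0^nu >= 32. *)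
Lemma pow2_quartic n : (2 ^ n * n.+1 ^ 4 <= 32 ^ n)%N.
Proof.
have h : (n.+1 <= 2 ^ n)%N by elim: n => // n IH; rewrite expnS mul2n -addnn -addn1 leq_add // expn_gt0.
rewrite (_ : 32 = 2 * 2 ^ 4)%N // expnMn leq_mul2l expn_eq0 /=.
by rewrite -expnM mulnC expnM leq_exp2r.
Qed.

(** * Conditions on ell0 and sizes of the errors *)

Section Numerics.
Variables (R : realType) (cg cg' nu nu' K ell0 L0 : R).
(* The scale [L_{n+1}] is [ra] radii, and [rb] and [rc] are the constants of the
   error and of the capacity condition of a decoupling step. *)
Variables (ra rb rc : R).
Hypotheses (ra0 : 0 < ra) (rb0 : 0 < rb) (rc0 : 0 < rc).
Hypotheses (cg0 : 0 < cg) (cg'0 : 0 < cg') (K0 : 0 < K).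
Hypothesis L01 : 1 <= L0.

Definition kappa1 : R := cg' * ra `^ nu.
(** At least 1 and at least [rb * kappa1], so its square divided by [rb * kappa1] is at least 1 in
    the error exponent. It involves neither [K] nor [nu'], as the order of quantifiers demands.
    [cap_cst] below gathers the constants of the capacity condition. *)
Definition c1_cst : R := 1 + rb * kappa1.
Definition cap_cst : R := (2 * rc) * kappa1 * 10 `^ nu / (cg * (c1_cst * Num.sqrt K)).

Hypothesis ell0_ge1 : 1 <= ell0.
Hypothesis ell0_32 : 32 <= ell0 `^ nu.
Hypothesis ell0_cap : cap_cst <= ell0 `^ ((nu + nu') / 2).
Hypothesis ell0_del : c1_cst * Num.sqrt K <= ell0 `^ ((nu - nu') / 2).

Lemma kap1_gt0 : 0 < kappa1.
Proof. by rewrite mulr_gt0 // powR_gt0. Qed.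

Lemma c1_cst_ge1 : 1 <= c1_cst.
Proof. by rewrite lerDl mulr_ge0 // ltW // kap1_gt0. Qed.

Let sK : 0 < Num.sqrt K. Proof. by rewrite sqrtr_gt0. Qed.
Let l0 : 0 < ell0. Proof. exact: lt_le_trans ell0_ge1. Qed.
Let L00 : 0 < L0. Proof. exact: lt_le_trans L01. Qed.
Let w := ell0 `^ nu.
Let e1 := ell0 `^ (- ((nu - nu') / 2)).
Let e10 : 0 < e1. Proof. exact: powR_gt0. Qed.
Let w0 : 0 < w. Proof. exact: powR_gt0. Qed.
Let c10 : 0 < c1_cst. Proof. exact: lt_le_trans c1_cst_ge1. Qed.

Let powM a b : ell0 `^ a * ell0 `^ b = ell0 `^ (a + b).
Proof. by rewrite powRD //; apply/implyP => _; rewrite gt_eqF. Qed.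

(** The origin of the exponent [nu'] in [epsilon]: the squared increment uses up one factor ell0^nu
    of the radius down to ell0^nu', and the other [n] factors pay for the leaves. *)
Let e1e1w : e1 ^+ 2 * w = ell0 `^ nu'.
Proof. by rewrite expr2 /e1 /w !powM; congr (_ `^ _); field. Qed.

Let e1w : e1 * w = ell0 `^ ((nu + nu') / 2).
Proof. by rewrite /e1 /w !powM; congr (_ `^ _); field. Qed.

Let e1c : c1_cst * Num.sqrt K * e1 <= 1.
Proof. by rewrite /e1 powRN ler_pdivrMr ?mul1r // powR_gt0. Qed.

Let t n : R := n.+1%:R `^ (3 / 2).
Let t0 n : 0 < t n. Proof. exact: powR_gt0. Qed.
Let tt n : t n ^+ 2 = n.+1%:R ^+ 3.
Proof.
rewrite /t -!powR_mulrn ?powR_ge0 // -powRrM; congr (_ `^ _); lra.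
Qed.
Let t_ge1 n : 1 <= t n.
Proof.
rewrite /t -[leLHS](powRr0 n.+1%:R).
by apply: ler_powR; rewrite ?ler1n //; lra.
Qed.
Let t_le n : t n <= n.+1%:R ^+ 4.
Proof.
rewrite /t -powR_mulrn ?ler0n //.
by apply: ler_powR; rewrite ?ler1n //; lra.
Qed.

Let quartic n : 2 ^+ n * n.+1%:R ^+ 4 <= w ^+ n.
Proof.
apply: (@le_trans _ _ (32 ^+ n)).
  by rewrite -!natrX -natrM ler_nat pow2_quartic.
by apply: lerXn2r => //; rewrite nnegrE ltW.
Qed.

Lemma incr_gt0 n : 0 < incr c1_cst K nu nu' ell0 n.
Proof. by rewrite /incr !mulr_gt0 // invr_gt0. Qed.

Lemma incr_le1 n : incr c1_cst K nu nu' ell0 n <= 1.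
Proof.
apply: le_trans e1c; rewrite /incr -/e1 -/(t n) mulrA ler_wpM2r ?(ltW e10) //.
by rewrite ler_pdivrMr // ler_peMr // mulr_ge0 // ltW.
Qed.

Definition rad n : R := scale ell0 L0 n.+1 / ra.
Definition kappa n : R := cg' * rad n `^ (- nu).

Let Dnu n : rad n `^ nu = w ^+ n.+1 * L0 `^ nu / ra `^ nu.
Proof.
have l1 : 0 <= ell0 ^+ n.+1 by apply/exprn_ge0/ltW.
have r1 : 0 <= ra^-1 by rewrite invr_ge0 ltW.
rewrite /rad /scale (powRM nu (mulr_ge0 l1 (ltW L00)) r1) (powRM nu l1 (ltW L00)).
have -> : (ell0 ^+ n.+1) `^ nu = w ^+ n.+1.
  rewrite -(powR_mulrn _ (powR_ge0 _ _)) -(powR_mulrn _ (ltW l0)).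
  by rewrite -!powRrM mulrC.
congr (_ * _ * _).
rewrite -(powR_inv1 (ltW ra0)) -(powR_inv1 (powR_ge0 ra nu)) -!powRrM.
by rewrite mulrC.
Qed.

Let kapnE n : kappa n = kappa1 / (w ^+ n.+1 * L0 `^ nu).
Proof.
rewrite /kappa powRN Dnu /kappa1 invfM invrK; ring.
Qed.

(** The 2^(n+1) leaves have capacity at most 2^(n+1) times the bound for one ball of radius 10 L0,
    while [kappa n] decays like w^(-(n+1)). [quartic] absorbs the factor [t n] of the increment, and
    [ell0_cap] the constants. *)
Lemma cap_small n :
  kappa n * (2 ^+ n.+1 * ((10 * L0) `^ nu / cg)) <= incr c1_cst K nu nu' ell0 n / rc.
Proof.
have Ln : 0 < L0 `^ nu by rewrite powR_gt0.
rewrite kapnE powRM ?(ltW L00) //.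
have -> : kappa1 / (w ^+ n.+1 * L0 `^ nu) * (2 ^+ n.+1 * (10 `^ nu * L0 `^ nu / cg))
   = ((2 * rc) * kappa1 * 10 `^ nu / cg) * (2 ^+ n / w ^+ n.+1) / rc.
  have wn : w ^+ n.+1 != 0 by rewrite gt_eqF // exprn_gt0.
  rewrite (exprS 2); move: wn; move: (w ^+ n.+1) (2 ^+ n) => x y x_n0.
  by field; rewrite x_n0 !gt_eqF.
apply: ler_wpM2r; first by rewrite invr_ge0 ltW.
have hc : (2 * rc) * kappa1 * 10 `^ nu / cg = cap_cst * (c1_cst * Num.sqrt K).
  by rewrite /cap_cst; field; rewrite !gt_eqF.
rewrite hc [leLHS]mulrA ler_pdivrMr ?exprn_gt0 //.
have -> : incr c1_cst K nu nu' ell0 n * w ^+ n.+1 =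
    c1_cst * Num.sqrt K * (e1 * w) * (w ^+ n / t n).
  by rewrite /incr -/e1 -/(t n) exprS; field; rewrite gt_eqF.
rewrite e1w.
have h : 2 ^+ n <= w ^+ n / t n.
  rewrite ler_pdivlMr //; apply: le_trans (quartic n).
  by apply: ler_wpM2l => //; exact: exprn_ge0.
have cc0 : 0 <= cap_cst * (c1_cst * Num.sqrt K).
  rewrite -hc; apply: divr_ge0; last exact: ltW.
  apply: mulr_ge0; last exact: powR_ge0.
  by apply: mulr_ge0; [apply: mulr_ge0 => //|]; apply: ltW => //; exact: kap1_gt0.
apply: ler_pM => //.
rewrite mulrC; apply: ler_wpM2l => //.
by apply/ltW/mulr_gt0.
Qed.

(** A common lower bound [ul] replaces the level of the step, so that all depths share one ratio
    [q]. *)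
Lemma step_err_small n (ul u : R) : 0 < ul -> ul <= u ->
  2 * expR (- (incr c1_cst K nu nu' ell0 n ^+ 2 * u / (rb * kappa n))) <=
  (2 * expR (- (K * ul * L0 `^ nu * ell0 `^ nu')) ^+ n.+1) ^+ (2 ^ n).
Proof.
move=> ul0 ulu; have Ln : 0 < L0 `^ nu by rewrite powR_gt0.
rewrite [leRHS]exprMn; apply: ler_pM => //.
  by apply: ler_eXnr; rewrite ?expn_gt0 // ler1n.
rewrite -exprM -expRM_natl ler_expR mulrN lerN2.
have -> : incr c1_cst K nu nu' ell0 n ^+ 2 * u / (rb * kappa n) =
   (c1_cst ^+ 2 / (rb * kappa1)) * (K * u * L0 `^ nu * ell0 `^ nu')
     * (w ^+ n / n.+1%:R ^+ 3).
  rewrite kapnE -e1e1w -tt /incr -/e1 -/(t n) -[in RHS](sqr_sqrtr (ltW K0)).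
  rewrite (exprS w n); have : w ^+ n != 0 by rewrite gt_eqF // exprn_gt0.
  move: (w ^+ n) => x x_n0.
  by field; rewrite x_n0 !gt_eqF // kap1_gt0.
have hc : 1 <= c1_cst ^+ 2 / (rb * kappa1).
  have k1 : 0 < rb * kappa1 by apply: mulr_gt0 => //; exact: kap1_gt0.
  rewrite (ler_pdivlMr _ _ k1) mul1r.
  apply: (@le_trans _ _ c1_cst); first by rewrite lerDr.
  by rewrite expr2 ler_peMr ?c1_cst_ge1 // ltW.
have hx : K * ul * L0 `^ nu * ell0 `^ nu' <= K * u * L0 `^ nu * ell0 `^ nu'.
  by rewrite !ler_wpM2r ?powR_ge0 // ler_wpM2l // ltW.
have x0 : 0 <= K * ul * L0 `^ nu * ell0 `^ nu'.
  by rewrite !mulr_ge0 ?powR_ge0 // ltW.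
have hn : (n.+1 * 2 ^ n)%:R <= w ^+ n / n.+1%:R ^+ 3.
  rewrite ler_pdivlMr ?exprn_gt0 //; apply: le_trans (quartic n).
  rewrite natrM natrX mulrAC -exprS mulrC //.
rewrite mulrC; apply: ler_pM => //.
by rewrite -[leLHS]mul1r; apply: ler_pM.
Qed.

End Numerics.

(** * Assembly *)

(** The sets that depend only on the coordinates in [C] form a sigma-algebra containing the
    generators. *)
Lemma sigma_coord_local (E : choiceType) (C : set E) (A : set (E -> bool)) :
  <<s coord_system bool C >> A -> local (fun x => `[< C x >]) A.
Proof.
pose H : set (set (E -> bool)) := [set B | local (fun x => `[< C x >]) B].
suff sub : <<s coord_system bool C >> `<=` H by move=> /sub.
have sym (w w' : E -> bool) : (forall x, `[< C x >] -> w x = w' x) ->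
  forall x, `[< C x >] -> w' x = w x by move=> h x /h.
apply: smallest_sub; last first.
  move=> _ [i Ci [Y _ <-]] w w' h [_ wY]; split => //=.
  by rewrite -h //; apply/asboolP.
split.
- by move=> w w' _ [].
- move=> B hB w w' h [_ nB]; split => // hw'; apply: nB.
  exact: hB (sym _ _ h) hw'.
- by move=> F hF w w' h [i _ Fi]; exists i => //; exact: hF h Fi.
Qed.

(** * Decoupling along the tree of boxes *)

Section Final.
Variables (R : realType) (V : pointedType) (G : weighted_graph R V).
Local Notation E := (V * int)%type.
Variables (beta nu : R).
Hypotheses (hbeta : 2 <= beta) (nu0 : 0 < nu).
Variable P : E -> probability (paths E) R.
Hypothesis hP : walk_law G P.
Variables (cg cg' : R).
Hypotheses (cg0 : 0 < cg) (cg'0 : 0 < cg').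
Local Notation dist := (distE G beta).
Hypothesis hgreen : forall x x', ((cg * Num.max (dist x x') 1 `^ (- nu))%:E
  <= green G P x x' <= (cg' * Num.max (dist x x') 1 `^ (- nu))%:E)%E.
Variables (K nu' : R).
Hypothesis K0 : 0 < K.
Variables (ra rb rc : R).
Hypotheses (raE : ra = 1200) (rbE : rb = 18432) (rcE : rc = 576).
Local Notation c1 := (c1_cst cg' nu ra rb).
Variables (ell0 L0 : R).
Hypotheses (ell0_ge : 10 * ra <= ell0) (L01 : 1 <= L0).
Hypothesis ell0_32 : 32 <= ell0 `^ nu.
Hypothesis ell0_cap : cap_cst cg cg' nu K ra rb rc <= ell0 `^ ((nu + nu') / 2).
Hypothesis ell0_del : c1 * Num.sqrt K <= ell0 `^ ((nu - nu') / 2).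
Variables (d : measure_display) (Omega : measurableType d).
Variables (mu : probability Omega R) (I : R -> Omega -> set E).
Hypothesis hI : random_interlacements G P mu I.
Local Notation prob := (prob mu I).
Local Notation box := (box G beta ell0 L0).
Local Notation Lambda := (Lambda G beta ell0 L0).
Local Notation leaves := (leaves G beta ell0 L0).
Local Notation incr := (incr c1 K nu nu' ell0).

Let ra0 : 0 < ra. Proof. by rewrite raE ltr0n. Qed.
Let rb0 : 0 < rb. Proof. by rewrite rbE ltr0n. Qed.
Let rc0 : 0 < rc. Proof. by rewrite rcE ltr0n. Qed.

Let ell0_ge1 : 1 <= ell0.
Proof.
apply: le_trans ell0_ge; rewrite raE -natrM ler1n.
by rewrite muln_gt0.
Qed.

Let finite_box n (T : n.-bseq bool -> E) m : finite_set (box T m).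
Proof. exact: finite_ballE. Qed.

Let finite_leaves n (T : n.-bseq bool -> E) : finite_set (leaves T).
Proof. by apply: bigcup_finite => // t _; exact: finite_box. Qed.

Definition points (C : set E) : seq E := finmap.enum_fset (fset_set C).

Let points_uniq C : uniq (points C). Proof. exact: finmap.fset_uniq. Qed.

Let mem_points C x : finite_set C -> (x \in points C) = `[< C x >].
Proof. by move=> fC; rewrite in_fset_set. Qed.

Let rad_ge1 n : 1 <= rad ell0 L0 ra n.
Proof.
rewrite /rad /scale (ler_pdivlMr _ _ ra0) mul1r.
apply: (@le_trans _ _ ell0).
  by apply: le_trans ell0_ge; rewrite ler_peMl ?(ltW ra0) // ler1n.
rewrite exprS -mulrA ler_peMr ?(le_trans _ ell0_ge1) //.
by rewrite -[leLHS]mulr1; apply: ler_pM => //; exact: exprn_ege1.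
Qed.

(** The box of a child of the root has radius 10 L_n, and ell0 >= 12000 makes it fit into the radius
    L_{n+1}/1200. *)
Let scale_rad n : 10 * scale ell0 L0 n <= rad ell0 L0 ra n.
Proof.
have -> : rad ell0 L0 ra n = ell0 * scale ell0 L0 n / ra.
  by rewrite /rad /scale exprS mulrA.
rewrite (ler_pdivlMr _ _ ra0) mulrAC; apply: ler_wpM2r => //.
apply: mulr_ge0; last exact: le_trans L01.
by apply: exprn_ge0; exact: le_trans ell0_ge1.
Qed.

Let leaves_near n (T : n.+1.-bseq bool -> E) b x : Lambda T ->
  leaves (subtree T b) x -> dist (subtree T b [bseq]) x <= rad ell0 L0 ra n.
Proof.
move=> hT [t _ /(leaf_box (Lambda_subtree b hT))].
by rewrite /box /Defs.ballE /= subn0 => /le_trans; apply.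
Qed.

Let leaves_sub n (T : n.+1.-bseq bool -> E) b x :
  leaves (subtree T b) x -> leaves T x.
Proof.
move=> [t _ h]; exists [tuple of b :: t] => //; move: h.
by rewrite box_subtree (@box_val _ _ G beta ell0 L0 _ T _ [tuple of b :: t]).
Qed.

Let leaves_split n (T : n.+1.-bseq bool -> E) x : leaves T x ->
  exists b, leaves (subtree T b) x.
Proof.
move=> [t _]; case/tupleP: t => b t h; exists b; exists t => //; move: h.
by rewrite box_subtree (@box_val _ _ G beta ell0 L0 _ T _ (cons_bseq b t)).
Qed.

Let capac_leaves n (T : n.-bseq bool -> E) :
  capac (@nbE R V G) (@pE R V G) (rhoE G) (points (leaves T))
    <= 2 ^+ n * ((10 * L0) `^ nu / cg).
Proof.
pose cj (t : n.-tuple bool) := points (box T t).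
have h := @capac_sub _ _ G (points (leaves T)) _ cj (points_uniq _)
  (fun t => points_uniq _).
apply: le_trans (h _ _) _.
- move=> t x; rewrite !mem_points // => /asboolP hx; apply/asboolP.
  by exists t.
- move=> x; rewrite mem_points // => /asboolP[t _ hx]; exists t.
  by rewrite mem_points //; apply/asboolP.
apply: (@le_trans _ _ (\sum_(t : n.-tuple bool) (10 * L0) `^ nu / cg)).
  apply: ler_sum => t _.
  have r1 : 1 <= 10 * L0.
    by rewrite -[leLHS]mulr1; apply: ler_pM; rewrite ?ler1n ?ler01.
  apply: (capac_ball nu0 hP cg0 hgreen (points_uniq _) r1 (x := T t)) => y.
  rewrite mem_points // => /asboolP.
  by rewrite /box /Defs.ballE /= size_tuple subnn /scale expr0 mul1r.
by rewrite sumr_const card_tuple card_bool -natrX [leRHS]mulr_natl.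
Qed.

Let err n u := step_err nu cg' (rad ell0 L0 ra n) (incr n) u.

Let err_le n ul u : 0 < ul -> ul <= u ->
  err n u <= (2 * expR (- (K * ul * L0 `^ nu * ell0 `^ nu')) ^+ n.+1) ^+ (2 ^ n).
Proof. by rewrite /err /step_err -rbE; exact: step_err_small. Qed.

Let err_ge0 n u : 0 <= err n u.
Proof. by apply: mulr_ge0; [exact: ler0n|exact: expR_ge0]. Qed.

Let tree_step n (T : n.+1.-bseq bool -> E) A1 A2 u : Lambda T -> 0 <= u ->
  local (fun x => `[< leaves (subtree T false) x >]) A1 ->
  local (fun x => `[< leaves (subtree T true) x >]) A2 ->
  (increasing_event A1 -> increasing_event A2 ->
     prob (A1 `&` A2) u <= (prob A1 ((1 + incr n) * u) + err n u)
                           * (prob A2 ((1 + incr n) * u) + err n u)) /\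
  (decreasing_event A1 -> decreasing_event A2 ->
     prob (A1 `&` A2) ((1 + incr n) * u) <=
       (prob A1 u + err n u) * (prob A2 u + err n u)).
Proof.
move=> hT u0 l1 l2.
(* The children are L_{n+1}/100 apart, which is 12 radii since 1200 is 12 times 100. *)
have x12 : 12 * rad ell0 L0 ra n <=
    dist (subtree T false [bseq]) (subtree T true [bseq]).
  apply: le_trans (Lambda_root hT).
  have e : ra = 12 * 100 by rewrite raE -natrM.
  have n12 : 12 != 0 :> R by rewrite pnatr_eq0.
  by rewrite /rad e invfM mulrCA (mulVKf n12).
have cs12 x : x \in points (leaves T) ->
    dist (subtree T false [bseq]) x <= rad ell0 L0 ra n \/
    dist (subtree T true [bseq]) x <= rad ell0 L0 ra n.
  rewrite mem_points // => /asboolP/leaves_split[b hb].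
  by have := leaves_near hT hb; case: b hb => _ ?; [right|left].
have del01 : 0 < incr n <= 1 by rewrite incr_gt0 // incr_le1.
have kc : cg' * rad ell0 L0 ra n `^ (- nu) *
    capac (@nbE R V G) (@pE R V G) (rhoE G) (points (leaves T)) <= incr n / 576.
  rewrite -rcE.
  apply: le_trans (cap_small ra0 rb0 rc0 cg0 cg'0 K0 L01 ell0_ge1 ell0_32 ell0_cap n).
  apply: ler_wpM2l; last exact: capac_leaves.
  by rewrite mulr_ge0 ?powR_ge0 // ltW.
have loc b A : local (fun x => `[< leaves (subtree T b) x >]) A ->
    local (fun x => (x \in points (leaves T)) &&
      (dist (subtree T b [bseq]) x <= rad ell0 L0 ra n)) A.
  move=> lA w w' h; apply: lA => x /asboolP hx; apply: h.
  rewrite mem_points // (leaves_near hT hx) andbT; apply/asboolP.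
  exact: leaves_sub hx.
have l1' := loc false _ l1; have l2' := loc true _ l2.
split => i1 i2.
  exact: (step_increasing hbeta nu0 hP cg0 hgreen hI (points_uniq _)
    (rad_ge1 n) x12 cs12 del01 u0 kc l1' l2').
exact: (step_decreasing hbeta nu0 hP cg0 hgreen hI (points_uniq _)
    (rad_ge1 n) x12 cs12 del01 u0 kc l1' l2').
Qed.

Variables (u0 : R).
Hypothesis u00 : 0 < u0.
Let c10 : 0 < c1.
Proof. exact: lt_le_trans ltr01 (c1_cst_ge1 nu ra0 rb0 cg'0). Qed.

Local Notation up := (u_plus c1 K nu nu' ell0 u0).
Local Notation um := (u_minus c1 K nu nu' ell0 u0).
Local Notation um_infty := (u_minus_infty c1 K nu nu' ell0 u0).
Local Notation up_infty := (u_plus_infty c1 K nu nu' ell0 u0).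
Local Notation eps := (epsilon K nu nu' ell0 L0).

Let qq u := expR (- (K * u * L0 `^ nu * ell0 `^ nu')).

(** [epsilon] is twice the full geometric series, of which a tree of depth [n] sees a partial
    sum. *)
Let geom_eps n u : 0 < u -> 2 * \sum_(k < n) qq u ^+ k.+1 <= eps u.
Proof.
move=> u1; have q0 : 0 < qq u by exact: expR_gt0.
have q1 : qq u < 1.
  rewrite -expR0 ltr_expR oppr_lt0 !mulr_gt0 ?powR_gt0 //.
    exact: lt_le_trans L01.
  exact: lt_le_trans ell0_ge1.
rewrite /epsilon -/(qq u) -mulrA; apply: ler_wpM2l => //.
suff -> : \sum_(k < n) qq u ^+ k.+1 = qq u * (1 - qq u ^+ n) / (1 - qq u).
  rewrite ler_wpM2r ?invr_ge0 ?subr_ge0 ?(ltW q1) // ler_piMr ?(ltW q0) //.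
  by rewrite gerBl exprn_ge0 // ltW.
have q1n : 1 - qq u != 0 by rewrite subr_eq0 eq_sym lt_eqF.
elim: n => [|n IH]; first by rewrite big_ord0 expr0 subrr mulr0 mul0r.
rewrite big_ord_recr /= IH exprS; field.
by rewrite q1n.
Qed.

Let Im u x : 0 <= u -> measurable [set om | I u om x].
Proof. by case: hI => h _ _; exact: h. Qed.

Let event_meas n (T : n.-bseq bool -> E) (t : n.-tuple bool) A u : 0 <= u ->
  local (fun x => `[< box T t x >]) A -> measurable (event_at I A u).
Proof.
move=> u1 lA.
have lA' : local (mem (points (box T t))) A.
  by move=> w w' h; apply: lA => x hx; apply: h; rewrite /= mem_points.
exact: (event_trace mu (fun x => Im x u1) lA').2.
Qed.

Let event_bigcap n (A : n.-tuple bool -> set (E -> bool)) u :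
  event_at I (\bigcap_m A m) u = \bigcap_m event_at I (A m) u.
Proof. by []. Qed.

Let bigcap_meas n (T : n.-bseq bool -> E) (A : n.-tuple bool -> set (E -> bool)) u :
  0 <= u -> (forall m : n.-tuple bool, local (fun x => `[< box T m x >]) (A m)) ->
  measurable (\bigcap_m event_at I (A m) u).
Proof.
move=> u1 lA; apply: fin_bigcap_measurable => // t _.
exact: event_meas u1 (lA t).
Qed.

Let final_bound n (T : n.-bseq bool -> E) (A : n.-tuple bool -> set (E -> bool)) u ul :
  0 <= u -> 0 < ul ->
  (forall m : n.-tuple bool, local (fun x => `[< box T m x >]) (A m)) ->
  prob (\bigcap_m A m) u <=
    \prod_m (prob (A m) u0 + 2 * \sum_(k < n) qq ul ^+ k.+1) ->
  (mu (\bigcap_m event_at I (A m) u) <=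
    \prod_(m : n.-tuple bool) (mu (event_at I (A m) u0) + (eps ul)%:E))%E.
Proof.
move=> u1 ul0 lA h.
rewrite (eq_bigr (fun m => (prob (A m) u0 + eps ul)%:E)); last first.
  move=> m _; rewrite EFinD fineK // fin_num_measure //.
  by apply: event_meas (lA m); exact: ltW.
rewrite prodEFin -event_bigcap -[leLHS]fineK; last first.
  by rewrite fin_num_measure //; exact: bigcap_meas lA.
rewrite lee_fin; apply: le_trans h _; apply: ler_prod => m _.
rewrite addr_ge0 ?prob_ge0 ?mulr_ge0 ?sumr_ge0 //=; last first.
  by move=> k _; rewrite exprn_ge0 // expR_ge0.
by rewrite lerD2l geom_eps.
Qed.

Let um_infty0 : 0 < um_infty.
Proof. exact: u_minus_infty_gt0. Qed.

Let um_ge n : um_infty <= um n.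
Proof. exact: u_minus_infty_le. Qed.

(** The levels grow with the depth, so [u0] bounds them all from below and the errors are those at
    [u0]. *)
Lemma decreasing_decoupling n (T : n.-bseq bool -> E)
    (A : n.-tuple bool -> set (E -> bool)) : Lambda T ->
  adapted G beta ell0 L0 T A -> (forall m, decreasing_event (A m)) ->
  (mu (\bigcap_m event_at I (A m) up_infty)
     <= mu (\bigcap_m event_at I (A m) (up n)))%E /\
  (mu (\bigcap_m event_at I (A m) (up n))
     <= \prod_(m : n.-tuple bool) (mu (event_at I (A m) u0) + (eps u0)%:E))%E.
Proof.
move=> hT adA dA.
have lA m := sigma_coord_local (adA m).
have up_ge k : u0 <= up k by exact: u_plus_ge.
have up0 k : 0 <= up k by apply: le_trans (up_ge k); exact: ltW.
have upi : up n <= up_infty by exact: u_plus_le_infty.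
split.
  apply: le_measure; rewrite ?inE.
  - by apply: (bigcap_meas (T := T)) => //; exact: le_trans upi.
  - exact: (bigcap_meas (T := T)).
  - move=> om h m _; apply: dA (h m Logic.I) => x /set_mem Ix; apply/mem_set.
    by case: hI => _ mono _; exact: mono Ix.
apply: (final_bound _ _ lA) => //.
have lev0 : up 0%N = u0 by rewrite /u_plus big_ord0 mul1r.
have := @tree_decouple _ _ G beta ell0 L0 prob up (qq u0)
  (@decreasing_event E) _ _ _ _ n T A hT _ lA.
rewrite lev0; apply => //.
- by move=> B u; exact: prob_ge0.
- exact: expR_ge0.
- by move=> k B hB w w' ww' h m _; apply: hB ww' (h m Logic.I).
move=> k T' A1 A2 hT' d1 d2 l1 l2; rewrite u_plusS.
apply: le_trans ((tree_step hT' (up0 k) l1 l2).2 d1 d2) _.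
by apply: ler_pM; rewrite ?addr_ge0 ?prob_ge0 // lerD2l err_le.
Qed.

(** The levels shrink with the depth: by [u_minusS] a step raises level [k.+1] to level [k], and
    only the limiting level is a lower bound valid at every depth. *)
Lemma increasing_decoupling n (T : n.-bseq bool -> E)
    (A : n.-tuple bool -> set (E -> bool)) : Lambda T ->
  adapted G beta ell0 L0 T A -> (forall m, increasing_event (A m)) ->
  (mu (\bigcap_m event_at I (A m) um_infty)
     <= mu (\bigcap_m event_at I (A m) (um n)))%E /\
  (mu (\bigcap_m event_at I (A m) (um n))
     <= \prod_(m : n.-tuple bool) (mu (event_at I (A m) u0) + (eps um_infty)%:E))%E.
Proof.
move=> hT adA iA.
have lA m := sigma_coord_local (adA m).
have um0 k : 0 <= um k by apply: le_trans (um_ge k); exact: ltW.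
split.
  apply: le_measure; rewrite ?inE.
  - by apply: (bigcap_meas (T := T)) => //; exact: ltW.
  - exact: (bigcap_meas (T := T)).
  - move=> om h m _; apply: iA (h m Logic.I) => x /set_mem Ix; apply/mem_set.
    by case: hI => _ mono _; apply: mono Ix => //; exact: ltW.
apply: (final_bound _ _ lA) => //.
have lev0 : um 0%N = u0 by rewrite /u_minus big_ord0 mul1r.
have := @tree_decouple _ _ G beta ell0 L0 prob um (qq um_infty)
  (@increasing_event E) _ _ _ _ n T A hT _ lA.
rewrite lev0; apply => //.
- by move=> B u; exact: prob_ge0.
- exact: expR_ge0.
- by move=> k B hB w w' ww' h m _; apply: hB ww' (h m Logic.I).
move=> k T' A1 A2 hT' d1 d2 l1 l2.
apply: le_trans ((tree_step hT' (um0 k.+1) l1 l2).1 d1 d2) _.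
rewrite -u_minusS //.
by apply: ler_pM; rewrite ?addr_ge0 ?prob_ge0 // lerD2l err_le.
Qed.

End Final.

Lemma le_of_sum (R : realFieldType) (b a x y z t : R) :
  0 <= b -> 0 <= a -> 0 <= x -> 0 <= y -> 0 <= z -> b + (a + x + y + z) <= t ->
  [/\ a <= t, x <= t, y <= t & z <= t].
Proof. by move=> *; split; lra. Qed.

Theorem theorem2p6 (R : realType) (V : pointedType) (G : weighted_graph R V)
    (alpha beta nu : R)
    (halpha : 1 < alpha) (hvol : volume_growth G alpha)
    (hbeta : 2 <= beta <= 1 + alpha) (hnu : nu = alpha - beta / 2)
    (P : V * int -> probability (paths (V * int)%type) R)
    (hP : walk_law G P) (hgreen : green_bounds G P beta nu)
    (c0 : R) (hc0 : 1 < c0) (hharnack : harnack G beta c0) :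
  exists2 c1 : R, 0 < c1 &
  forall K nu' : R, 0 < K -> 0 < nu' < nu ->
  exists2 c : R, 10 ^+ 6 * c0 <= c &
  forall ell0 L0 : R, c <= ell0 -> 1 <= L0 ->
  forall (d : measure_display) (Omega : measurableType d)
    (mu : probability Omega R) (I : R -> Omega -> set (V * int)),
  random_interlacements G P mu I ->
  forall (u0 : R) (n : nat) (T : n.-bseq bool -> V * int),
  0 < u0 -> Lambda G beta ell0 L0 T ->
  let up := u_plus c1 K nu nu' ell0 u0 in
  let um := u_minus c1 K nu nu' ell0 u0 in
  let up_infty := u_plus_infty c1 K nu nu' ell0 u0 in
  let um_infty := u_minus_infty c1 K nu nu' ell0 u0 in
  let eps := epsilon K nu nu' ell0 L0 in
  (forall A : n.-tuple bool -> set (V * int -> bool),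
     adapted G beta ell0 L0 T A -> (forall m, decreasing_event (A m)) ->
     (mu (\bigcap_m event_at I (A m) up_infty)
        <= mu (\bigcap_m event_at I (A m) (up n)))%E /\
     (mu (\bigcap_m event_at I (A m) (up n))
        <= \prod_(m : n.-tuple bool)
             (mu (event_at I (A m) u0) + (eps u0)%:E))%E) /\
  (forall B : n.-tuple bool -> set (V * int -> bool),
     adapted G beta ell0 L0 T B -> (forall m, increasing_event (B m)) ->
     (mu (\bigcap_m event_at I (B m) um_infty)
        <= mu (\bigcap_m event_at I (B m) (um n)))%E /\
     (mu (\bigcap_m event_at I (B m) (um n))
        <= \prod_(m : n.-tuple bool)
             (mu (event_at I (B m) u0) + (eps um_infty)%:E))%E).
Proof.
have [hb2 _] := andP hbeta.
have [cg [cg' [cg0 hg]]] := hgreen.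
have cg'0 : 0 < cg' := green_cst_gt0 cg0 hg.
(* Only the upper Green constant and [nu] enter; 1200 is the number of radii in L_{n+1} and 18432
   the constant of [step_err]. *)
pose c1 := c1_cst cg' nu 1200 18432.
have c10 : 0 < c1.
  by apply: lt_le_trans (c1_cst_ge1 nu _ _ cg'0); rewrite ?ltr0n ?ltr01.
exists c1 => // K nu' K0 /andP[nu'0 nu'nu].
have nu0 : 0 < nu by exact: lt_trans nu'nu.
pose capc := cap_cst cg cg' nu K 1200 18432 576.
have capc0 : 0 <= capc.
  rewrite /capc /cap_cst -/c1; apply: divr_ge0; last first.
    by apply: mulr_ge0; [exact: ltW|apply: mulr_ge0; [exact: ltW|exact: sqrtr_ge0]].
  apply: mulr_ge0; last exact: powR_ge0.
  apply: mulr_ge0; first by apply: mulr_ge0; exact: ler0n.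
  by apply: mulr_ge0; [exact: ltW|exact: powR_ge0].
(* ell0^s exceeds a bound B once ell0 exceeds B^(1/s); this gives one threshold for each of the
   three power conditions. Being nonnegative, they can simply be added up in the constant. *)
pose e1 : R := 32 `^ nu^-1.
pose e2 : R := capc `^ ((nu + nu') / 2)^-1.
pose e3 : R := (c1 * Num.sqrt K) `^ ((nu - nu') / 2)^-1.
have [e10 e20 e30] : [/\ 0 <= e1, 0 <= e2 & 0 <= e3] by split; exact: powR_ge0.
have b0 : 0 <= 10 ^+ 6 * c0.
  by apply: mulr_ge0; [exact/exprn_ge0/ler0n|exact/ltW/(lt_trans ltr01)].
have a0 : 0 <= 10 * 1200 :> R by apply: mulr_ge0; exact: ler0n.
exists (10 ^+ 6 * c0 + (10 * 1200 + e1 + e2 + e3)).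
  by rewrite lerDl (addr_ge0 (addr_ge0 (addr_ge0 a0 e10) e20) e30).
move=> ell0 L0 hell L01.
have [h1 h2 h3 h4] := le_of_sum b0 a0 e10 e20 e30 hell.
move=> d Omega mu I hI u0 n T u00 hT.
have h32 : 32 <= ell0 `^ nu by apply: powR_ge_of.
have hcap : capc <= ell0 `^ ((nu + nu') / 2).
  by apply: powR_ge_of => //; apply: divr_gt0; [apply: addr_gt0|].
have hdel : c1 * Num.sqrt K <= ell0 `^ ((nu - nu') / 2).
  apply: powR_ge_of => //; first by apply: divr_gt0; rewrite ?subr_gt0.
  by apply: mulr_ge0; [exact: ltW|exact: sqrtr_ge0].
split=> A adA hA.
  exact: (decreasing_decoupling hb2 nu0 hP cg0 cg'0 hg K0 erefl erefl erefl h1 L01 h32 hcap hdel hI u00 hT adA hA).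
exact: (increasing_decoupling hb2 nu0 hP cg0 cg'0 hg K0 erefl erefl erefl h1 L01 h32 hcap hdel hI u00 hT adA hA).
Qed.
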